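(* The rational self-map $\lambda_{\{2\},\{3\}}:\mathcal{R}_7\dashrightarrow\mathcal{R}_7$ (equivalently of the quartic surface $Z_7$) is a dominant rational map of degree $4$.
   Context: Over $\mathbb{C}$. For a line arrangement $\mathcal{C}$, $\Lambda_{\{2\},\{3\}}(\mathcal{C})$ is the union of lines containing exactly three double points (points where exactly two lines meet) of $\mathcal{C}$. $M_7$ is the rank-3 matroid on $\{1,\dots,7,1',\dots,7'\}$ in which every 3-subset is a basis except the triples $\{a,b,c'\}$ with $a\neq b\in\{1,\dots,7\}$, $a+b\equiv 2c\pmod 7$. A realization is a labeled family of 14 distinct lines such that three are concurrent iff their labels form a non-basis; $\mathcal{R}_7$ is the moduli space of $\mathrm{PGL}_3$-orbits of realizations. It is known that $\mathcal{R}_7$ is a dense open subset of the quartic surface $Z_7\subset\mathbb{P}^3$: $y_1^2y_2^2+y_1^2y_2y_3-y_1y_2^2y_3-y_1y_2y_3^2-y_1^2y_2y_4-y_1y_2^2y_4+y_1y_2y_3y_4-y_2y_3^2y_4+y_1y_2y_4^2+y_3^2y_4^2=0$. For a generic realization $(\ell_1,\dots,\ell_7,\ell'_1,\dots,\ell'_7)$, setting $\ell''_j=\Lambda_{\{2\},\{3\}}(\sum_{k\neq j}\ell'_k)$ yields a realization $(\ell'_1,\dots,\ell'_7,\ell''_1,\dots,\ell''_7)$; $\lambda_{\{2\},\{3\}}$ is the induced rational map on $\mathcal{R}_7$ sending the class of the first to the class of the second. *)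

(* Defs.v *)
(* The base field is C := R[i] for R : realType
   (a complete archimedean ordered field, i.e. the real numbers up to
   isomorphism), so C is (isomorphic to) the complex numbers. *)
From HB Require Import structures.
From mathcomp Require Import all_boot all_order all_algebra.
From mathcomp Require Import reals.
From mathcomp Require Import complex.
From mathcomp Require mpoly.
Set Implicit Arguments. Unset Strict Implicit. Unset Printing Implicit Defensive.
Import Order.TTheory GRing.Theory Num.Theory.
Local Open Scope ring_scope.

Section Defs.
Variable C : fieldType.

(* Homogeneous coordinates: both points and lines of P^2 are nonzero row
   vectors in C^3; two vectors represent the same point/line iff proportional. *)
Definition proj_eq (u v : 'rV[C]_3) : Prop :=
  exists c : C, c != 0 /\ u = c *: v.

Definition incid (a p : 'rV[C]_3) : bool := \sum_(i < 3) a 0 i * p 0 i == 0.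

(* Labels of M_7: inl a = a+1 (unprimed), inr c = (c+1)' (primed). *)
Definition label := ('I_7 + 'I_7)%type.

(* The non-bases of M_7: {a, b, c'} with a <> b, a + b = 2c (mod 7).
   (Shifting labels 1..7 to 0..6 does not change the congruence.) *)
Definition M7_nonbasis (S : {set label}) : bool :=
  [exists a : 'I_7, exists b : 'I_7, exists c : 'I_7,
     [&& a != b, (a + b == 2 * c %[mod 7])%N & S == [set inl a; inl b; inr c]]].

Definition concurrent (a b c : 'rV[C]_3) : Prop :=
  exists p : 'rV[C]_3, [/\ p != 0, incid a p, incid b p & incid c p].

Definition realization (L : label -> 'rV[C]_3) : Prop :=
  [/\ forall x, L x != 0,
      forall x y, x != y -> ~ proj_eq (L x) (L y) &
      forall x y z, x != y -> y != z -> x != z ->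
        (concurrent (L x) (L y) (L z) <-> M7_nonbasis [set x; y; z])].

Definition PGL_equiv (L L' : label -> 'rV[C]_3) : Prop :=
  exists g : 'M[C]_3, g \in unitmx /\ forall x, proj_eq (L' x) (L x *m g).

Definition double_point (A : {set label}) (L : label -> 'rV[C]_3)
  (p : 'rV[C]_3) : bool :=
  (p != 0) && (#|[set i in A | incid (L i) p]| == 2)%N.

Definition three_double_points (A : {set label}) (L : label -> 'rV[C]_3)
  (m : 'rV[C]_3) : Prop :=
  exists p1 p2 p3 : 'rV[C]_3,
    [/\ double_point A L p1 && incid m p1,
        double_point A L p2 && incid m p2,
        double_point A L p3 && incid m p3,
        [/\ ~ proj_eq p1 p2, ~ proj_eq p1 p3 & ~ proj_eq p2 p3] &
        forall q, double_point A L q -> incid m q ->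
          [\/ proj_eq q p1, proj_eq q p2 | proj_eq q p3]].

(* Lambda_{2,3} of the arrangement {L i, i in A} is exactly the line m:
   m is a line containing exactly three double points, and it is the only
   such line (so the union of all such lines is m). *)
Definition Lambda23_is_line (A : {set label}) (L : label -> 'rV[C]_3)
  (m : 'rV[C]_3) : Prop :=
  m != 0 /\ three_double_points A L m /\
  forall m', m' != 0 -> three_double_points A L m' -> proj_eq m' m.

(* The construction: from the realization L = (l_1..l_7, l'_1..l'_7) it
   produces N = (l'_1..l'_7, l''_1..l''_7) with
   l''_j = Lambda_{2,3}(sum_{k <> j} l'_k), and N is again a realization.
   lambda23 L N means that lambda_{2,3} is defined at [L] via this
   construction and sends [L] to [N]. *)
Definition lambda23 (L N : label -> 'rV[C]_3) : Prop :=
  [/\ realization L, realization N,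
      forall j : 'I_7, proj_eq (N (inl j)) (L (inr j)) &
      forall j : 'I_7,
        Lambda23_is_line [set inr k | k in [set~ j]] L (N (inr j))].

Definition nvars := #|{: label * 'I_3}|.
Definition coords (L : label -> 'rV[C]_3) : 'I_nvars -> C :=
  fun k => let: (x, i) := enum_val k in L x 0 i.

End Defs.

(* Main.v *)
(* Dualizing, a realization becomes seven points p_a and seven points q_c with
   p_a, p_b, q_c collinear iff a + b = 2c (a <> b), and lambda_{2,3} sends (p, q) to
   (q, r), where r_c is the common point of the three lines q_a q_b, a + b = 2c.
   All these points lie on one plane cubic E, on which p_a = x + a t with t of order
   7, q_c = - 2 (x + c t) and r_c = 4 (x + c t), collinearity meaning sum zero.
   Hence the realizations mapped to (q, r) are given by the solutions p_0 of
   2 p_0 = - q_0, that is, by the points of E whose tangent passes through q_0. These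
   are four for a generic (q, r), and a projectivity between two of the
   corresponding realizations fixes all q_c, so that it is trivial.
   The group law is replaced by explicit identities for the symmetric trilinear
   form polarizing the equation of E. *)
Require Import Defs.
From HB Require Import structures.
From mathcomp Require Import all_boot all_order all_algebra.
From mathcomp Require Import reals complex.
From mathcomp Require mpoly.
From mathcomp Require Import (canonicals) mpoly.
From mathcomp Require Import ring ssrZ.
From Stdlib Require BinNums.
Import Order.TTheory GRing.Theory Num.Theory.
Local Open Scope ring_scope.
Set Implicit Arguments. Unset Strict Implicit. Unset Printing Implicit Defensive.

(** * Plane projective geometry in coordinates *)

(** Only p_0 has to be chosen, since p_(2i) is the third point of the cubic on the line p_0 q_i. For
    the count to be complete, every preimage must lie on the cubic of (q, r) and not on one of its
    own: the cubic of (p, q) contains r, and a cubic through all q_c and r_c is unique up to a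
    factor. Both facts are computed in a normal form with six parameters. The cubic is never shown
    to be smooth or irreducible. Every nondegeneracy is drawn from the open conditions on a
    configuration, from smoothness at the points q_c and from smoothness at the chosen half s of -
    q_0. The last holds because a singular s would give a double root of the quartic that describes
    the tangents through q_0. The genericity condition is thus the discriminant of this quartic,
    together with the condition that no unexpected line carries exactly three double points. Both
    are polynomial in the coordinates, and one integral realization shows that they are not
    vacuous. *)

Definition c0 : 'I_3 := @Ordinal 3 0 isT.
Definition c1 : 'I_3 := @Ordinal 3 1 isT.
Definition c2 : 'I_3 := @Ordinal 3 2 isT.

Section Plane.
Variable K : fieldType.
Local Notation V := 'rV[K]_3.
Implicit Types u v w x y z s n : V.

Definition vec (a b c : K) : V := \row_j [:: a; b; c]`_j.

Lemma vecE a b c :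
  (vec a b c 0 c0 = a) * (vec a b c 0 c1 = b) * (vec a b c 0 c2 = c).
Proof. by rewrite !mxE. Qed.

Lemma big3 (F : 'I_3 -> K) : \sum_(i < 3) F i = F c0 + F c1 + F c2.
Proof.
rewrite !big_ord_recl big_ord0 addr0 addrA.
by congr (F _ + F _ + F _); apply: val_inj.
Qed.

Lemma vecP u v :
  u 0 c0 = v 0 c0 -> u 0 c1 = v 0 c1 -> u 0 c2 = v 0 c2 -> u = v.
Proof.
move=> e0 e1 e2; apply/rowP=> -[[|[|[|//]]] lt_i].
- by have ->: Ordinal lt_i = c0 by apply: val_inj.
- by have ->: Ordinal lt_i = c1 by apply: val_inj.
- by have ->: Ordinal lt_i = c2 by apply: val_inj.
Qed.

(* br u v w = det (u, v, w) vanishes iff u, v, w are collinear. *)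
Definition br u v w : K :=
  u 0 c0 * (v 0 c1 * w 0 c2 - v 0 c2 * w 0 c1)
  - u 0 c1 * (v 0 c0 * w 0 c2 - v 0 c2 * w 0 c0)
  + u 0 c2 * (v 0 c0 * w 0 c1 - v 0 c1 * w 0 c0).

Definition cross u v : V :=
  vec (u 0 c1 * v 0 c2 - u 0 c2 * v 0 c1)
      (u 0 c2 * v 0 c0 - u 0 c0 * v 0 c2)
      (u 0 c0 * v 0 c1 - u 0 c1 * v 0 c0).

Definition dot u v : K := u 0 c0 * v 0 c0 + u 0 c1 * v 0 c1 + u 0 c2 * v 0 c2.

Lemma br_rot u v w : br u v w = br v w u. Proof. by rewrite /br; ring. Qed.
Lemma br_sw u v w : br u v w = - br v u w. Proof. by rewrite /br; ring. Qed.
Lemma br_sw23 u v w : br u v w = - br u w v. Proof. by rewrite /br; ring. Qed.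
Lemma br_alt u v : (br u u v = 0) * (br u v u = 0) * (br v u u = 0).
Proof. by split; [split|]; rewrite /br; ring. Qed.

Lemma brZ a u v w :
  (br (a *: u) v w = a * br u v w) * (br u (a *: v) w = a * br u v w)
  * (br u v (a *: w) = a * br u v w).
Proof. by split; [split|]; rewrite /br !mxE; ring. Qed.

Lemma brD u u' v w :
  (br (u + u') v w = br u v w + br u' v w)
  * (br v (u + u') w = br v u w + br v u' w)
  * (br v w (u + u') = br v w u + br v w u').
Proof. by split; [split|]; rewrite /br !mxE; ring. Qed.

Lemma br_dot u v w : br u v w = dot (cross u v) w.
Proof. by rewrite /br /dot !vecE; ring. Qed.

Lemma crossC u v : cross u v = - cross v u.
Proof. by apply: vecP; rewrite !mxE /=; ring. Qed.

Lemma crossZ a u v :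
  (cross (a *: u) v = a *: cross u v) * (cross u (a *: v) = a *: cross u v).
Proof. by split; apply: vecP; rewrite !mxE /=; ring. Qed.

Lemma crossuu u : cross u u = 0.
Proof. by apply: vecP; rewrite !mxE /=; ring. Qed.

Lemma br_cross0 u v w : cross u v = 0 -> br u v w = 0.
Proof. by rewrite br_dot => ->; rewrite /dot !mxE; ring. Qed.

Lemma br_neq0 u v w : br u v w != 0 -> cross u v != 0.
Proof. by apply: contra_neq; apply: br_cross0. Qed.

Lemma cramer u v w x :
  br u v w *: x = br x v w *: u + br u x w *: v + br u v x *: w.
Proof. by apply: vecP; rewrite /br !mxE; ring. Qed.

(** Expansion of [n] in the basis dual to [u], [v], [w]: three vanishing dot products force
    [br u v w = 0] or [n = 0]. *)
Lemma cramer_dual u v w n :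
  br u v w *: n = dot u n *: cross v w + dot v n *: cross w u + dot w n *: cross u v.
Proof. by apply: vecP; rewrite /br /dot !mxE /=; ring. Qed.

Lemma dotC u v : dot u v = dot v u. Proof. by rewrite /dot; ring. Qed.

Lemma cross_neq0 u v : cross u v != 0 -> exists w, br u v w != 0.
Proof.
move=> nz; case: (eqVneq (cross u v 0 c0) 0) => [e0|]; last first.
  by exists (vec 1 0 0); rewrite br_dot /dot !(vecE 1) !(mulr0, mulr1, addr0).
case: (eqVneq (cross u v 0 c1) 0) => [e1|]; last first.
  by exists (vec 0 1 0); rewrite br_dot /dot !(vecE 0) !(mulr0, mulr1, addr0, add0r).
case: (eqVneq (cross u v 0 c2) 0) => [e2|]; last first.
  by exists (vec 0 0 1); rewrite br_dot /dot !(vecE 0) !(mulr0, mulr1, addr0, add0r).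
by case/eqP: nz; apply: vecP; rewrite ?e0 ?e1 ?e2 mxE.
Qed.

Lemma cross_eq0 u v : u != 0 -> cross u v = 0 -> exists k, v = k *: u.
Proof.
move=> nz /rowP cr0.
have := cr0 c0; have := cr0 c1; have := cr0 c2; rewrite !mxE /= => e2 e1 e0.
case: (eqVneq (u 0 c0) 0) => [z0|nz0]; last first.
  exists (v 0 c0 / u 0 c0); apply: vecP; rewrite !mxE; first by field.
    by apply: (mulfI nz0); move/eqP: e2; rewrite subr_eq0 => /eqP ->; field.
  by apply: (mulfI nz0); move/eqP: e1; rewrite subr_eq0 => /eqP <-; field.
case: (eqVneq (u 0 c1) 0) => [z1|nz1]; last first.
  exists (v 0 c1 / u 0 c1); apply: vecP; rewrite !mxE; last 2 first.
  - by field.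
  - by apply: (mulfI nz1); move/eqP: e0; rewrite subr_eq0 => /eqP ->; field.
  by apply: (mulfI nz1); move/eqP: e2; rewrite subr_eq0 => /eqP <-; field.
case: (eqVneq (u 0 c2) 0) => [z2|nz2]; last first.
  exists (v 0 c2 / u 0 c2); apply: vecP; rewrite !mxE; last by field.
    by apply: (mulfI nz2); move/eqP: e1; rewrite subr_eq0 => /eqP ->; field.
  by apply: (mulfI nz2); move/eqP: e0; rewrite subr_eq0 => /eqP <-; field.
by case/eqP: nz; apply: vecP; rewrite ?z0 ?z1 ?z2 mxE.
Qed.

Lemma collinear3 u v x y z : cross u v != 0 ->
  br u v x = 0 -> br u v y = 0 -> br u v z = 0 -> br x y z = 0.
Proof.
move=> nz; rewrite !br_dot => ex ey ez; apply/eqP; rewrite -br_dot.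
case: (eqVneq (br x y z) 0) => // nb; case/eqP: nz.
have := cramer_dual x y z (cross u v).
rewrite !(dotC _ (cross u v)) ex ey ez !scale0r !addr0 => /eqP.
by rewrite scaler_eq0 (negPf nb) /= => /eqP.
Qed.

Lemma span2 u v x : cross u v != 0 -> br u v x = 0 ->
  exists a b, x = a *: u + b *: v.
Proof.
move=> /cross_neq0 [w nz] e0; exists (br x v w / br u v w), (br u x w / br u v w).
have := cramer u v w x; rewrite e0 scale0r addr0 => e.
apply: (scalerI nz); rewrite e scalerDr !scalerA.
by congr (_ *: _ + _ *: _); field.
Qed.

Lemma exists_orth u : exists2 n, n != 0 & dot u n = 0.
Proof.
case: (eqVneq u 0) => [->|nz].
  exists (vec 1 0 0); last by rewrite /dot !mxE; ring.
  by apply/eqP => /rowP/(_ c0); rewrite !mxE /=; apply/eqP; rewrite oner_eq0.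
case: (eqVneq (cross u (vec 1 0 0)) 0) => [e1|n1]; last first.
  by exists (cross u (vec 1 0 0)) => //; rewrite /dot !vecE; ring.
case: (eqVneq (cross u (vec 0 1 0)) 0) => [e2|n2]; last first.
  by exists (cross u (vec 0 1 0)) => //; rewrite /dot !vecE; ring.
case/eqP: nz; apply: vecP; rewrite [RHS]mxE.
- by move/rowP/(_ c2): e2; rewrite !mxE /= mulr1 mulr0 subr0.
- by move/rowP/(_ c2): e1; rewrite !mxE /= mulr1 mulr0 sub0r => /eqP; rewrite oppr_eq0 => /eqP.
- by move/rowP/(_ c1): e1; rewrite !mxE /= mulr1 mulr0 subr0.
Qed.

(** A nonzero cross product of two of the vectors is a witness. If all of them vanish, the vectors
    span at most a line, and anything orthogonal to that line serves. *)
Lemma br_eq0P u v w : br u v w = 0 <->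
  exists n, [/\ n != 0, dot u n = 0, dot v n = 0 & dot w n = 0].
Proof.
split=> [e0|[n [nz eu ev ew]]]; last first.
  have := cramer_dual u v w n; rewrite eu ev ew !scale0r !addr0 => /eqP.
  by rewrite scaler_eq0 (negPf nz) orbF => /eqP.
have dots x y : (dot x (cross x y) = 0) * (dot y (cross x y) = 0).
  by split; rewrite /dot !vecE; ring.
case: (eqVneq (cross u v) 0) => [euv|n]; last first.
  by exists (cross u v); rewrite !dots dotC -br_dot.
case: (eqVneq (cross v w) 0) => [evw|n]; last first.
  by exists (cross v w); rewrite !dots dotC -br_dot -br_rot.
case: (eqVneq (cross u w) 0) => [euw|n]; last first.
  by exists (cross u w); rewrite !dots dotC -br_dot br_sw23 e0 oppr0.
have dotZ k x n : dot (k *: x) n = k * dot x n by rewrite /dot !mxE; ring.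
have dot0 n : dot 0 n = 0 by rewrite /dot !mxE; ring.
case: (eqVneq u 0) => [->|nu]; last first.
  have [n nz en] := exists_orth u; exists n.
  have [k ->] := cross_eq0 nu euv; have [k' ->] := cross_eq0 nu euw.
  by rewrite !dotZ en !mulr0.
case: (eqVneq v 0) => [->|nv].
  by have [n nz en] := exists_orth w; exists n; rewrite !dot0.
have [n nz en] := exists_orth v; exists n.
by have [k ->] := cross_eq0 nv evw; rewrite dot0 dotZ en mulr0.
Qed.

Lemma cross_trans u v w : v != 0 -> cross u v = 0 -> cross v w = 0 -> cross u w = 0.
Proof.
move=> nz e1 e2; have [k ->] := cross_eq0 nz e2.
have [|k' ->] := @cross_eq0 v u nz; first by rewrite crossC e1 oppr0.
by rewrite !crossZ crossuu !scaler0.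
Qed.

End Plane.

(** * Cubics through a configuration *)

Section Trilinear.
Variable K : numFieldType.
Local Notation V := 'rV[K]_3.
Implicit Types u v w x y z s n : V.

(** The polar form of a plane cubic: the curve is f(x, x, x) = 0, its tangent at a smooth point x is
    f(x, x, y) = 0, and x is singular when f(x, x, .) is identically zero. *)
Definition trilinear (f : V -> V -> V -> K) : Prop :=
  [/\ forall u v w, f u v w = f v u w,
      forall u v w, f u v w = f u w v &
      forall a b u v x y, f (a *: u + b *: v) x y = a * f u x y + b * f v x y].

Section Theory.
Variable f : V -> V -> V -> K.
Hypothesis fT : trilinear f.

Lemma triC u v w : f u v w = f v u w. Proof. by case: fT. Qed.
Lemma triCA u v w : f u v w = f u w v. Proof. by case: fT. Qed.
Lemma tri_rot u v w : f u v w = f v w u. Proof. by rewrite triC triCA. Qed.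
Lemma tri_lin1 a b u v x y : f (a *: u + b *: v) x y = a * f u x y + b * f v x y.
Proof. by case: fT. Qed.
Lemma tri_lin2 a b u v x y : f x (a *: u + b *: v) y = a * f x u y + b * f x v y.
Proof. by rewrite triC tri_lin1 !(triC _ x). Qed.
Lemma tri_lin3 a b u v x y : f x y (a *: u + b *: v) = a * f x y u + b * f x y v.
Proof. by rewrite triCA tri_lin2 !(triCA _ y). Qed.
Lemma triZ a u x y :
  (f (a *: u) x y = a * f u x y) * (f x (a *: u) y = a * f x u y)
  * (f x y (a *: u) = a * f x y u).
Proof.
have e : a *: u = a *: u + 0 *: u by rewrite scale0r addr0.
by split; [split|]; rewrite {1}e ?tri_lin1 ?tri_lin2 ?tri_lin3 mul0r addr0.
Qed.
Lemma triD u v x y :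
  (f (u + v) x y = f u x y + f v x y) * (f x (u + v) y = f x u y + f x v y)
  * (f x y (u + v) = f x y u + f x y v).
Proof.
by split; [split|]; rewrite -{1}[u]scale1r -{1}[v]scale1r
  ?tri_lin1 ?tri_lin2 ?tri_lin3 !mul1r.
Qed.
Lemma tri_line a b u v : let x := a *: u + b *: v in
  f x x x = a ^+ 3 * f u u u + 3%:R * a ^+ 2 * b * f u u v
            + 3%:R * a * b ^+ 2 * f u v v + b ^+ 3 * f v v v.
Proof.
move=> x; rewrite /x !(tri_lin1, tri_lin2, tri_lin3).
by rewrite (triC v u u) (triCA u v u) (triC v u v) (triCA v v u) (triC v u v); ring.
Qed.

Lemma tri_line2 a b u v w : let x := a *: u + b *: v in
  f x x w = a ^+ 2 * f u u w + 2%:R * a * b * f u v w + b ^+ 2 * f v v w.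
Proof. by move=> x; rewrite /x !(tri_lin1, tri_lin2) (triC v u); ring. Qed.

Lemma tri_vanish u v w : br u v w != 0 -> forall y z,
  f y z u = 0 -> f y z v = 0 -> f y z w = 0 -> forall x, f y z x = 0.
Proof.
move=> nz y z eu ev ew x; apply: (mulfI nz); rewrite mulr0 -(triZ _ x y z).2 cramer.
by rewrite !triD !triZ eu ev ew !mulr0 !addr0.
Qed.

Lemma tri_vanish2 u v : cross u v != 0 -> forall y z w,
  f y z u = 0 -> f y z v = 0 -> br u v w != 0 ->
  forall x, f y z x = f y z w / br u v w * br u v x.
Proof.
move=> _ y z w eu ev nz x; apply: (mulfI nz); rewrite -(triZ _ x y z).2 cramer.
by rewrite !triD !triZ eu ev !mulr0 !add0r; field.
Qed.

Lemma tri3 u v w a b c y : let x := a *: u + b *: v + c *: w in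
  f x x y = a ^+ 2 * f u u y + b ^+ 2 * f v v y + c ^+ 2 * f w w y
    + 2%:R * a * b * f u v y + 2%:R * a * c * f u w y + 2%:R * b * c * f v w y.
Proof.
move=> x; rewrite /x !triD !triZ.
by rewrite (triC v u) (triC w u) (triC w v); ring.
Qed.

Lemma tri3_1 u v w a b c y y' :
  f (a *: u + b *: v + c *: w) y y' = a * f u y y' + b * f v y y' + c * f w y y'.
Proof. by rewrite !triD !triZ. Qed.

End Theory.
End Trilinear.

Ltac caseI i := let h := fresh in case: i => -[|[|[|[|[|[|[|//]]]]]]] h.

Section Config.
Variable K : numFieldType.
Local Notation V := 'rV[K]_3.
Local Notation I := 'I_7.

(* Realizations of M_7 in the dual plane: q_a is dual to l_a and r_c to l'_c. *)
Definition config (q r : I -> V) : Prop :=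
  [/\ forall i j k, i != j -> i != k -> j != k -> br (q i) (q j) (q k) != 0,
      forall i j k, i != j -> (br (q i) (q j) (r k) == 0) = (i + j == k + k),
      forall i j k, j != k -> br (q i) (r j) (r k) != 0 &
      forall i j k, i != j -> i != k -> j != k -> br (r i) (r j) (r k) != 0].

(* f is the polar form of a cubic passing through all q_c and r_c, smooth at q_c
   with a tangent through r_c; in the group law, r_c = - 2 q_c. *)
Definition on_cubic (f : V -> V -> V -> K) (q r : I -> V) : Prop :=
  [/\ trilinear f, forall c, f (q c) (q c) (q c) = 0,
      forall c, f (r c) (r c) (r c) = 0,
      forall c, f (q c) (q c) (r c) = 0 &
      forall c, exists x, f (q c) (q c) x != 0].

Section Facts.
Variables (q r : I -> V) (f : V -> V -> V -> K).
Hypotheses (cf : config q r) (fC : on_cubic f q r).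

Let fT : trilinear f. Proof. by case: fC. Qed.
Let fq c : f (q c) (q c) (q c) = 0. Proof. by case: fC. Qed.
Let fr c : f (r c) (r c) (r c) = 0. Proof. by case: fC. Qed.
Let fqr c : f (q c) (q c) (r c) = 0. Proof. by case: fC. Qed.

Lemma qqq i j k : i != j -> i != k -> j != k -> br (q i) (q j) (q k) != 0.
Proof. by case: cf => h _ _ _; apply: h. Qed.
Lemma qqr0 i j k : i != j -> i + j = k + k -> br (q i) (q j) (r k) = 0.
Proof. by case: cf => _ h _ _ nij e; apply/eqP; rewrite h // e. Qed.
Lemma qqr i j k : i != j -> i + j != k + k -> br (q i) (q j) (r k) != 0.
Proof. by case: cf => _ h _ _ nij e; rewrite h. Qed.
Lemma qrr i j k : j != k -> br (q i) (r j) (r k) != 0.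
Proof. by case: cf => _ _ h _; apply: h. Qed.

Lemma r_neq0 k : r k != 0.
Proof.
have [j nkj] : exists j, k != j by exists (k + 1); clear; caseI k; vm_compute.
apply: contra_neq (qrr 0 nkj) => ->.
by rewrite -(scale0r 0) brZ mul0r.
Qed.

(** 4 is the inverse of 2 modulo 7, so every index has exactly one half. *)
Lemma halfK (i : I) : (i + i) * 4%:R = i.
Proof.
rewrite -mulr2n -(mulr_natr i 2) -mulrA -natrM.
have -> : (2 * 4)%:R = 1 :> I by apply: val_inj.
exact: mulr1.
Qed.
Lemma half_inj (i j : I) : i + i = j + j -> i = j.
Proof. by move=> /(congr1 (fun x => x * 4%:R)); rewrite !halfK. Qed.
Lemma half_exists (i : I) : exists m, m + m = i.
Proof. by exists (i * 4%:R); rewrite -mulrDl halfK. Qed.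

(** The form f(q_c, q_c, .) vanishes at q_c and r_c. As c + d differs from 2 c, q_d is off their
    line; a zero there would make the form zero and q_c singular. *)
Lemma fqq c d : c != d -> f (q c) (q c) (q d) != 0.
Proof.
move=> ncd; case: fC => _ _ _ _ /(_ c) [x]; apply: contra_neq => e.
apply: (tri_vanish fT _ (fq c) (fqr c) e).
by rewrite br_sw23 oppr_eq0 qqr // (inj_eq (addrI _)) eq_sym.
Qed.

(** At c q_i + d q_j the cubic takes the value 3 c d (c f(q_i, q_i, q_j) + d f(q_i, q_j, q_j)). By
    [fqq] the last factor is not identically zero, so it has a single zero up to scaling, and r_m is
    one. *)
Lemma third_point i j m a b : let x := a *: q i + b *: q j in
  i != j -> i + j = m + m -> a != 0 -> b != 0 -> f x x x = 0 -> cross x (r m) = 0.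
Proof.
move=> x nij eij na nb fx.
have nqq : cross (q i) (q j) != 0.
  have [k /andP[nik njk]] : exists k, (i != k) && (j != k).
    by exists (if (i + 1 == j) then i + 2%:R else i + 1); move: nij; clear; caseI i; caseI j; vm_compute.
  exact: br_neq0 (qqq nij nik njk).
have [a' [b' er]] := span2 nqq (qqr0 nij eij).
have line c d : let y := c *: q i + d *: q j in f y y y =
    3%:R * c * d * (c * f (q i) (q i) (q j) + d * f (q i) (q j) (q j)).
  by move=> y; rewrite /y (tri_line fT) !fq; ring.
(* Some q_d off the line q_l r_k shows that q_l and r_k are different points. *)
have nr k l : i != j -> i + j = k + k -> cross (q l) (r k) != 0.
  move=> _ _; have [d nd] : exists d, (l != d) && (l + d != k + k).
    by exists (if l == k then l + 1 else if k + k - l == l + 1 then l + 2%:R else l + 1); clear; caseI l; caseI k; vm_compute.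
  case/andP: nd => nld nk; apply: (@br_neq0 _ _ _ (q d)).
  by rewrite br_sw23 oppr_eq0 qqr.
have na' : a' != 0.
  apply: contra_neq (nr m j nij eij) => e; rewrite er e scale0r add0r.
  by rewrite crossZ crossuu scaler0.
have nb' : b' != 0.
  apply: contra_neq (nr m i nij eij) => e; rewrite er e scale0r addr0.
  by rewrite crossZ crossuu scaler0.
have n3 : 3%:R != 0 :> K by rewrite pnatr_eq0.
have root c d : c != 0 -> d != 0 -> (let y := c *: q i + d *: q j in f y y y = 0) ->
    c * f (q i) (q i) (q j) + d * f (q i) (q j) (q j) = 0.
  move=> nc nd /=; rewrite line => /eqP; rewrite !mulf_eq0 (negPf n3) (negPf nc) (negPf nd) /=.
  by move/eqP.
have e1 := root _ _ na nb fx.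
have e2 : a' * f (q i) (q i) (q j) + b' * f (q i) (q j) (q j) = 0.
  by apply: root => //=; rewrite -er.
have eab : a * b' - b * a' = 0.
  apply: (mulIf (fqq nij)); rewrite mul0r.
  have -> : (a * b' - b * a') * f (q i) (q i) (q j)
     = b' * (a * f (q i) (q i) (q j) + b * f (q i) (q j) (q j))
       - b * (a' * f (q i) (q i) (q j) + b' * f (q i) (q j) (q j)) by ring.
  by rewrite e1 e2 !mulr0 subr0.
rewrite er /x; apply: vecP; rewrite !mxE /= ?mxE.
- rewrite -[RHS](mul0r (q i 0 c1 * q j 0 c2 - q i 0 c2 * q j 0 c1)) -eab; ring.
- rewrite -[RHS](mul0r (q i 0 c2 * q j 0 c0 - q i 0 c0 * q j 0 c2)) -eab; ring.
- rewrite -[RHS](mul0r (q i 0 c0 * q j 0 c1 - q i 0 c1 * q j 0 c0)) -eab; ring.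
Qed.

(** Otherwise the cubic contains the whole line q_i r_i. That line meets q_j q_k, where j + k = 2 m
    and m is not i, in a point x other than q_j and q_k; by [third_point] x is r_m, so q_i, r_i, r_m
    would be collinear. *)
Lemma fqrr i : f (q i) (r i) (r i) != 0.
Proof.
apply/eqP => e0.
have [j [k [m [nij nik njk nim ejk]]]] : exists j k m,
    [/\ i != j, i != k, j != k, i != m & j + k = m + m].
  exists (i + 1), (i + 2%:R), (i + 5%:R).
  by clear; split; last apply/eqP; caseI i; vm_compute.
have nqr : cross (q i) (r i) != 0.
  apply: (@br_neq0 _ _ _ (q j)).
  by rewrite br_sw23 oppr_eq0 qqr // (inj_eq (addrI _)) eq_sym.
have nb l : i != l -> br (q i) (r i) (q l) != 0.
  move=> nil; rewrite br_sw23 oppr_eq0 qqr // (inj_eq (addrI _)).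
  by rewrite eq_sym.
set a := br (q i) (r i) (q k); set b := - br (q i) (r i) (q j).
have na : a != 0 by exact: nb.
have nb' : b != 0 by rewrite oppr_eq0 nb.
pose x := a *: q j + b *: q k.
have ex : br (q i) (r i) x = 0 by rewrite /x !(brD, brZ) /a /b; ring.
have fx : f x x x = 0.
  have [c [d ->]] := span2 nqr ex.
  by rewrite (tri_line fT) fq fr fqr e0 !(mulr0, addr0).
have := third_point njk ejk na nb' fx; rewrite -/x => cx.
have nx : x != 0.
  apply/eqP => x0; have : cross x (q k) = 0 by rewrite x0; apply: vecP; rewrite !mxE /=; ring.
  have -> : cross x (q k) = a *: cross (q j) (q k).
    by apply: vecP; rewrite /x !mxE /=; ring.
  apply/eqP; rewrite scaler_eq0 (negPf na) /=; apply: (@br_neq0 _ _ _ (q i)).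
  by apply: qqq; rewrite // eq_sym.
have [t et] := cross_eq0 nx cx.
by have := qrr i nim; rewrite et brZ ex mulr0 eqxx.
Qed.

End Facts.
End Config.

(** * Halving on the cubic *)

Section Halving.
Variable K : numFieldType.
Local Notation V := 'rV[K]_3.
Local Notation I := 'I_7.

(* Let s = (s0, s1, s2) and u = (x, y, z) = q_(i+j) in the frame q_0, q_i, q_j, and
   A = f q_0 q_0 q_i, B = f q_0 q_0 q_j, C = f q_0 q_i q_i, D = f q_0 q_j q_j,
   E = f q_i q_i q_j, G = f q_i q_j q_j, H = f q_0 q_i q_j. The hypotheses say
   that the tangent at s is the line s q_0, that r_m lies on the cubic (2m = i + j)
   and that u does; the conclusion is the collinearity in br_halfpt. When
   i + j = 0, so that u = q_0, tangent_identity is used instead. *)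
Lemma chord_identity (A B C D E G H s0 s1 s2 x y z k : K) :
  2%:R * s0 * s1 * A + 2%:R * s0 * s2 * B + s1 ^+ 2 * C + s2 ^+ 2 * D
    + 2%:R * s1 * s2 * H = 0 ->
  s0 ^+ 2 * A + 2%:R * s0 * s1 * C + 2%:R * s0 * s2 * H + 2%:R * s1 * s2 * E
    + s2 ^+ 2 * G = k * s2 ->
  s0 ^+ 2 * B + 2%:R * s0 * s2 * D + 2%:R * s0 * s1 * H + 2%:R * s1 * s2 * G
    + s1 ^+ 2 * E = - (k * s1) ->
  y * E + z * G = 0 -> z != 0 -> z * s1 - y * s2 != 0 ->
  x * (y * A + z * B) + y ^+ 2 * C + z ^+ 2 * D + 2%:R * y * z * H = 0 ->
  - k * s1 * s2 * x - s2 * (s0 * D + s1 * G) * (s2 * x - s0 * z)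
    + s1 * (s0 * C + s2 * E) * (s1 * x - s0 * y) = 0.
Proof.
move=> h0 h1 h2 hr nz nw hq.
have n2 : 2%:R != 0 :> K by rewrite pnatr_eq0.
have n3 : 3%:R != 0 :> K by rewrite pnatr_eq0.
(* The relation y E + z G = 0 makes (E, G) a multiple of (z, - y). *)
have [e eE eG] : exists2 e, E = z * e & G = - (y * e).
  exists (E / z); first by field.
  by apply: (mulfI nz); move/eqP: hr; rewrite addrC addr_eq0 => /eqP ->; field.
move: h1 h2; rewrite {hr}eE {}eG => h1 h2.
(* In s1 [h1] + s2 [h2] - 2 s0 [h0] the terms in C, D, H and k cancel, and the rest is divisible by
   3. *)
have q0 : s1 * s2 * e * (z * s1 - y * s2) - s0 ^+ 2 * (s1 * A + s2 * B) = 0.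
  apply: (mulfI n3); rewrite mulr0.
  transitivity (s1 * (s0 ^+ 2 * A + 2%:R * s0 * s1 * C + 2%:R * s0 * s2 * H
      + 2%:R * s1 * s2 * (z * e) + s2 ^+ 2 * - (y * e))
    + s2 * (s0 ^+ 2 * B + 2%:R * s0 * s2 * D + 2%:R * s0 * s1 * H
      + 2%:R * s1 * s2 * - (y * e) + s1 ^+ 2 * (z * e))
    - 2%:R * s0 * (2%:R * s0 * s1 * A + 2%:R * s0 * s2 * B + s1 ^+ 2 * C
      + s2 ^+ 2 * D + 2%:R * s1 * s2 * H)); first by ring.
  by rewrite h0 h1 h2; ring.
have ek : 2%:R * (k * s1 * s2) = s1 * (s0 ^+ 2 * A + 2%:R * s0 * s1 * C
      + 2%:R * s0 * s2 * H + 2%:R * s1 * s2 * (z * e) + s2 ^+ 2 * - (y * e))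
    - s2 * (s0 ^+ 2 * B + 2%:R * s0 * s2 * D + 2%:R * s0 * s1 * H
      + 2%:R * s1 * s2 * - (y * e) + s1 ^+ 2 * (z * e)).
  by rewrite h1 h2; ring.
(* After multiplication by 2 (z s1 - y s2) and elimination of k through [ek], the goal is a
   combination of [q0], [h0] and [hq]. *)
apply: (mulfI n2); apply: (mulfI nw); rewrite !mulr0.
transitivity ((z * s1 - y * s2) * (- (2%:R * (k * s1 * s2)) * x
    + 2%:R * (- s2 * (s0 * D + s1 * - (y * e)) * (s2 * x - s0 * z)
    + s1 * (s0 * C + s2 * (z * e)) * (s1 * x - s0 * y)))); first by ring.
rewrite ek.
transitivity ((x * (z * s1 + y * s2) - 4%:R * s0 * y * z)
    * (s1 * s2 * e * (z * s1 - y * s2) - s0 ^+ 2 * (s1 * A + s2 * B))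
  + s0 ^+ 2 * (- 2%:R * y * z * (2%:R * s0 * s1 * A + 2%:R * s0 * s2 * B
      + s1 ^+ 2 * C + s2 ^+ 2 * D + 2%:R * s1 * s2 * H)
    + 2%:R * s1 * s2 * (x * (y * A + z * B) + y ^+ 2 * C + z ^+ 2 * D
      + 2%:R * y * z * H))); first by ring.
by rewrite q0 h0 hq; ring.
Qed.

(** For i + j = 0 it says nothing new that u = q_0 is on the cubic. Its place is taken by y A + z B
    = 0: the point r_0 = (0, y, z) is on the tangent at q_0. *)
Lemma tangent_identity (A B C D E G H s0 s1 s2 y z k : K) :
  2%:R * s0 * s1 * A + 2%:R * s0 * s2 * B + s1 ^+ 2 * C + s2 ^+ 2 * D
    + 2%:R * s1 * s2 * H = 0 ->
  s0 ^+ 2 * A + 2%:R * s0 * s1 * C + 2%:R * s0 * s2 * H + 2%:R * s1 * s2 * E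
    + s2 ^+ 2 * G = k * s2 ->
  s0 ^+ 2 * B + 2%:R * s0 * s2 * D + 2%:R * s0 * s1 * H + 2%:R * s1 * s2 * G
    + s1 ^+ 2 * E = - (k * s1) ->
  y * E + z * G = 0 -> y * A + z * B = 0 -> z != 0 -> z * s1 - y * s2 != 0 ->
  - k * s1 * s2 - s2 ^+ 2 * (s0 * D + s1 * G) + s1 ^+ 2 * (s0 * C + s2 * E) = 0.
Proof.
move=> h0 h1 h2 hr ha nz nw.
have n2 : 2%:R != 0 :> K by rewrite pnatr_eq0.
have n3 : 3%:R != 0 :> K by rewrite pnatr_eq0.
have param U W : y * U + z * W = 0 -> exists2 e, U = z * e & W = - (y * e).
  move=> h; exists (U / z); first by field.
  by apply: (mulfI nz); move/eqP: h; rewrite addrC addr_eq0 => /eqP ->; field.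
have [e eE eG] := param _ _ hr; have [d dE dG] := param _ _ ha.
move: h0 h1 h2; rewrite {hr}eE {}eG {ha}dE {}dG => h0 h1 h2.
have q0 : (z * s1 - y * s2) * (s0 ^+ 2 * d - s1 * s2 * e) = 0.
  apply: (mulfI n3); rewrite mulr0.
  transitivity (- (s1 * (s0 ^+ 2 * (z * d) + 2%:R * s0 * s1 * C + 2%:R * s0 * s2 * H
      + 2%:R * s1 * s2 * (z * e) + s2 ^+ 2 * - (y * e))
    + s2 * (s0 ^+ 2 * - (y * d) + 2%:R * s0 * s2 * D + 2%:R * s0 * s1 * H
      + 2%:R * s1 * s2 * - (y * e) + s1 ^+ 2 * (z * e)))
    + 2%:R * s0 * (2%:R * s0 * s1 * (z * d) + 2%:R * s0 * s2 * - (y * d) + s1 ^+ 2 * C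
      + s2 ^+ 2 * D + 2%:R * s1 * s2 * H)); first by ring.
  by rewrite h0 h1 h2; ring.
move/eqP: q0; rewrite mulf_eq0 (negPf nw) /= subr_eq0 => /eqP q0.
apply: (mulfI n2); rewrite mulr0.
transitivity (- (s1 * (k * s2) - s2 * - (k * s1))
    + 2%:R * (- s2 ^+ 2 * (s0 * D + s1 * - (y * e))
    + s1 ^+ 2 * (s0 * C + s2 * (z * e)))); first by ring.
rewrite -h1 -h2.
transitivity ((z * s1 + y * s2) * (s1 * s2 * e - s0 ^+ 2 * d)); first by ring.
by rewrite q0 subrr mulr0.
Qed.

Lemma br_coords (u v w : V) (a0 a1 a2 b0 b1 b2 d0 d1 d2 : K) :
  br (a0 *: u + a1 *: v + a2 *: w) (b0 *: u + b1 *: v + b2 *: w)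
     (d0 *: u + d1 *: v + d2 *: w) =
  (a0 * (b1 * d2 - b2 * d1) - a1 * (b0 * d2 - b2 * d0) + a2 * (b0 * d1 - b1 * d0))
  * br u v w.
Proof. by rewrite /br !mxE; ring. Qed.

Variables (q r : I -> V) (f : V -> V -> V -> K).
Hypotheses (cf : config q r) (fC : on_cubic f q r).
Let fT : trilinear f. Proof. by case: fC. Qed.
Let fq c : f (q c) (q c) (q c) = 0. Proof. by case: fC. Qed.
Let fr c : f (r c) (r c) (r c) = 0. Proof. by case: fC. Qed.
Let fqr c : f (q c) (q c) (r c) = 0. Proof. by case: fC. Qed.

Variable s : V.
Hypotheses (fs : f s s s = 0) (fs0 : f s s (q 0) = 0).
Hypotheses (ns : cross s (q 0) != 0) (nsing : exists x, f s s x != 0).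

Let n3 : 3%:R != 0 :> K. Proof. by rewrite pnatr_eq0. Qed.

(** On the line q_0 q_c the cubic would vanish at q_0, at q_c and doubly at s. These are too many
    zeros unless s is q_c, and then the tangent at q_c would pass through q_0; [fqq] excludes
    both. *)
Lemma br_s_q0 c : c != 0 -> br s (q 0) (q c) != 0.
Proof.
move=> nc; apply/eqP => e0.
have cr0 : cross (q 0) (q c) != 0.
  have [k /andP[n0k nck]] : exists k, (0 != k) && (c != k).
    by exists (if c == 1 then 2%:R else 1); move: nc; clear; caseI c; vm_compute.
  by apply: br_neq0 (qqq cf _ n0k nck); rewrite eq_sym.
have [|a [b es]] := span2 cr0 (x := s); first by rewrite -br_rot.
have nb : b != 0.
  apply: contra_neq ns => b0.
  by rewrite es b0 scale0r addr0 crossZ crossuu scaler0.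
have n0c : 0 != c by rewrite eq_sym.
have := fs0; rewrite {1 2}es (tri_line2 fT) fq mulr0 add0r.
rewrite -(triCA fT (q 0)) -(tri_rot fT (q 0)).
set S := f (q 0) (q c) (q c); set T := f (q 0) (q 0) (q c) => e1.
have := fs; rewrite {1 2 3}es (tri_line fT) !fq -/S -/T => e2.
have nS : S != 0 by rewrite /S (tri_rot fT) (fqq cf fC).
have nT : T != 0 by rewrite /T (fqq cf fC) // eq_sym.
have e1' : 2%:R * a * T + b * S = 0.
  by apply: (mulfI nb); rewrite mulr0 -e1; ring.
have : 3%:R * a * b * (a * T + b * S) = 0 by rewrite -[RHS]e2; ring.
move/eqP; rewrite !mulf_eq0 (negPf n3) (negPf nb) /= orbF => /orP[/eqP a0|/eqP e3].
  by move: e1'; rewrite a0 mulr0 mul0r add0r => /eqP; rewrite mulf_eq0 (negPf nb) (negPf nS).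
have : a * T = 0 by rewrite -(subrr 0) -{1}e1' -e3; ring.
move/eqP; rewrite mulf_eq0 (negPf nT) orbF => /eqP a0.
by move: e3; rewrite a0 mul0r add0r => /eqP; rewrite mulf_eq0 (negPf nb) (negPf nS).
Qed.

(* The tangent to the cubic at s passes through q_0. *)
Lemma tangent_at_s : exists2 k, k != 0 & forall x, f s s x = k * br s (q 0) x.
Proof.
have [w nw] := cross_neq0 ns.
have h := tri_vanish2 fT ns fs fs0 nw.
exists (f s s w / br s (q 0) w) => //.
apply/eqP => k0; have [x] := nsing.
by rewrite h k0 mul0r eqxx.
Qed.

(** Otherwise s is on the tangent q_i r_i, which by [fqrr] meets the cubic only in q_i and r_i. Both
    are on a line through q_0 and some q_c with c nonzero (c = i, and c = 2 i for r_i), against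
    [br_s_q0]. *)
Lemma f_s_q i : i != 0 -> f s (q i) (q i) != 0.
Proof.
move=> ni; apply/eqP => e0.
have e1 : f (q i) (q i) s = 0 by rewrite -(tri_rot fT).
have nqr : cross (q i) (r i) != 0.
  apply: (@br_neq0 _ _ _ (q 0)).
  by rewrite br_sw23 oppr_eq0 qqr // (inj_eq (addrI _)) eq_sym.
have e2 : br (q i) (r i) s = 0.
  apply/eqP/negPn/negP => nb; case: fC => _ _ _ _ /(_ i) [x].
  by rewrite (tri_vanish fT nb (fq i) (fqr i) e1) eqxx.
have [a [b es]] := span2 nqr e2.
have := fs; rewrite {1 2 3}es (tri_line fT) fq fr fqr !(mulr0, addr0, add0r) => /eqP.
rewrite !mulf_eq0 (negPf n3) (negPf (fqrr cf fC i)) /= orbF orbb.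
case/orP=> /eqP z0.
  have := @br_s_q0 (i + i); rewrite es z0 scale0r add0r brZ.
  have n2i : i + i != 0 by move: ni; clear; caseI i; vm_compute.
  rewrite br_rot qqr0 ?mulr0 ?eqxx // ?add0r //; last by rewrite eq_sym.
  by move/(_ n2i).
by have := br_s_q0 ni; rewrite es z0 scale0r addr0 brZ (br_alt (q i)) mulr0 eqxx.
Qed.

(* The third point - (s + q_i) of the cubic on the line through s and q_i. If
   s = p_0 is a half of - q_0, it is p_(2i). *)
Definition half_point i : V := f s s (q i) *: q i - f s (q i) (q i) *: s.

(** In the group law, p_(2i) + p_(2j) + q_(i+j) = 0. In the frame q_0, q_i, q_j the determinant is a
    multiple of the left side of [chord_identity] or [tangent_identity]. Their hypotheses come from
    r_m with 2 m = i + j, which is on the cubic and on q_i q_j, and also on q_0 q_(i+j) or, if i + j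
    = 0, on the tangent at q_0. *)
Lemma br_halfpt i j : i != 0 -> j != 0 -> i != j ->
  br (half_point i) (half_point j) (q (i + j)) = 0.
Proof.
move=> ni nj nij.
have [k nk ek] := tangent_at_s.
have nd : br (q 0) (q i) (q j) != 0 by apply: (qqq cf); rewrite // eq_sym.
have coord x : exists a b c, x = a *: q 0 + b *: q i + c *: q j.
  have := cramer (q 0) (q i) (q j) x; set d := br _ _ _ in nd * => e.
  exists (br x (q i) (q j) / d), (br (q 0) x (q j) / d), (br (q 0) (q i) x / d).
  apply: (scalerI nd); rewrite e !scalerDr !scalerA.
  by congr (_ *: _ + _ *: _ + _ *: _); field.
have [s0 [s1 [s2 es]]] := coord s.
set d := br (q 0) (q i) (q j) in nd.
have e0 : q 0 = 1 *: q 0 + 0 *: q i + 0 *: q j by rewrite scale1r !scale0r !addr0.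
have ei : q i = 0 *: q 0 + 1 *: q i + 0 *: q j by rewrite scale1r !scale0r addr0 add0r.
have ej : q j = 0 *: q 0 + 0 *: q i + 1 *: q j by rewrite scale1r !scale0r !add0r.
pose A := f (q 0) (q 0) (q i); pose B := f (q 0) (q 0) (q j).
pose C := f (q 0) (q i) (q i); pose D := f (q 0) (q j) (q j).
pose E := f (q i) (q i) (q j); pose G := f (q i) (q j) (q j).
pose H := f (q 0) (q i) (q j).
have h0 : f s s (q 0) = 2%:R * s0 * s1 * A + 2%:R * s0 * s2 * B + s1 ^+ 2 * C
    + s2 ^+ 2 * D + 2%:R * s1 * s2 * H.
  rewrite es (tri3 fT) fq (triCA fT (q 0) (q i)) (triCA fT (q 0) (q j)).
  by rewrite -!(tri_rot fT (q 0)) -/A -/B -/C -/D -/H; ring.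
have h1 : f s s (q i) = s0 ^+ 2 * A + 2%:R * s0 * s1 * C + 2%:R * s0 * s2 * H
    + 2%:R * s1 * s2 * E + s2 ^+ 2 * G.
  rewrite es (tri3 fT) fq (triCA fT (q 0) (q j)) (triCA fT (q i) (q j)).
  by rewrite -(tri_rot fT (q i) (q j)) -/A -/C -/E -/G -/H; ring.
have h2 : f s s (q j) = s0 ^+ 2 * B + 2%:R * s0 * s2 * D + 2%:R * s0 * s1 * H
    + 2%:R * s1 * s2 * G + s1 ^+ 2 * E.
  by rewrite es (tri3 fT) fq -/B -/D -/E -/G -/H; ring.
have h1' : f s s (q i) = k * d * s2.
  rewrite ek; have := br_coords (q 0) (q i) (q j) s0 s1 s2 1 0 0 0 1 0.
  by rewrite -es -e0 -ei -/d => ->; ring.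
have h2' : f s s (q j) = - (k * d * s1).
  rewrite ek; have := br_coords (q 0) (q i) (q j) s0 s1 s2 1 0 0 0 0 1.
  by rewrite -es -e0 -ej -/d => ->; ring.
have T1 : f s (q i) (q i) = s0 * C + s2 * E.
  by rewrite {1}es (tri3_1 fT) fq (tri_rot fT (q j)) -/C -/E; ring.
have T2 : f s (q j) (q j) = s0 * D + s1 * G.
  by rewrite {1}es (tri3_1 fT) fq -/D -/G; ring.
have pi : half_point i = (- (s0 * C + s2 * E) * s0) *: q 0
    + (k * d * s2 - (s0 * C + s2 * E) * s1) *: q i
    + (- (s0 * C + s2 * E) * s2) *: q j.
  by rewrite /half_point h1' T1 {1}es; apply: vecP; rewrite !mxE; ring.
have pj : half_point j = (- (s0 * D + s1 * G) * s0) *: q 0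
    + (- (s0 * D + s1 * G) * s1) *: q i
    + (- (k * d * s1) - (s0 * D + s1 * G) * s2) *: q j.
  by rewrite /half_point h2' T2 {1}es; apply: vecP; rewrite !mxE; ring.
have [m em] := half_exists (i + j).
have n0i : cross (q i) (q j) != 0 by apply: br_neq0 (qqq cf nij ni nj).
have [y [z er]] := span2 n0i (qqr0 cf nij (esym em)).
have nr l' : l' != i -> l' != j -> br (q l') (q i) (r m) != 0 /\ br (q l') (q j) (r m) != 0.
  move=> li lj; split; apply: qqr => //; rewrite em; first by rewrite addrC (inj_eq (addrI _)).
  by rewrite (inj_eq (addIr _)).
have [nz ny] : z != 0 /\ y != 0.
  have [l' [li lj]] : exists l', l' != i /\ l' != j by exists 0; rewrite ![0 == _]eq_sym.
  have [h h'] := nr l' li lj; split; [move: h|move: h']; apply: contra_neq => e.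
    by rewrite er e scale0r addr0 brZ br_alt mulr0.
  by rewrite er e scale0r add0r brZ br_alt mulr0.
have hr : y * E + z * G = 0.
  have := fr m; rewrite er (tri_line fT) !fq -/E -/G => h.
  apply: (mulfI n3); apply: (mulfI ny); apply: (mulfI nz).
  by rewrite !mulr0 -h; ring.
have h0' : 2%:R * s0 * s1 * A + 2%:R * s0 * s2 * B + s1 ^+ 2 * C + s2 ^+ 2 * D
    + 2%:R * s1 * s2 * H = 0 by rewrite -h0.
case: (eqVneq (i + j) 0) => [s_ij|nk0].
  have m0 : m = 0 by apply: half_inj; rewrite em s_ij addr0.
  have er0 : r 0 = y *: q i + z *: q j by rewrite -m0.
  have ha : y * A + z * B = 0.
    by have := fqr 0; rewrite er0 !(triD fT) !(triZ fT).
  (* That is, s is off the tangent q_0 r_0: for s = a q_0 + b r_0 one has f(s, s, q_0) = b^2 f(q_0,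
     r_0, r_0), which forces b = 0, but s and q_0 are different points. *)
  have nw : z * s1 - y * s2 != 0.
    apply/eqP => w0.
    have e1 : br (q 0) (r 0) s = 0.
      have := br_coords (q 0) (q i) (q j) 1 0 0 0 y z s0 s1 s2.
      rewrite -es -e0 scale0r add0r -er0 => ->.
      by transitivity (- (z * s1 - y * s2) * d); [rewrite /d; ring|rewrite w0; ring].
    have nqr : cross (q 0) (r 0) != 0.
      apply: (@br_neq0 _ _ _ (q i)); rewrite br_sw23 oppr_eq0 qqr // ?add0r ?addr0 //.
      by rewrite eq_sym.
    have [a [b es']] := span2 nqr e1.
    have := fs0; rewrite {1 2}es' (tri_line2 fT) fq.
    rewrite (triCA fT (q 0) (r 0)) fqr -(tri_rot fT (q 0) (r 0)).
    rewrite !mulr0 !add0r => /eqP.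
    rewrite mulf_eq0 (negPf (fqrr cf fC 0)) orbF expf_eq0 /= => /eqP b0.
    by move: ns; rewrite es' b0 scale0r addr0 crossZ crossuu scaler0 eqxx.
  have W := tangent_identity h0' (etrans (esym h1) h1') (etrans (esym h2) h2') hr ha nz nw.
  have := br_coords (q 0) (q i) (q j) (- (s0 * C + s2 * E) * s0)
    (k * d * s2 - (s0 * C + s2 * E) * s1) (- (s0 * C + s2 * E) * s2)
    (- (s0 * D + s1 * G) * s0) (- (s0 * D + s1 * G) * s1)
    (- (k * d * s1) - (s0 * D + s1 * G) * s2) 1 0 0.
  rewrite -e0 -pi -pj -/d s_ij => ->.
  transitivity (k * d * (- (k * d) * s1 * s2 - s2 ^+ 2 * (s0 * D + s1 * G)
     + s1 ^+ 2 * (s0 * C + s2 * E)) * d); first by ring.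
  by rewrite W !(mulr0, mul0r).
have n0k : 0 != i + j by rewrite eq_sym.
have nkj : i + j != j by rewrite -subr_eq0 addrK.
have nki : i + j != i by rewrite -subr_eq0 addrC addKr.
have nqr : cross (q 0) (r m) != 0.
  apply: (@br_neq0 _ _ _ (q i)); rewrite br_sw23 oppr_eq0 qqr // ?add0r ?em //.
    by rewrite eq_sym.
  by rewrite eq_sym.
(* Collinear because 0 + (i + j) = 2 m. *)
have e0k : br (q 0) (r m) (q (i + j)) = 0.
  by rewrite br_sw23 qqr0 ?oppr0 // add0r em.
have [x [t eqk]] := span2 nqr e0k.
have nx : x != 0.
  apply/eqP => x0; have : br (q (i + j)) (q i) (r m) != 0.
    by apply: (qqr cf nki); rewrite em -subr_eq0 [i + j + i]addrC addrK.
  by rewrite eqk x0 scale0r add0r brZ br_alt mulr0 eqxx.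
have nt : t != 0.
  have nc : cross (q 0) (q (i + j)) != 0.
    by apply: (@br_neq0 _ _ _ (q i)); apply: (qqq cf); rewrite // eq_sym.
  by apply: contra_neq nc => t0; rewrite eqk t0 scale0r addr0 crossZ crossuu scaler0.
have eqk' : q (i + j) = x *: q 0 + (t * y) *: q i + (t * z) *: q j.
  by rewrite eqk er scalerDr !scalerA addrA.
have hr' : (t * y) * E + (t * z) * G = 0 by rewrite -!mulrA -mulrDr hr mulr0.
have nz' : t * z != 0 by rewrite mulf_neq0.
have nw : t * z * s1 - t * y * s2 != 0.
  have := br_s_q0 nk0.
  have := br_coords (q 0) (q i) (q j) s0 s1 s2 1 0 0 x (t * y) (t * z).
  rewrite -es -e0 -eqk' -/d => ->; apply: contra_neq => w0.
  by transitivity (- (t * z * s1 - t * y * s2) * d); [ring|rewrite w0; ring].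
have hq : x * (t * y * A + t * z * B) + (t * y) ^+ 2 * C + (t * z) ^+ 2 * D
    + 2%:R * (t * y) * (t * z) * H = 0.
  have f1 : f (q 0) (q 0) (r m) = y * A + z * B by rewrite er (tri_lin3 fT).
  have f2 : f (q 0) (r m) (r m) = y ^+ 2 * C + z ^+ 2 * D + 2%:R * y * z * H.
    by rewrite (tri_rot fT) er (tri_line2 fT) -!(tri_rot fT (q 0)) -/C -/D -/H; ring.
  have := fq (i + j); rewrite eqk (tri_line fT) fq fr f1 f2 => h.
  apply: (mulfI n3); apply: (mulfI nx); rewrite !mulr0 -[RHS]h; ring.
have W := chord_identity h0' (etrans (esym h1) h1') (etrans (esym h2) h2') hr' nz' nw hq.
have := br_coords (q 0) (q i) (q j) (- (s0 * C + s2 * E) * s0)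
  (k * d * s2 - (s0 * C + s2 * E) * s1) (- (s0 * C + s2 * E) * s2)
  (- (s0 * D + s1 * G) * s0) (- (s0 * D + s1 * G) * s1)
  (- (k * d * s1) - (s0 * D + s1 * G) * s2) x (t * y) (t * z).
rewrite -eqk' -pi -pj -/d => ->.
transitivity (k * d * (- (k * d) * s1 * s2 * x
    - s2 * (s0 * D + s1 * G) * (s2 * x - s0 * (t * z))
    + s1 * (s0 * C + s2 * E) * (s1 * x - s0 * (t * y))) * d); first by ring.
by rewrite W !(mulr0, mul0r).
Qed.

End Halving.

(** * The halves form a configuration *)

Section Preimage.
Variable K : numFieldType.
Local Notation V := 'rV[K]_3.
Local Notation I := 'I_7.
Variables (q r : I -> V) (f : V -> V -> V -> K).
Hypotheses (cf : config q r) (fC : on_cubic f q r).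
Let fT : trilinear f. Proof. by case: fC. Qed.
Let fq c : f (q c) (q c) (q c) = 0. Proof. by case: fC. Qed.
Let fqr c : f (q c) (q c) (r c) = 0. Proof. by case: fC. Qed.
Variable s : V.
Hypotheses (fs : f s s s = 0) (fs0 : f s s (q 0) = 0).
Hypotheses (ns : cross s (q 0) != 0) (nsing : exists x, f s s x != 0).
Local Notation halfpt := (half_point q f s).

(* half_point (4 a) has index 8 a = a. *)
Definition half (a : I) : V := if a == 0 then s else halfpt (a * 4%:R).

Lemma half0 : half 0 = s. Proof. by rewrite /half eqxx. Qed.
Lemma half_double i : i != 0 -> half (i + i) = halfpt i.
Proof.
move=> ni; rewrite /half halfK ifN //; apply: contra ni => /eqP e.
by rewrite -[ i ]halfK e mul0r.
Qed.

Lemma double_neq0 (i : I) : i != 0 -> i + i != 0.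
Proof. by apply: contra => /eqP e; rewrite -[ i ]halfK e mul0r. Qed.

Lemma f_ssq i : i != 0 -> f s s (q i) != 0.
Proof.
move=> ni; have [k nk ->] := tangent_at_s fC fs fs0 ns nsing.
by rewrite mulf_neq0 // (br_s_q0 cf fC).
Qed.

Let fsq i : i != 0 -> f s (q i) (q i) != 0.
Proof. by apply: (f_s_q cf fC fs fs0 ns). Qed.

Lemma cross_s_q i : i != 0 -> cross s (q i) != 0.
Proof.
move=> ni; apply: (@br_neq0 _ _ _ (q 0)); rewrite br_sw23 oppr_eq0.
exact: (br_s_q0 cf fC).
Qed.

Lemma br_s_halfpt i x : br s (halfpt i) x = f s s (q i) * br s (q i) x.
Proof. by rewrite /half_point -scaleNr !(brD, brZ) br_alt mulr0 addr0. Qed.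

(** Writing i = 2 a and j = 2 b turns k into a + b. If a or b is 0, the line is s q_k, which
    contains the other half by construction. *)
Lemma br_half i j k : i != j -> i + j = k + k -> br (half i) (half j) (q k) = 0.
Proof.
have [a <-] := half_exists i; have [b <-] := half_exists j => nab e.
have {e} -> : k = a + b by apply: half_inj; rewrite -e addrACA.
case: (eqVneq a 0) => [a0|na]; case: (eqVneq b 0) => [b0|nb].
- by rewrite a0 b0 eqxx in nab.
- by rewrite a0 !add0r half0 half_double // br_s_halfpt br_alt mulr0.
- rewrite b0 !addr0 half0 half_double // br_sw br_s_halfpt br_alt mulr0.
  by rewrite oppr0.
rewrite !half_double //; apply: (br_halfpt cf fC) => //.
by apply: contra nab => /eqP ->.
Qed.

Lemma half_cubic i : f (half i) (half i) (half i) = 0.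
Proof.
have [a <-] := half_exists i.
case: (eqVneq a 0) => [->|na]; first by rewrite addr0 half0.
rewrite half_double // /half_point -scaleNr (tri_line fT) fq fs.
by rewrite -(tri_rot fT s (q a)) (tri_rot fT (q a) s); ring.
Qed.

Lemma half_neq0 i : half i != 0.
Proof.
have [a <-] := half_exists i.
case: (eqVneq a 0) => [->|na].
  rewrite addr0 half0; apply: contra_neq ns => ->.
  by apply: vecP; rewrite !mxE /=; ring.
rewrite half_double //; apply/eqP => e0.
have [w nw] := cross_neq0 (cross_s_q na).
have := br_s_halfpt a w; rewrite e0.
have -> : br s 0 w = 0 by rewrite -(scale0r 0) brZ mul0r.
by move/esym/eqP; rewrite mulf_eq0 (negPf nw) (negPf (f_ssq na)).
Qed.

Lemma halfpt_par i x : i != 0 -> cross (halfpt i) x = 0 -> br s (q i) x = 0.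
Proof.
move=> ni e; apply: (mulfI (f_ssq ni)); rewrite mulr0 -br_s_halfpt br_rot.
exact: br_cross0.
Qed.

Lemma nil_par i (j : I) : i != j -> cross (q i) (q j) != 0.
Proof.
move=> nij; have [k /andP[nik njk]] : exists k, (i != k) && (j != k).
  by exists (if (i + 1 == j) then i + 2%:R else i + 1); move: nij; clear; caseI i; caseI j; vm_compute.
exact: br_neq0 (qqq cf nij nik njk).
Qed.

Lemma half_par0 i : i != 0 -> cross s (half i) != 0.
Proof.
have [a <-] := half_exists i => n2a.
have na : a != 0 by apply: contra n2a => /eqP ->; rewrite addr0.
rewrite half_double //.
have [w nw] := cross_neq0 (cross_s_q na).
by apply: (@br_neq0 _ _ _ w); rewrite br_s_halfpt mulf_neq0 // f_ssq.
Qed.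

(** If p_(2a) and p_(2b) were one point m, then m would be on the lines p_(2k) q_(a+k) and p_(2k)
    q_(b+k), hence collinear with q_(a+k) and q_(b+k), for all k other than a and b. Three
    consecutive such lines form a chain q_(e1) q_(e2), q_(e2) q_(e3), q_(e3) q_(e4): the first two
    force m = q_(e2), and then the third makes three points q collinear. *)
Lemma half_par i j : i != j -> cross (half i) (half j) != 0.
Proof.
have [a <-] := half_exists i; have [b <-] := half_exists j => nab.
have {}nab : a != b by apply: contra nab => /eqP ->.
case: (eqVneq a 0) nab => [->|na] nab.
  by rewrite addr0 half0 half_par0 // double_neq0 // eq_sym.
case: (eqVneq b 0) nab => [->|nb] nab.
  by rewrite addr0 half0 crossC oppr_eq0 half_par0 // double_neq0.
rewrite !half_double //; apply/eqP => e0.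
set m := halfpt a in e0 *.
have nm : m != 0 by rewrite /m -half_double // half_neq0.
have par_s k l : k != 0 -> l != 0 -> cross (halfpt k) (halfpt l) = 0 ->
    br s (q k) (q l) = 0.
  move=> nk nl /(halfpt_par nk); rewrite /half_point -scaleNr !(brD, brZ) br_alt.
  by rewrite mulr0 addr0 => /eqP; rewrite mulf_eq0 (negPf (f_ssq nl)) => /eqP.
have sab : br s (q a) (q b) = 0 by apply: par_s.
have [t et] := cross_eq0 nm e0.
have colk k : k != a -> k != b -> br m (q (a + k)) (q (b + k)) = 0.
  move=> nka nkb; case: (eqVneq k 0) => [->|nk].
    by rewrite !addr0 /m /half_point -scaleNr !(brD, brZ) sab br_alt !mulr0 addr0.
  have nPm : cross (half (k + k)) m != 0.
    rewrite half_double //; apply/eqP => /(par_s k a nk na) ska.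
    have := qqq cf nka nkb nab; rewrite -oppr_eq0 -br_sw.
    rewrite (collinear3 (cross_s_q na)) ?eqxx ?br_alt //.
    by rewrite br_sw23 ska oppr0.
  have nn i' j' : i' != j' -> i' + i' != j' + j' :> I.
    by apply: contra => /eqP/half_inj ->.
  apply: (collinear3 nPm); first by rewrite br_alt.
    rewrite /m -half_double //; apply: br_half; first exact: nn.
    by rewrite addrACA [k + a]addrC.
  have : br (half (k + k)) (half (b + b)) (q (b + k)) = 0.
    by apply: br_half; [exact: nn|rewrite addrACA [k + b]addrC].
  rewrite [half (b + b)]half_double // et brZ => /eqP; rewrite mulf_eq0.
  case/orP=> [/eqP t0|/eqP //].
  by have := half_neq0 (b + b); rewrite half_double // et t0 scale0r eqxx.
(* For k = b + n (b - a) the indices a + k and b + k are [e n] and [e n.+1]. The value n = 0 would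
   give the excluded k = b. *)
pose e n : I := a + b + (b - a) *+ n.
have ek n : e n = a + (b + (b - a) *+ n) by rewrite addrA.
have ek' n : e n.+1 = b + (b + (b - a) *+ n).
  by rewrite /e mulrS; ring.
have col n : (0 < n < 4)%N -> br m (q (e n)) (q (e n.+1)) = 0.
  move=> hn; rewrite ek ek'; apply: colk.
    by move: nab hn; clear; case: n => [|[|[|[|//]]]] // + _; caseI a; caseI b; vm_compute.
  by move: nab hn; clear; case: n => [|[|[|[|//]]]] // + _; caseI a; caseI b; vm_compute.
have dist : [&& e 1 != e 2, e 1 != e 3, e 2 != e 3, e 2 != e 4 & e 3 != e 4].
  by move: nab; rewrite /e; clear; caseI a; caseI b; vm_compute.
case/and5P: dist => n12 n13 n23 n24 n34.
have cm2 : cross m (q (e 2)) = 0.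
  apply/eqP/negPn/negP => nc; have := qqq cf n12 n13 n23.
  rewrite (collinear3 nc) ?eqxx ?br_alt ?col //.
  by rewrite br_sw23 col // oppr0.
have [t' et'] := cross_eq0 nm cm2.
by have := qqq cf n23 n24 n34; rewrite et' brZ col // mulr0 eqxx.
Qed.

(** Otherwise p_(2i) and p_(2j), which are distinct, are both on the line s q_i q_j. Then q_(i+j),
    on the line of these two, is collinear with q_i and q_j. *)
Lemma br_s_qq i j : i != 0 -> j != 0 -> i != j -> br s (q i) (q j) != 0.
Proof.
move=> ni nj nij; apply/eqP => e0.
have nd : i + i != j + j by apply: contra nij => /eqP/half_inj ->.
have := half_par nd; rewrite !half_double // => np.
have e1 : br (halfpt i) (halfpt j) (q (i + j)) = 0 by apply: (br_halfpt cf fC).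
have nc := cross_s_q ni.
have ci : br s (q i) (halfpt i) = 0.
  by rewrite /half_point -scaleNr !(brD, brZ) !br_alt !mulr0 addr0.
have cj : br s (q i) (halfpt j) = 0.
  by rewrite /half_point -scaleNr !(brD, brZ) br_alt e0 !mulr0 addr0.
have hi : br (halfpt i) (halfpt j) (q i) = 0.
  by apply: (collinear3 nc); rewrite ?br_alt.
have hj : br (halfpt i) (halfpt j) (q j) = 0.
  by apply: (collinear3 nc).
have : br (q i) (q j) (q (i + j)) != 0.
  apply: (qqq cf nij); first by rewrite -subr_eq0 opprD addNKr oppr_eq0.
  by rewrite -subr_eq0 opprD addrCA subrr addr0 oppr_eq0.
by rewrite (collinear3 np) ?eqxx.
Qed.

Lemma br_halfpt_q i x y : br (halfpt i) x y =
  f s s (q i) * br (q i) x y - f s (q i) (q i) * br s x y.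
Proof. by rewrite /half_point -scaleNr !(brD, brZ); ring. Qed.

(** Let a = 2 i. A point p_a on q_a q_c would be r_m with 2 m = a + c, by [third_point]. If c = 0,
    then m = i and s is on the tangent q_i r_i, against [f_s_q]. Otherwise r_m is also on q_i
    q_(i+c), and since p_a q_i is the line s q_i, the points s, q_i, q_(i+c) would be collinear. *)
Lemma br_half_qq a c : a != c -> br (half a) (q a) (q c) != 0.
Proof.
have [i <-] := half_exists a.
case: (eqVneq i 0) => [->|ni] nac.
  by move: nac; rewrite !addr0 half0 => nac; rewrite (br_s_q0 cf fC) // eq_sym.
rewrite half_double //; apply/eqP => e0.
have nsi := f_ssq ni; have nii := fsq ni.
have n2i := double_neq0 ni.
have ni2i : i != i + i by rewrite -subr_eq0 opprD addNKr oppr_eq0.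
have ncr := nil_par nac.
have brs k : i != k -> k != 0 -> br (halfpt i) (q i) (q k) != 0.
  move=> nik nk; rewrite br_halfpt_q br_alt mulr0 sub0r oppr_eq0.
  by rewrite mulf_neq0 // br_s_qq.
have [|x [y e]] := span2 ncr (x := halfpt i); first by rewrite -br_rot.
have ny : y != 0.
  apply: contra_neq (brs (i + i) ni2i n2i) => y0.
  by rewrite e y0 scale0r addr0 brZ br_sw23 br_sw br_alt !(oppr0, mulr0).
have nx : x != 0.
  apply/eqP => x0; move: e; rewrite x0 scale0r add0r => e.
  case: (eqVneq i c) => [ec|nic].
    have [w nw] := cross_neq0 (cross_s_q ni).
    have := br_halfpt_q i (q i) w; rewrite {1}e -ec brZ !br_alt !mulr0 sub0r.
    by move/esym/eqP; rewrite oppr_eq0 mulf_eq0 (negPf nii) (negPf nw).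
  case: (eqVneq c 0) => [c0|nc].
    have : br (halfpt i) (q i) (q c) != 0.
      rewrite br_halfpt_q br_alt mulr0 sub0r oppr_eq0 mulf_neq0 //.
      by rewrite c0 br_sw23 oppr_eq0 (br_s_q0 cf fC).
    by rewrite e brZ br_alt mulr0 eqxx.
  by have := brs c nic nc; rewrite e brZ br_alt mulr0 eqxx.
have [m em] := half_exists (i + i + c).
have fx : f (halfpt i) (halfpt i) (halfpt i) = 0 by rewrite -half_double // half_cubic.
have := third_point cf fC nac (esym em) nx ny; rewrite -e => /(_ fx) cm.
have nh : halfpt i != 0 by rewrite -half_double // half_neq0.
have [t et] := cross_eq0 nh cm.
case: (eqVneq c 0) => [c0|nc].
  have mi : m = i by apply: half_inj; rewrite em c0 addr0.
  have nqr : cross (q i) (r i) != 0.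
    by apply: (@br_neq0 _ _ _ (q 0)); rewrite br_sw23 oppr_eq0 (qqr cf) // addr0.
  have : br (q i) (r i) (halfpt i) = 0 by rewrite -{2}mi et brZ br_alt mulr0.
  rewrite -br_rot br_halfpt_q br_alt mulr0 sub0r => /eqP.
  rewrite oppr_eq0 mulf_eq0 (negPf nii) => /eqP si0.
  have [|u [v es]] := span2 nqr (x := s); first by rewrite -br_rot.
  have := nii; rewrite (tri_rot fT) es (tri_lin3 fT) fq fqr !mulr0 addr0.
  by rewrite eqxx.
have nij : i != i + c by rewrite -subr_eq0 opprD addNKr oppr_eq0.
have : br (q i) (q (i + c)) (r m) = 0 by apply: (qqr0 cf nij); rewrite em addrA.
rewrite et brZ -br_rot => /eqP; rewrite mulf_eq0 => /orP[/eqP t0|].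
  by have := r_neq0 cf m; rewrite et t0 scale0r eqxx.
case: (eqVneq (i + c) 0) => [->|nic0]; last by rewrite (negPf (brs _ _ nic0)).
rewrite br_halfpt_q br_alt mulr0 sub0r oppr_eq0 mulf_eq0 (negPf nii) /=.
by rewrite br_sw23 oppr_eq0 (negPf (br_s_q0 cf fC _ _ _ _)).
Qed.

Lemma half_qq_par a c : cross (half a) (q c) != 0.
Proof.
case: (eqVneq a c) => [->|nac].
  have [k nck] : exists k, c != k.
    by exists (c + 1); clear; caseI c; vm_compute.
  by apply: br_neq0 (br_half_qq nck).
by apply: (@br_neq0 _ _ _ (q a)); rewrite br_sw23 oppr_eq0 br_half_qq.
Qed.

(** A line through three of the p would contain the three points q attached to their pairs, and no
    three q are collinear. *)
Lemma br_halves i j k : i != j -> i != k -> j != k ->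
  br (half i) (half j) (half k) != 0.
Proof.
move=> nij nik njk; apply/eqP => e0.
have [a ea] := half_exists (i + j); have [b eb] := half_exists (i + k).
have [c ec] := half_exists (j + k).
have nab : a != b by apply: contra njk => /eqP eab; rewrite -(inj_eq (addrI i)) -ea -eb eab.
have nac : a != c by apply: contra nik => /eqP eac; rewrite -(inj_eq (addIr j)) -ea [k + j]addrC -ec eac.
have nbc : b != c by apply: contra nij => /eqP ebc; rewrite -(inj_eq (addIr k)) -eb -ec ebc.
have np := half_par nij.
have := qqq cf nab nac nbc; rewrite (collinear3 np) ?eqxx //.
- by apply: br_half; rewrite // ea.
- apply: (collinear3 (half_par nik)); rewrite ?br_alt //.
    by rewrite br_sw23 e0 oppr0.
  by apply: br_half; rewrite // eb.
- apply: (collinear3 (half_par njk)); rewrite ?br_alt //.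
    by rewrite -br_rot.
  by apply: br_half; rewrite // ec.
Qed.

(** The line p_i q_k already contains p_d with d = 2 k - i, so p_j on it would make three p
    collinear. By symmetry i is not k, so that d is not i. *)
Lemma br_half_half_q i j k : i != j -> i + j != k + k ->
  br (half i) (half j) (q k) != 0.
Proof.
wlog nik : i j / i != k => [hw nij e|].
  case: (eqVneq i k) => [eik|nik]; last exact: hw.
  rewrite br_sw oppr_eq0; apply: hw; last by rewrite addrC.
    by rewrite -eik eq_sym.
  by rewrite eq_sym.
move=> nij e.
have ed : i + (k + k - i) = k + k by rewrite addrC subrK.
set d := k + k - i in ed.
have nid : i != d.
  by apply: contra nik => /eqP eid; rewrite -eid in ed; rewrite (half_inj ed).
have njd : j != d by apply: contra e => /eqP ->; rewrite ed.
apply/eqP => e0; have := br_halves nij nid njd.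
rewrite (collinear3 (half_qq_par i k)) ?eqxx ?br_alt //.
  by rewrite br_sw23 e0 oppr0.
by rewrite br_sw23 br_half ?oppr0.
Qed.

Lemma half_config : config half q.
Proof.
split=> [i j k|i j k nij|i j k njk|i j k].
- exact: br_halves.
- case: (eqVneq (i + j) (k + k)) => [e|e].
    by rewrite br_half ?eqxx.
  by rewrite (negPf (br_half_half_q nij e)).
- case: (eqVneq i j) => [eij|nij]; first by rewrite -eij br_half_qq // eij.
  case: (eqVneq i k) => [eik|nik].
    by rewrite br_sw23 oppr_eq0 -eik br_half_qq // eik eq_sym.
  (* The lines p_i q_j and p_i q_k contain p_d and p_e with d = 2 j - i and e = 2 k - i. If they
     coincided, p_i, p_d, p_e would be collinear. *)
  have ed : i + (j + j - i) = j + j by rewrite addrC subrK.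
  have ee : i + (k + k - i) = k + k by rewrite addrC subrK.
  set d := j + j - i in ed; set e := k + k - i in ee.
  have nid : i != d by apply: contra nij => /eqP e1; rewrite -e1 in ed; rewrite (half_inj ed).
  have nie : i != e by apply: contra nik => /eqP e1; rewrite -e1 in ee; rewrite (half_inj ee).
  have nde : d != e.
    apply: contra njk => /eqP e1; rewrite e1 ee in ed.
    by rewrite (half_inj (esym ed)).
  apply/eqP => e0; have := br_halves nid nie nde.
  have hd : br (half i) (q j) (half d) = 0 by rewrite br_sw23 br_half ?oppr0.
  have he : br (half i) (q k) (half e) = 0 by rewrite br_sw23 br_half ?oppr0.
  rewrite (collinear3 (half_qq_par i j)) ?eqxx ?br_alt //.
  apply: (collinear3 (half_qq_par i k)); rewrite ?br_alt //.
  by rewrite br_sw23 e0 oppr0.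
- exact: (qqq cf).
Qed.

End Preimage.

(** * Normal form of a configuration *)

Notation o7 k := (@Ordinal 7 k isT).

Section NormalForm.
Variable K : numFieldType.
Local Notation V := 'rV[K]_3.
Local Notation I := 'I_7.

Section Params.
Variables X Y Z a b c : K.

(* In the frame q_1, q_2, q_4, q_0 the collinearities determine all points of a
   configuration from six parameters, subject to the equations nrel. *)
Definition nq (i : I) : V :=
  match val i with
  | 0 => vec 1 1 1 | 1 => vec 1 0 0 | 2 => vec 0 1 0 | 3 => vec X Y c
  | 4 => vec 0 0 1 | 5 => vec X b Z | _ => vec a Y Z end.

Definition nr (i : I) : V :=
  match val i with
  | 0 => vec X Y Z | 1 => vec X b X | 2 => vec Y Y c | 3 => vec 0 b Z
  | 4 => vec a Z Z | 5 => vec a Y 0 | _ => vec X 0 c end.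

(** The collinearities of q_0, q_6, r_3, of q_0, q_3, r_5 and of q_0, q_5, r_6. *)
Definition nrel : Prop := [/\ a * b - a * Z - b * Z + Y * Z = 0,
  a * c - a * Y - c * Y + X * Y = 0 & b * c - b * X - c * X + Z * X = 0].

(* Obtained by solving for the cubics through the fourteen points. *)
Definition nphi (u v w : V) : K :=
  2%:R * c * (u 0 c0 * v 0 c0 * w 0 c1 + u 0 c0 * v 0 c1 * w 0 c0 + u 0 c1 * v 0 c0 * w 0 c0)
  + 2%:R * (Z - b - c) * (u 0 c0 * v 0 c0 * w 0 c2 + u 0 c0 * v 0 c2 * w 0 c0 + u 0 c2 * v 0 c0 * w 0 c0)
  + 2%:R * b * (u 0 c0 * v 0 c2 * w 0 c2 + u 0 c2 * v 0 c0 * w 0 c2 + u 0 c2 * v 0 c2 * w 0 c0)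
  + 2%:R * (Y - a - b) * (u 0 c1 * v 0 c2 * w 0 c2 + u 0 c2 * v 0 c1 * w 0 c2 + u 0 c2 * v 0 c2 * w 0 c1)
  + 2%:R * a * (u 0 c1 * v 0 c1 * w 0 c2 + u 0 c1 * v 0 c2 * w 0 c1 + u 0 c2 * v 0 c1 * w 0 c1)
  + 2%:R * (X - a - c) * (u 0 c0 * v 0 c1 * w 0 c1 + u 0 c1 * v 0 c0 * w 0 c1 + u 0 c1 * v 0 c1 * w 0 c0)
  + (a + b + c - X - Y - Z) * (u 0 c0 * v 0 c1 * w 0 c2 + u 0 c0 * v 0 c2 * w 0 c1
     + u 0 c1 * v 0 c0 * w 0 c2 + u 0 c1 * v 0 c2 * w 0 c0 + u 0 c2 * v 0 c0 * w 0 c1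
     + u 0 c2 * v 0 c1 * w 0 c0).

Lemma nphi_trilinear : trilinear nphi.
Proof.
by split=> *; rewrite /nphi ?mxE; ring.
Qed.

Hypothesis rel : nrel.
Let rel1 := let: And3 h _ _ := rel in h.
Let rel2 := let: And3 _ h _ := rel in h.
Let rel3 := let: And3 _ _ h := rel in h.

(* The arguments are the coefficients of the polynomial identity expressing the
   goal in terms of the three equations nrel. *)
Local Tactic Notation "by_rel" uconstr(p1) uconstr(p2) uconstr(p3) :=
  rewrite /nphi !vecE;
  transitivity (p1 * (a * b - a * Z - b * Z + Y * Z)
   + p2 * (a * c - a * Y - c * Y + X * Y) + p3 * (b * c - b * X - c * X + Z * X));
  [ring | rewrite rel1 rel2 rel3; ring].

Hypothesis cf : config nq nr.

(** Each of these quantities is the determinant of three of the points q_i. *)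
Lemma nparam_neq0 :
  [/\ [/\ X != 0, Y != 0 & Z != 0], [/\ a != 0, b != 0 & c != 0],
   [/\ Z - Y != 0, X - Z != 0 & Y - X != 0]
   & [/\ c - Y != 0, b - X != 0 & b - Z != 0]].
Proof.
have nz n1 n2 n3 (h1 : (n1 < 7)%N) (h2 : (n2 < 7)%N) (h3 : (n3 < 7)%N) x :
    n1 != n2 -> n1 != n3 -> n2 != n3 ->
    br (nq (Ordinal h1)) (nq (Ordinal h2)) (nq (Ordinal h3)) = x -> x != 0.
  by move=> n12 n13 n23 <-; apply: (qqq cf).
split; split;
[ apply: (nz 5 2 4)%N | apply: (nz 1 6 4)%N | apply: (nz 1 2 6)%N
| apply: (nz 6 2 4)%N | apply: (nz 1 5 4)%N | apply: (nz 1 2 3)%N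
| apply: (nz 1 0 6)%N | apply: (nz 2 0 5)%N | apply: (nz 4 0 3)%N
| apply: (nz 1 0 3)%N | apply: (nz 4 0 5)%N | apply: (nz 0 1 5)%N ];
by rewrite // /br /nq /= !vecE; ring.
Qed.

(** Incidence and tangency are polynomial identities modulo [nrel]. Smoothness at q_c is shown by
    one partial derivative that is, modulo [nrel], a product of factors nonzero by [nparam_neq0]. *)
Lemma nphi_on_cubic : on_cubic nphi nq nr.
Proof.
have [[nX nY nZ] [na nb nc] [nZY nXZ nYX] _] := nparam_neq0.
split; first exact: nphi_trilinear.
- move=> [[|[|[|[|[|[|[|//]]]]]]] i]; rewrite /nq /=.
  + by_rel 0 0 0.
  + by_rel 0 0 0.
  + by_rel 0 0 0.
  + by_rel 0 (6%:R * X * Y - 6%:R * c * Y) (- 6%:R * c * Y + 6%:R * c * X).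
  + by_rel 0 0 0.
  + by_rel (6%:R * b * Z - 6%:R * b * X) 0 (6%:R * X * Z - 6%:R * b * X).
  + by_rel (6%:R * Y * Z - 6%:R * a * Z) (- 6%:R * a * Z + 6%:R * a * Y) 0.
- move=> [[|[|[|[|[|[|[|//]]]]]]] i]; rewrite /nr /=.
  + by_rel (6%:R * Y * Z - 6%:R * X * Z - 6%:R * c * Y + 6%:R * c * X)
      (- 6%:R * Y * Z + 6%:R * X * Y + 6%:R * b * Z - 6%:R * b * X)
      (6%:R * X * Z - 6%:R * X * Y - 6%:R * a * Z + 6%:R * a * Y).
  + by_rel 0 0 (6%:R * X ^+ 2 - 6%:R * b * X).
  + by_rel 0 (6%:R * Y ^+ 2 - 6%:R * c * Y) 0.
  + by_rel (6%:R * b * Z) 0 0.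
  + by_rel (6%:R * Z ^+ 2 - 6%:R * a * Z) 0 0.
  + by_rel 0 (6%:R * a * Y) 0.
  + by_rel 0 0 (6%:R * c * X).
- move=> [[|[|[|[|[|[|[|//]]]]]]] i]; rewrite /nq /nr /=.
  + by_rel 0 0 0.
  + by_rel 0 0 2%:R.
  + by_rel 0 2%:R 0.
  + by_rel (2%:R * c * Y - 2%:R * c * X)
      (- 2%:R * Y * Z - 2%:R * X * Z + 4%:R * b * X - 2%:R * b * c)
      (- 2%:R * Y * Z + 2%:R * X * Z - 2%:R * b * c).
  + by_rel 2%:R 0 0.
  + by_rel (2%:R * Y * Z - 2%:R * X * Z - 2%:R * X * Y + 2%:R * c * X
        + 2%:R * b * X - 2%:R * b * c - 2%:R * a * b)
      (- 2%:R * b * Z + 2%:R * b * X)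
      (- 2%:R * X * Y - 2%:R * b * Z + 2%:R * a * Z).
  + by_rel (- 2%:R * X * Z - 2%:R * X * Y + 4%:R * c * Y - 2%:R * a * c)
      (- 2%:R * X * Z + 2%:R * X * Y - 2%:R * a * c)
      (2%:R * a * Z - 2%:R * a * Y).
have n2 : 2%:R != 0 :> K by rewrite pnatr_eq0.
have neq x e v : x != 0 -> nphi v v e = x -> exists w, nphi v v w != 0.
  by move=> nx ex; exists e; rewrite ex.
move=> [[|[|[|[|[|[|[|//]]]]]]] i]; rewrite /nq /=.
- apply: (neq (2%:R * (Z - Y)) (vec 1 0 0)); first by rewrite !mulf_neq0.
  by rewrite /nphi !vecE; ring.
- apply: (neq (2%:R * c) (vec 0 1 0)); first by rewrite !mulf_neq0.
  by rewrite /nphi !vecE; ring.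
- apply: (neq (2%:R * a) (vec 0 0 1)); first by rewrite !mulf_neq0.
  by rewrite /nphi !vecE; ring.
- apply: (neq (2%:R * c * (Y - X) * a) (vec 0 1 0)); first by rewrite !mulf_neq0.
  apply/eqP; rewrite -subr_eq0; apply/eqP.
  by_rel 0 (4%:R * X - 2%:R * c) (- 2%:R * c).
- apply: (neq (2%:R * b) (vec 1 0 0)); first by rewrite !mulf_neq0.
  by rewrite /nphi !vecE; ring.
- apply: (neq (2%:R * b * (X - Z) * c) (vec 1 0 0)); first by rewrite !mulf_neq0.
  apply/eqP; rewrite -subr_eq0; apply/eqP.
  by_rel (- 2%:R * b) 0 (4%:R * Z - 2%:R * b).
- apply: (neq (2%:R * a * (Z - Y) * b) (vec 0 0 1)); first by rewrite !mulf_neq0.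
  apply/eqP; rewrite -subr_eq0; apply/eqP.
  by_rel (4%:R * Y - 2%:R * a) (- 2%:R * a) 0.
Qed.

(** At z = x r_1 + y r_6 the cubic equals 3 x y (x [f1] + y [f2]). By [e1] and [e2] the linear
    factor is, up to 2 b (c - X) / Y, the condition that z be on r_2 r_5. *)
Lemma nphi_next (z : V) :
  br (nr (o7 1)) (nr (o7 6)) z = 0 -> br (nr (o7 2)) (nr (o7 5)) z = 0 ->
  nphi z z z = 0.
Proof.
have fC := nphi_on_cubic; case: (fC) => fT _ fr _ _.
have [[_ nY _] _ _ _] := nparam_neq0.
have rrr : br (nr (o7 1)) (nr (o7 6)) (nr (o7 0)) != 0 by case: cf => _ _ _; apply.
move=> /(span2 (br_neq0 rrr)) [x [y ->]]; rewrite !(brD, brZ) => e0.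
rewrite (tri_line fT) !fr.
set f1 := nphi _ _ (nr (o7 6)); set f2 := nphi (nr (o7 1)) _ _.
have e1 : f1 * Y = 2%:R * b * (c - X) * br (nr (o7 2)) (nr (o7 5)) (nr (o7 1)).
  apply/eqP; rewrite -subr_eq0 /f1 /nr /= /br; apply/eqP.
  by_rel (2%:R * X * Y * Z - 2%:R * c * X * Z - 2%:R * c * X * Y
       + 2%:R * c ^+ 2 * X - 2%:R * b * X * Y + 2%:R * b * c * Y
       + 2%:R * b * c * X - 2%:R * b * c ^+ 2)
    (- 2%:R * X * Z ^+ 2 + 2%:R * c * X * Z + 4%:R * b * X * Z
       - 2%:R * b * c * Z - 2%:R * b * c * X)
    (- 2%:R * Y ^+ 2 * Z + 2%:R * X * Y * Z + 4%:R * X ^+ 2 * Y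
       + 2%:R * c * X * Y + 2%:R * b * Y * Z - 4%:R * b * X * Y - 2%:R * b * c * Z).
have e2 : f2 * Y = 2%:R * b * (c - X) * br (nr (o7 2)) (nr (o7 5)) (nr (o7 6)).
  apply/eqP; rewrite -subr_eq0 /f2 /nr /= /br; apply/eqP.
  by_rel 0 0 (2%:R * X ^+ 2 * Y + 4%:R * c * X * Y - 2%:R * b * c * Y).
apply: (mulfI nY); rewrite mulr0.
transitivity (3%:R * x * y * (x * (f1 * Y) + y * (f2 * Y))); first by ring.
rewrite e1 e2; transitivity (3%:R * x * y * (2%:R * b * (c - X)
  * (x * br (nr (o7 2)) (nr (o7 5)) (nr (o7 1)) + y * br (nr (o7 2)) (nr (o7 5)) (nr (o7 6))))).
  by ring.
by rewrite e0 !mulr0.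
Qed.

Lemma cubic_vec (h : V -> V -> V -> K) (x y z : K) : trilinear h ->
  let v := vec x y z in let e := vec 1 0 0 in let e' := vec 0 1 0 in
  let e'' := vec 0 0 1 in
  h v v v = x ^+ 3 * h e e e + y ^+ 3 * h e' e' e' + z ^+ 3 * h e'' e'' e''
    + 3%:R * x ^+ 2 * y * h e e e' + 3%:R * x * y ^+ 2 * h e e' e'
    + 3%:R * x ^+ 2 * z * h e e e'' + 3%:R * x * z ^+ 2 * h e e'' e''
    + 3%:R * y ^+ 2 * z * h e' e' e'' + 3%:R * y * z ^+ 2 * h e' e'' e''
    + 6%:R * x * y * z * h e e' e''.
Proof.
move=> hT v e e' e''.
have -> : v = x *: e + y *: e' + z *: e''.
  by apply: vecP; rewrite !mxE /=; ring.
rewrite (tri3 hT) !(triD hT) !(triZ hT).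
rewrite (triCA hT e e' e) (triCA hT e e'' e) (triCA hT e' e'' e') (triCA hT e e'' e').
rewrite -(tri_rot hT e e' e') -(tri_rot hT e e'' e'') -(tri_rot hT e' e'' e'').
rewrite -(tri_rot hT e e' e'').
ring.
Qed.

Lemma trilinear_eq0 (h : V -> V -> V -> K) : trilinear h ->
  let e := vec 1 0 0 in let e' := vec 0 1 0 in let e'' := vec 0 0 1 in
  [/\ h e e e = 0, h e' e' e' = 0, h e'' e'' e'' = 0, h e e e' = 0 & h e e' e' = 0] ->
  [/\ h e e e'' = 0, h e e'' e'' = 0, h e' e' e'' = 0, h e' e'' e'' = 0 & h e e' e'' = 0] ->
  forall u v w, h u v w = 0.
Proof.
move=> hT e e' e'' [h1 h2 h3 h4 h5] [h6 h7 h8 h9 h10].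
have ext y z : h y z e = 0 -> h y z e' = 0 -> h y z e'' = 0 ->
    forall u, h y z u = 0.
  move=> z1 z2 z3 u.
  have -> : u = u 0 c0 *: e + u 0 c1 *: e' + u 0 c2 *: e''.
    by apply: vecP; rewrite !mxE /=; ring.
  by rewrite !(triD hT) !(triZ hT) z1 z2 z3 !mulr0 !addr0.
have x11 : forall u, h e e u = 0 by exact: ext.
have x22 : forall u, h e' e' u = 0.
  by apply: ext => //; rewrite -(tri_rot hT).
have x33 : forall u, h e'' e'' u = 0.
  by apply: ext => //; rewrite -(tri_rot hT).
have x12 : forall u, h e e' u = 0.
  by apply: ext => //; rewrite (triCA hT).
have x13 : forall u, h e e'' u = 0.
  by apply: ext => //; rewrite (triCA hT).
have x23 : forall u, h e' e'' u = 0.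
  apply: ext; [by rewrite -(tri_rot hT) | by rewrite (triCA hT) |].
  by rewrite (tri_rot hT).
have y1 v u : h e v u = 0.
  by rewrite (triCA hT); apply: (ext e u); rewrite (triCA hT) ?x11 ?x12 ?x13.
have y2 v u : h e' v u = 0.
  rewrite (triCA hT); apply: (ext e' u); rewrite (triCA hT) ?x22 ?x23 //.
  by rewrite (triC hT) x12.
have y3 v u : h e'' v u = 0.
  rewrite (triCA hT); apply: (ext e'' u); rewrite (triCA hT) ?x33 //.
    by rewrite (triC hT) x13.
  by rewrite (triC hT) x23.
by move=> u v w; apply: ext; rewrite -(tri_rot hT).
Qed.

(** The last hypothesis removes the multiples of [nphi]. The other coefficients of [h] are
    eliminated one by one, using only q_0, q_1, q_2, q_4, q_5 and r_1, r_2, r_3, r_5, r_6. *)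
Lemma nphi_unique (h : V -> V -> V -> K) : trilinear h ->
  (forall i, h (nq i) (nq i) (nq i) = 0) -> (forall i, h (nr i) (nr i) (nr i) = 0) ->
  h (nq (o7 1)) (nq (o7 1)) (nq (o7 2)) = 0 -> forall u v w, h u v w = 0.
Proof.
move=> hT hq hr h112.
have [[nX nY nZ] [na nb nc] [_ nXZ _] [ncY nbX _]] := nparam_neq0.
have n3 : 3%:R != 0 :> K by rewrite pnatr_eq0.
have n6 : 6%:R != 0 :> K by rewrite pnatr_eq0.
pose e : V := vec 1 0 0; pose e' : V := vec 0 1 0; pose e'' : V := vec 0 0 1.
have cub x y z : h (vec x y z) (vec x y z) (vec x y z) =
    x ^+ 3 * h e e e + y ^+ 3 * h e' e' e' + z ^+ 3 * h e'' e'' e''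
    + 3%:R * x ^+ 2 * y * h e e e' + 3%:R * x * y ^+ 2 * h e e' e'
    + 3%:R * x ^+ 2 * z * h e e e'' + 3%:R * x * z ^+ 2 * h e e'' e''
    + 3%:R * y ^+ 2 * z * h e' e' e'' + 3%:R * y * z ^+ 2 * h e' e'' e''
    + 6%:R * x * y * z * h e e' e'' := cubic_vec x y z hT.
have h111 : h e e e = 0 := hq (o7 1).
have h222 : h e' e' e' = 0 := hq (o7 2).
have h333 : h e'' e'' e'' = 0 := hq (o7 4).
have {}h112 : h e e e' = 0 := h112.
move: cub; rewrite h111 h222 h333 h112.
have h122 : h e e' e' = 0.
  have := hr (o7 5); rewrite /nr /= (cubic_vec _ _ _ hT) -/e -/e' -/e'' h111 h222 h333 h112.
  move=> h0; apply: (mulfI n3); apply: (mulfI na); apply: (mulfI (expf_neq0 2 nY)).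
  by rewrite !mulr0 -h0; ring.
rewrite h122.
set h113 := h e e e''; set h133 := h e e'' e''; set h223 := h e' e' e''.
set h233 := h e' e'' e''; set h123 := h e e' e'' => cub.
have r6 : X * h113 + c * h133 = 0.
  have := hr (o7 6); rewrite /nr /= cub => h0.
  apply: (mulfI n3); apply: (mulfI nX); apply: (mulfI nc); rewrite !mulr0 -h0; ring.
have r3 : b * h223 + Z * h233 = 0.
  have := hr (o7 3); rewrite /nr /= cub => h0.
  apply: (mulfI n3); apply: (mulfI nb); apply: (mulfI nZ); rewrite !mulr0 -h0; ring.
have q0 : h113 + h133 + h223 + h233 + 2%:R * h123 = 0.
  have := hq (o7 0); rewrite /nq /= cub => h0.
  apply: (mulfI n3); rewrite mulr0 -h0; ring.
have r2 : Y * h113 + c * h133 + Y * h223 + c * h233 + 2%:R * Y * h123 = 0.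
  have := hr (o7 2); rewrite /nr /= cub => h0.
  apply: (mulfI n3); apply: (mulfI nY); apply: (mulfI nc); rewrite !mulr0 -h0; ring.
have r1 : X ^+ 2 * h113 + X ^+ 2 * h133 + b ^+ 2 * h223 + b * X * h233
    + 2%:R * X * b * h123 = 0.
  have := hr (o7 1); rewrite /nr /= cub => h0.
  apply: (mulfI n3); apply: (mulfI nX); rewrite !mulr0 -h0; ring.
have q5 : X ^+ 2 * h113 + X * Z * h133 + b ^+ 2 * h223 + b * Z * h233
    + 2%:R * X * b * h123 = 0.
  have := hq (o7 5); rewrite /nq /= cub => h0.
  apply: (mulfI n3); apply: (mulfI nZ); rewrite !mulr0 -h0; ring.
have e1 : h133 + h233 = 0.
  apply: (mulfI ncY); rewrite mulr0.
  transitivity ((Y * h113 + c * h133 + Y * h223 + c * h233 + 2%:R * Y * h123)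
    - Y * (h113 + h133 + h223 + h233 + 2%:R * h123)); first by ring.
  by rewrite r2 q0; ring.
have e2 : h233 = 0.
  apply: (mulfI nXZ); apply: (mulfI nbX); rewrite !mulr0.
  transitivity ((X ^+ 2 * h113 + X ^+ 2 * h133 + b ^+ 2 * h223 + b * X * h233
    + 2%:R * X * b * h123) - (X ^+ 2 * h113 + X * Z * h133 + b ^+ 2 * h223
    + b * Z * h233 + 2%:R * X * b * h123) - X * (X - Z) * (h133 + h233)).
    by ring.
  by rewrite r1 q5 e1; ring.
have e3 : h133 = 0 by move: e1; rewrite e2 addr0.
have e4 : h113 = 0.
  by apply: (mulfI nX); rewrite mulr0; move: r6; rewrite e3 mulr0 addr0.
have e5 : h223 = 0.
  by apply: (mulfI nb); rewrite mulr0; move: r3; rewrite e2 mulr0 addr0.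
have e6 : h123 = 0.
  have n2 : 2%:R != 0 :> K by rewrite pnatr_eq0.
  by apply: (mulfI n2); rewrite mulr0; move: q0; rewrite e2 e3 e4 e5 !add0r.
by apply: (trilinear_eq0 hT); split.
Qed.

End Params.
End NormalForm.

(** * Reduction to the normal form *)

Section Normalization.
Variable K : numFieldType.
Local Notation V := 'rV[K]_3.
Local Notation I := 'I_7.

Lemma mulmx_vec (v : V) (M : 'M[K]_3) :
  v *m M = v 0 c0 *: row c0 M + v 0 c1 *: row c1 M + v 0 c2 *: row c2 M.
Proof. by apply/rowP=> j; rewrite !mxE big3. Qed.

Lemma br_mulmx (M : 'M[K]_3) u v w :
  br (u *m M) (v *m M) (w *m M) = br u v w * br (row c0 M) (row c1 M) (row c2 M).
Proof. by rewrite !mulmx_vec br_coords /br; ring. Qed.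

Lemma br_row_unit (M : 'M[K]_3) :
  (M \in unitmx) = (br (row c0 M) (row c1 M) (row c2 M) != 0).
Proof.
apply/idP/idP=> [uM|nz].
  have := br_mulmx M (vec 1 0 0 *m invmx M) (vec 0 1 0 *m invmx M) (vec 0 0 1 *m invmx M).
  rewrite !mulmxKV // => e; apply/eqP => e0; move/eqP: e.
  rewrite e0 mulr0 /br !vecE !(mul0r, mul1r, mulr0, mulr1, subr0, addr0).
  by rewrite oner_eq0.
rewrite -row_free_unit -kermx_eq0; apply/rowV0P => v /sub_kermxP e.
rewrite mulmx_vec in e.
have h (x y z : K) : x *: row c0 M + y *: row c1 M + z *: row c2 M = 0 ->
   [/\ x = 0, y = 0 & z = 0].
  move=> e0; have br0 (u w : V) : br 0 u w = 0 by rewrite -(scale0r 0) brZ mul0r.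
  split; apply: (mulIf nz); rewrite mul0r.
  - by rewrite -(br0 (row c1 M) (row c2 M)) -e0 !(brD, brZ) !br_alt !mulr0 !addr0.
  - have := br0 (row c2 M) (row c0 M); rewrite -e0 !(brD, brZ) !br_alt !mulr0 addr0 add0r.
    by rewrite -br_rot.
  - have := br0 (row c0 M) (row c1 M); rewrite -e0 !(brD, brZ) !br_alt !mulr0 !add0r.
    by rewrite br_rot.
by case: (h _ _ _ e) => e0 e1 e2; apply: vecP; rewrite ?e0 ?e1 ?e2 mxE.
Qed.

Definition sim (M : 'M[K]_3) (q' q : I -> V) : Prop :=
  forall i, exists2 t, t != 0 & q' i *m M = t *: q i.

Lemma sim_inv M q' q : M \in unitmx -> sim M q' q -> sim (invmx M) q q'.
Proof.
move=> uM s i; have [t nt e] := s i; exists t^-1; first by rewrite invr_eq0.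
by apply: (scalerI nt); rewrite scalerA divff // scale1r scalemxAl -e mulmxK.
Qed.

Lemma br_sim M q' q r' r s' s i j k : M \in unitmx ->
  sim M q' q -> sim M r' r -> sim M s' s ->
  (br (q' i) (r' j) (s' k) == 0) = (br (q i) (r j) (s k) == 0).
Proof.
move=> uM /(_ i) [x nx ex] /(_ j) [y ny ey] /(_ k) [z nz ez].
have := br_mulmx M (q' i) (r' j) (s' k); rewrite ex ey ez !brZ => e.
apply/idP/idP => [/eqP e0|/eqP e0].
  move/eqP: e; rewrite e0 mul0r !mulf_eq0 (negPf nx) (negPf ny) (negPf nz) /=.
  by [].
move/esym/eqP: e; rewrite e0 !mulr0 mulf_eq0.
by rewrite br_row_unit in uM; rewrite (negPf uM) orbF.
Qed.

Lemma config_sim M q' r' q r : M \in unitmx -> sim M q' q -> sim M r' r ->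
  config q r -> config q' r'.
Proof.
move=> uM sq sr [h1 h2 h3 h4]; split=> i j k *.
- by rewrite (br_sim i j k uM sq sq sq) h1.
- by rewrite (br_sim i j k uM sq sq sr) h2.
- by rewrite (br_sim i j k uM sq sr sr) h3.
- by rewrite (br_sim i j k uM sr sr sr) h4.
Qed.

Lemma trilinear_mul f (M : 'M[K]_3) : trilinear f ->
  trilinear (fun u v w => f (u *m M) (v *m M) (w *m M)).
Proof.
move=> [h1 h2 h3]; split=> *; rewrite ?mulmxDl -?scalemxAl; [exact: h1|exact: h2|exact: h3].
Qed.

Lemma on_cubic_sim M q' r' q r f : M \in unitmx -> sim M q' q -> sim M r' r ->
  on_cubic f q r -> on_cubic (fun u v w => f (u *m M) (v *m M) (w *m M)) q' r'.
Proof.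
move=> uM sq sr [fT h1 h2 h3 h4]; split=> [|i|i|i|i].
- exact: trilinear_mul.
- by have [t nt ->] := sq i; rewrite !(triZ fT) h1 !mulr0.
- by have [t nt ->] := sr i; rewrite !(triZ fT) h2 !mulr0.
- by have [t nt ->] := sq i; have [t' nt' ->] := sr i; rewrite !(triZ fT) h3 !mulr0.
have [t nt ->] := sq i; have [x nx] := h4 i; exists (x *m invmx M).
by rewrite mulmxKV // !(triZ fT) !mulf_neq0.
Qed.

Section Core.
Variables (X X' Y Z a b c : K) (r : I -> V).
Let q i := if i == o7 3 then vec X' Y c else nq X Y Z a b c i.
Hypothesis cf : config q r.

(** Rescaling q_3, q_5, q_6 can equate the second coordinates of q_3 and q_6 and the third ones of
    q_5 and q_6. That the first coordinates of q_3 and q_5 then agree is the concurrency of q_1 q_6,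
    q_2 q_5 and q_3 q_4 in r_0. Every other r_i is the meet of two known lines, and a third line
    through r_3, r_5 and r_6 gives [nrel]. *)
Lemma normal_core : [/\ X' = X, nrel X Y Z a b c &
  forall i, exists2 t, t != 0 & nr X Y Z a b c i = t *: r i].
Proof.
have nz n1 n2 n3 (h1 : (n1 < 7)%N) (h2 : (n2 < 7)%N) (h3 : (n3 < 7)%N) x :
    n1 != n2 -> n1 != n3 -> n2 != n3 ->
    br (q (Ordinal h1)) (q (Ordinal h2)) (q (Ordinal h3)) = x -> x != 0.
  by move=> n12 n13 n23 <-; apply: (qqq cf).
have nX : X != 0.
  by apply: (nz 5 2 4)%N; rewrite // /q /nq /br /= !vecE; ring.
have nY : Y != 0.
  by apply: (nz 1 6 4)%N; rewrite // /q /nq /br /= !vecE; ring.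
have nZ : Z != 0.
  by apply: (nz 1 2 6)%N; rewrite // /q /nq /br /= !vecE; ring.
have line n1 n2 n3 (h1 : (n1 < 7)%N) (h2 : (n2 < 7)%N) (h3 : (n3 < 7)%N) x :
    n1 != n2 -> Ordinal h1 + Ordinal h2 = Ordinal h3 + Ordinal h3 :> I ->
    br (q (Ordinal h1)) (q (Ordinal h2)) (r (Ordinal h3)) = x -> x = 0.
  by move=> n12 e <-; apply: (qqr0 cf).
have nr0 := r_neq0 cf.
have scal i v t : r i = t *: v -> exists2 t, t != 0 & v = t *: r i.
  move=> e; have nt : t != 0 by apply: contra_neq (nr0 i) => t0; rewrite e t0 scale0r.
  by exists t^-1; rewrite ?invr_eq0 // e scalerA mulVf // scale1r.
have e0 : X' = X /\ exists t, r (o7 0) = t *: nr X Y Z a b c (o7 0).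
  set x := r (o7 0) 0 c0; set y := r (o7 0) 0 c1; set z := r (o7 0) 0 c2.
  have e1 : Y * z - Z * y = 0.
    by apply: (line 1 6 0 isT isT isT)%N => //; [exact: val_inj|]; rewrite /q /nq /br /= !vecE /x /y /z; ring.
  have e2 : Z * x - X * z = 0.
    by apply: (line 2 5 0 isT isT isT)%N => //; [exact: val_inj|]; rewrite /q /nq /br /= !vecE /x /y /z; ring.
  have e3 : X' * y - Y * x = 0.
    by apply: (line 4 3 0 isT isT isT)%N => //; [exact: val_inj|]; rewrite /q /nq /br /= !vecE /x /y /z; ring.
  have ex : x = z / Z * X.
    by apply: (mulfI nZ); move/eqP: e2; rewrite subr_eq0 => /eqP ->; field.
  have ey : y = z / Z * Y.
    by apply: (mulfI nZ); move/eqP: e1; rewrite subr_eq0 => /eqP <-; field.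
  have er : r (o7 0) = z / Z *: nr X Y Z a b c (o7 0).
    by apply: vecP; rewrite /nr /= !mxE /=; [exact: ex|exact: ey|rewrite -/z; field].
  split; last by exists (z / Z).
  have nt : z / Z != 0 by apply: contra_neq (nr0 (o7 0)) => t0; rewrite er t0 scale0r.
  apply/eqP; rewrite -subr_eq0; apply/eqP; apply: (mulfI nt); apply: (mulfI nY).
  by rewrite !mulr0 -e3 ex ey; ring.
case: e0 => eX [t0 e0].
have l0 i x y z t : r i 0 c0 = t * x -> r i 0 c1 = t * y -> r i 0 c2 = t * z ->
    r i = t *: vec x y z.
  by move=> h0 h1 h2; apply: vecP; rewrite !mxE.
have quot (p p' u v : K) : p != 0 -> p * u - p' * v = 0 -> u = v / p * p'.
  by move=> np /eqP; rewrite subr_eq0 => /eqP e; apply: (mulfI np); rewrite e; field.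
have e1 : r (o7 1) = (r (o7 1) 0 c0 / X) *: vec X b X.
  apply: l0; [by field| |].
    apply: quot => //.
    by apply: (line 4 5 1 isT isT isT)%N => //; [exact: val_inj|]; rewrite /q /nq /br /= !vecE; ring.
  rewrite divfK //; apply/eqP; rewrite -subr_eq0; apply/eqP.
  by apply: (line 0 2 1 isT isT isT)%N => //; [exact: val_inj|]; rewrite /q /nq /br /= !vecE; ring.
have e2 : r (o7 2) = (r (o7 2) 0 c1 / Y) *: vec Y Y c.
  apply: l0; [|by field|].
    rewrite divfK //; apply/eqP; rewrite -subr_eq0; apply/eqP.
    by apply: (line 0 4 2 isT isT isT)%N => //; [exact: val_inj|]; rewrite /q /nq /br /= !vecE; ring.
  apply: quot => //.
  by apply: (line 1 3 2 isT isT isT)%N => //; [exact: val_inj|]; rewrite /q /nq /br /= !vecE; ring.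
have e3 : r (o7 3) = (r (o7 3) 0 c2 / Z) *: vec 0 b Z.
  apply: l0; [| |by field].
    rewrite mulr0.
    by apply: (line 2 4 3 isT isT isT)%N => //; [exact: val_inj|]; rewrite /q /nq /br /= !vecE; ring.
  apply: quot => //.
  by apply: (line 5 1 3 isT isT isT)%N => //; [exact: val_inj|]; rewrite /q /nq /br /= !vecE; ring.
have e4 : r (o7 4) = (r (o7 4) 0 c2 / Z) *: vec a Z Z.
  apply: l0; [| |by field].
    apply: quot => //.
    by apply: (line 2 6 4 isT isT isT)%N => //; [exact: val_inj|]; rewrite /q /nq /br /= !vecE; ring.
  rewrite divfK //; apply/eqP; rewrite -subr_eq0; apply/eqP.
  by apply: (line 0 1 4 isT isT isT)%N => //; [exact: val_inj|]; rewrite /q /nq /br /= !vecE; ring.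
have e5 : r (o7 5) = (r (o7 5) 0 c1 / Y) *: vec a Y 0.
  apply: l0; [|by field|].
    apply: quot => //.
    by apply: (line 6 4 5 isT isT isT)%N => //; [exact: val_inj|]; rewrite /q /nq /br /= !vecE; ring.
  rewrite mulr0.
  by apply: (line 1 2 5 isT isT isT)%N => //; [exact: val_inj|]; rewrite /q /nq /br /= !vecE; ring.
have e6 : r (o7 6) = (r (o7 6) 0 c0 / X) *: vec X 0 c.
  apply: l0; [by field| |].
    rewrite mulr0.
    by apply: (line 4 1 6 isT isT isT)%N => //; [exact: val_inj|]; rewrite /q /nq /br /= !vecE; ring.
  apply: quot => //.
  by apply: (line 3 2 6 isT isT isT)%N => //; [exact: val_inj|]; rewrite /q /nq /br /= !vecE eX; ring.
split=> //; last first.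
  by move=> [[|[|[|[|[|[|[|//]]]]]]] i]; (apply: scal; rewrite (bool_irrelevance i isT));
   [exact: e0|exact: e1|exact: e2|exact: e3|exact: e4|exact: e5|exact: e6].
have rel n1 n2 n3 (h1 : (n1 < 7)%N) (h2 : (n2 < 7)%N) (h3 : (n3 < 7)%N) t v x :
    r (Ordinal h3) = t *: v ->
    n1 != n2 -> Ordinal h1 + Ordinal h2 = Ordinal h3 + Ordinal h3 :> I ->
    br (q (Ordinal h1)) (q (Ordinal h2)) v = x -> x = 0.
  move=> er n12 e <-; have nt : t != 0.
    by apply: contra_neq (nr0 (Ordinal h3)) => t1; rewrite er t1 scale0r.
  by apply: (mulfI nt); rewrite mulr0 -(brZ t _ _ v).2 -er; apply: (qqr0 cf).
split.
- by apply: (rel 0 6 3 isT isT isT _ _ _ e3)%N => //; [exact: val_inj|]; rewrite /q /nq /br /= !vecE; ring.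
- by apply: (rel 0 3 5 isT isT isT _ _ _ e5)%N => //; [exact: val_inj|]; rewrite /q /nq /br /= !vecE eX; ring.
- by apply: (rel 0 5 6 isT isT isT _ _ _ e6)%N => //; [exact: val_inj|]; rewrite /q /nq /br /= !vecE; ring.
Qed.
End Core.

Section Normal.
Variable q : I -> V.
Let w0 := br (q (o7 0)) (q (o7 2)) (q (o7 4)).
Let w1 := br (q (o7 1)) (q (o7 0)) (q (o7 4)).
Let w2 := br (q (o7 1)) (q (o7 2)) (q (o7 0)).
Let fx i := br (q i) (q (o7 2)) (q (o7 4)) * w1 * w2.
Let fy i := br (q (o7 1)) (q i) (q (o7 4)) * w0 * w2.
Let fz i := br (q (o7 1)) (q (o7 2)) (q i) * w0 * w1.

(* The frame q_1, q_2, q_4, q_0 is moved to e_1, e_2, e_3, (1, 1, 1), and all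
   denominators are cleared, so that the parameters are polynomials in q. *)
Definition nfX := fz (o7 6) * fy (o7 3) * fx (o7 5).
Definition nfY := fz (o7 5) * fy (o7 3) * fy (o7 6).
Definition nfZ := fz (o7 5) * fy (o7 3) * fz (o7 6).
Definition nfa := fz (o7 5) * fy (o7 3) * fx (o7 6).
Definition nfb := fz (o7 6) * fy (o7 3) * fy (o7 5).
Definition nfc := fz (o7 5) * fy (o7 6) * fz (o7 3).

Lemma normal_form (r : I -> V) : config q r ->
  nrel nfX nfY nfZ nfa nfb nfc /\ exists2 M, M \in unitmx &
    sim M (nq nfX nfY nfZ nfa nfb nfc) q /\ sim M (nr nfX nfY nfZ nfa nfb nfc) r.
Proof.
move=> cf; pose X' := fz (o7 5) * fy (o7 6) * fx (o7 3).
(* By Cramer's rule the weights make the image of (1, 1, 1) a multiple of q_0, and [fx], [fy], [fz]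
   are coordinates of q_i in this frame. *)
pose M : 'M[K]_3 := \matrix_(i < 3) [:: w0 *: q (o7 1); w1 *: q (o7 2); w2 *: q (o7 4)]`_i.
have r0 : row c0 M = w0 *: q (o7 1) by rewrite rowK.
have r1 : row c1 M = w1 *: q (o7 2) by rewrite rowK.
have r2 : row c2 M = w2 *: q (o7 4) by rewrite rowK.
pose d := br (q (o7 1)) (q (o7 2)) (q (o7 4)).
have nd : d != 0 by apply: (qqq cf).
have nw0 : w0 != 0 by apply: (qqq cf).
have nw1 : w1 != 0 by apply: (qqq cf).
have nw2 : w2 != 0 by apply: (qqq cf).
have uM : M \in unitmx by rewrite br_row_unit r0 r1 r2 !brZ !mulf_neq0.
have fE i t : vec (t * fx i) (t * fy i) (t * fz i) *m M = (t * w0 * w1 * w2 * d) *: q i.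
  rewrite mulmx_vec !vecE r0 r1 r2 -[RHS]scalerA.
  rewrite (cramer (q (o7 1)) (q (o7 2)) (q (o7 4)) (q i)) !scalerDr !scalerA.
  by rewrite /fx /fy /fz; congr (_ *: _ + _ *: _ + _ *: _); ring.
have nz5 : fz (o7 5) != 0 by rewrite !mulf_neq0 //; apply: (qqq cf).
have nz6 : fz (o7 6) != 0 by rewrite !mulf_neq0 //; apply: (qqq cf).
have ny3 : fy (o7 3) != 0 by rewrite !mulf_neq0 //; apply: (qqq cf).
have ny6 : fy (o7 6) != 0 by rewrite !mulf_neq0 //; apply: (qqq cf).
have fsim i t v : t != 0 -> v = vec (t * fx i) (t * fy i) (t * fz i) ->
    exists2 x, x != 0 & v *m M = x *: q i.
  by move=> nt ->; rewrite fE; exists (t * w0 * w1 * w2 * d) => //; rewrite !mulf_neq0.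
have sq : sim M (fun i => if i == o7 3 then vec X' nfY nfc else
    nq nfX nfY nfZ nfa nfb nfc i) q.
  move=> [[|[|[|[|[|[|[|//]]]]]]] i]; rewrite (bool_irrelevance i isT) /nq /=.
  - by exists d; rewrite // mulmx_vec !vecE r0 r1 r2 !scale1r /w0 /w1 /w2 -cramer.
  - by exists w0; rewrite // mulmx_vec !vecE r0 !scale0r !addr0 scale1r.
  - by exists w1; rewrite // mulmx_vec !vecE r1 !scale0r add0r addr0 scale1r.
  - apply: (fsim _ (fz (o7 5) * fy (o7 6))); first by rewrite mulf_neq0.
    by rewrite /X' /nfY /nfc; congr vec; ring.
  - by exists w2; rewrite // mulmx_vec !vecE r2 !scale0r !add0r scale1r.
  - apply: (fsim _ (fz (o7 6) * fy (o7 3))); first by rewrite mulf_neq0.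
    by rewrite /nfX /nfZ /nfb; congr vec; ring.
  - apply: (fsim _ (fz (o7 5) * fy (o7 3))); first by rewrite mulf_neq0.
    by rewrite /nfY /nfZ /nfa; congr vec; ring.
have sr : sim M (fun i => r i *m invmx M) r.
  by move=> i; exists 1; rewrite ?oner_neq0 // mulmxKV // scale1r.
have [eX rel hr] := normal_core (config_sim uM sq sr cf).
split=> //; exists M => //; split=> i.
  have := sq i; case: eqP => // ->.
  by rewrite eX.
have [t nt ->] := hr i; exists t => //.
by rewrite -scalemxAl mulmxKV.
Qed.
End Normal.

End Normalization.

(** * The cubic of a configuration *)

Section Cubics.
Variable K : numFieldType.
Local Notation V := 'rV[K]_3.
Local Notation I := 'I_7.
Implicit Types q r p : I -> V.

Lemma cubic_exists q r : config q r -> exists f, on_cubic f q r.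
Proof.
move=> cf; have [rel [M uM [sq sr]]] := normal_form cf.
have fC := nphi_on_cubic rel (config_sim uM sq sr cf).
have uM' : invmx M \in unitmx by rewrite unitmx_inv.
by eexists; apply: (on_cubic_sim uM' (sim_inv uM sq) (sim_inv uM sr) fC).
Qed.

(** In normal form, f(q_1, q_1, q_2) is nonzero by [fqq], so some [g - l * f] vanishes there and
    [nphi_unique] applies. *)
Lemma cubic_unique q r f g : config q r -> on_cubic f q r -> trilinear g ->
  (forall i, g (q i) (q i) (q i) = 0) -> (forall i, g (r i) (r i) (r i) = 0) ->
  exists l, forall u v w, g u v w = l * f u v w.
Proof.
move=> cf fC gT gq gr; have [rel [M uM [sq sr]]] := normal_form cf.
have cn := config_sim uM sq sr cf.
have fC' := on_cubic_sim uM sq sr fC.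
have gT' := trilinear_mul M gT.
set f' := (fun u v w => _) in fC'; set g' := (fun u v w => _) in gT'.
set nq' := nq _ _ _ _ _ _ in sq cn fC'; set nr' := nr _ _ _ _ _ _ in sr cn fC'.
have n12 : f' (nq' (o7 1)) (nq' (o7 1)) (nq' (o7 2)) != 0 by apply: (fqq cn fC').
set x := f' _ _ _ in n12.
pose l := g' (nq' (o7 1)) (nq' (o7 1)) (nq' (o7 2)) / x.
have fT' : trilinear f' by case: fC'.
have [_ fq' fr' _ _] := fC'.
pose h u v w := g' u v w - l * f' u v w.
have hT : trilinear h.
  split=> *; rewrite /h; first by rewrite (triC gT') (triC fT').
    by rewrite (triCA gT') (triCA fT').
  by rewrite (tri_lin1 gT') (tri_lin1 fT'); ring.
have hq i : h (nq' i) (nq' i) (nq' i) = 0.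
  rewrite /h fq' mulr0 subr0 /g'; have [t nt ->] := sq i.
  by rewrite !(triZ gT) gq !mulr0.
have hr i : h (nr' i) (nr' i) (nr' i) = 0.
  rewrite /h fr' mulr0 subr0 /g'; have [t nt ->] := sr i.
  by rewrite !(triZ gT) gr !mulr0.
have h12 : h (nq' (o7 1)) (nq' (o7 1)) (nq' (o7 2)) = 0.
  by rewrite /h -/x /l divfK ?subrr.
have h0 := nphi_unique cn hT hq hr h12.
exists l => u v w; have := h0 (u *m invmx M) (v *m invmx M) (w *m invmx M).
by rewrite /h /g' /f' !mulmxKV // => /eqP; rewrite subr_eq0 => /eqP.
Qed.

Lemma cubic_next q r f z : config q r -> on_cubic f q r ->
  br (r (o7 1)) (r (o7 6)) z = 0 -> br (r (o7 2)) (r (o7 5)) z = 0 ->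
  f z z z = 0.
Proof.
move=> cf fC z1 z2; have [rel [M uM [sq sr]]] := normal_form cf.
have cn := config_sim uM sq sr cf.
have fC' := on_cubic_sim uM sq sr fC.
set nq' := nq _ _ _ _ _ _ in sq cn fC'; set nr' := nr _ _ _ _ _ _ in sr cn fC'.
have [fT' fq' fr' _ _] := fC'.
have nC := nphi_on_cubic rel cn.
have [l hl] := cubic_unique cn nC fT' fq' fr'.
have sz : sim M (fun=> z *m invmx M) (fun=> z).
  by move=> i; exists 1; rewrite ?oner_neq0 // mulmxKV // scale1r.
have e1 : br (nr' (o7 1)) (nr' (o7 6)) (z *m invmx M) = 0.
  by apply/eqP; rewrite (br_sim _ _ (o7 0) uM sr sr sz) z1.
have e2 : br (nr' (o7 2)) (nr' (o7 5)) (z *m invmx M) = 0.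
  by apply/eqP; rewrite (br_sim _ _ (o7 0) uM sr sr sz) z2.
have := hl (z *m invmx M) (z *m invmx M) (z *m invmx M).
by rewrite (nphi_next rel cn e1 e2) mulr0 mulmxKV.
Qed.

Lemma config_shift q r c : config q r ->
  config (fun i => q (i + c)) (fun i => r (i + c)).
Proof.
move=> [h1 h2 h3 h4]; split=> i j k *.
- by apply: h1; rewrite (inj_eq (addIr _)).
- by rewrite h2 ?(inj_eq (addIr _)) // !(addrACA _ c) (inj_eq (addIr _)).
- by apply: h3; rewrite (inj_eq (addIr _)).
- by apply: h4; rewrite (inj_eq (addIr _)).
Qed.

Lemma on_cubic_shift f q r c : on_cubic f q r ->
  on_cubic f (fun i => q (i + c)) (fun i => r (i + c)).
Proof. by case=> h1 h2 h3 h4 h5; split. Qed.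

(* One cubic carries the points of a realization and of its image. *)
Lemma cubic_iterate p q r f : config p q -> config q r -> on_cubic f p q ->
  forall i, f (r i) (r i) (r i) = 0.
Proof.
move=> cp cq fC i.
(* Shifting all indices by i reduces to index 0: r_i is the meet of q_(i+1) q_(i+6) and q_(i+2)
   q_(i+5). *)
apply: (cubic_next (config_shift i cp) (on_cubic_shift i fC)).
  apply: (qqr0 cq); first by rewrite (inj_eq (addIr _)).
  by clear; caseI i; apply: val_inj.
apply: (qqr0 cq); first by rewrite (inj_eq (addIr _)).
by clear; caseI i; apply: val_inj.
Qed.
End Cubics.

(** * The four halves *)

Section Quartic.
Variable K : comNzRingType.
Implicit Types a b c d e x : K.

Definition quartic a b c d e x :=
  a * x ^+ 4 + b * x ^+ 3 + c * x ^+ 2 + d * x + e.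
Definition quartic' a b c d x :=
  4%:R * a * x ^+ 3 + 3%:R * b * x ^+ 2 + 2%:R * c * x + d.

(* 27 times the discriminant of the quartic. *)
Definition disc4 a b c d e :=
  4%:R * (12%:R * a * e - 3%:R * b * d + c ^+ 2) ^+ 3
  - (72%:R * a * c * e + 9%:R * b * c * d - 27%:R * a * d ^+ 2
     - 27%:R * e * b ^+ 2 - 2%:R * c ^+ 3) ^+ 2.

(** A double root x expresses d and e through x and the other coefficients. After substitution
    [disc4] vanishes identically. *)
Lemma disc4_eq0 a b c d e x :
  quartic a b c d e x = 0 -> quartic' a b c d x = 0 -> disc4 a b c d e = 0.
Proof.
rewrite /quartic /quartic' => h h'.
have ed : d = - (4%:R * a * x ^+ 3 + 3%:R * b * x ^+ 2 + 2%:R * c * x).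
  by rewrite -[LHS]addr0 -[X in _ + X]oppr0 -h'; ring.
have ee : e = - (a * x ^+ 4 + b * x ^+ 3 + c * x ^+ 2 + d * x).
  by rewrite -[LHS]addr0 -[X in _ + X]oppr0 -h; ring.
by rewrite ee ed /disc4; ring.
Qed.
End Quartic.

Lemma quartic_roots (K : closedFieldType) (a b c d e : K) :
  a != 0 -> disc4 a b c d e != 0 ->
  exists x1 x2 x3 x4, uniq [:: x1; x2; x3; x4] /\
    forall x, quartic a b c d e x = 0 <-> x \in [:: x1; x2; x3; x4].
Proof.
move=> na nd.
pose Q : {poly K} := a *: 'X^4 + b *: 'X^3 + c *: 'X^2 + d *: 'X + e%:P.
have QE x : Q.[x] = quartic a b c d e x by rewrite /Q !(hornerD, hornerZ, hornerXn, hornerX, hornerC).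
have Q'E x : Q^`().[x] = quartic' a b c d x.
  rewrite /Q !(derivD, derivZ, derivXn, derivX, derivC) /=.
  by rewrite !(hornerD, hornerZ, hornerMn, hornerXn, hornerX, hornerC) /quartic'; ring.
have sQ : size Q = 5%N.
  have Qi i : Q`_i = [:: e; d; c; b; a]`_i.
    rewrite /Q !coefE; case: i => [|[|[|[|[|i]]]]] /=;
      by rewrite ?(mulr0, mulr1, addr0, add0r) ?nth_nil.
  apply/eqP; rewrite eqn_leq; apply/andP; split.
    by apply/leq_sizeP => i hi; rewrite Qi nth_default.
  by rewrite ltnNge; apply/negP => /leq_sizeP/(_ 4%N (leqnn 4)) /eqP; rewrite Qi (negPf na).
have [rs eQ] := closed_field_poly_normal Q.
have nl : lead_coef Q != 0 by rewrite lead_coef_eq0 -size_poly_eq0 sQ.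
have srs : size rs = 4%N.
  by apply: succn_inj; rewrite -sQ eQ size_scale // size_prod_XsubC.
case: rs srs eQ => [|x1 [|x2 [|x3 [|x4 [|//]]]]] // _ eQ.
exists x1, x2, x3, x4; split=> [|x]; last first.
  rewrite -root_prod_XsubC /root -QE {1}eQ hornerZ; split=> [/eqP|/eqP ->].
    by rewrite mulf_eq0 (negPf nl).
  by rewrite mulr0.
have dbl x y z : ~ perm_eq [:: x1; x2; x3; x4] [:: x; x; y; z].
  move=> pe.
  case/eqP: nd; rewrite (perm_big _ pe) /= !big_cons big_nil mulr1 in eQ.
  apply: (@disc4_eq0 _ _ _ _ _ _ x).
    by rewrite -QE eQ hornerZ !hornerM !hornerXsubC subrr !(mul0r, mulr0).
  rewrite -Q'E eQ derivZ hornerZ !derivM !hornerD !hornerM !hornerXsubC subrr.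
  by rewrite !(mul0r, mulr0, addr0).
rewrite /= !inE !negb_or !andbT.
have d12 : x1 != x2.
  by apply/eqP => exy; apply: (dbl x2 x3 x4); apply/permP => P; rewrite exy /=; ring.
have d13 : x1 != x3.
  by apply/eqP => exy; apply: (dbl x3 x2 x4); apply/permP => P; rewrite exy /=; ring.
have d14 : x1 != x4.
  by apply/eqP => exy; apply: (dbl x4 x2 x3); apply/permP => P; rewrite exy /=; ring.
have d23 : x2 != x3.
  by apply/eqP => exy; apply: (dbl x3 x1 x4); apply/permP => P; rewrite exy /=; ring.
have d24 : x2 != x4.
  by apply/eqP => exy; apply: (dbl x4 x1 x3); apply/permP => P; rewrite exy /=; ring.
have d34 : x3 != x4.
  by apply/eqP => exy; apply: (dbl x4 x1 x2); apply/permP => P; rewrite exy /=; ring.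
by rewrite d12 d13 d14 d23 d24 d34.
Qed.

(* On the line through q_0 and q_1 + T q_2, f vanishes at q_0 and at two more
   points; they coincide iff a certain quartic in T vanishes. tangent_disc is 27 times the
   discriminant of this quartic. *)
Definition tangent_disc (K : numFieldType) (q : 'I_7 -> 'rV[K]_3)
    (f : 'rV[K]_3 -> 'rV[K]_3 -> 'rV[K]_3 -> K) : K :=
  let q0 := q (o7 0) in let q1 := q (o7 1) in let q2 := q (o7 2) in
  let A := f q0 q0 q1 in let B := f q0 q0 q2 in let C := f q0 q1 q1 in
  let D := f q0 q2 q2 in let E := f q1 q1 q2 in let G := f q1 q2 q2 in
  let H := f q0 q1 q2 in
  disc4 (D ^+ 2) (4%:R * H * D - 4%:R * B * G)
    (2%:R * C * D + 4%:R * H ^+ 2 - 4%:R * A * G - 4%:R * B * E)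
    (4%:R * C * H - 4%:R * A * E) (C ^+ 2).

(** * Tangents to the cubic through q_0 *)

Section Fibre.
Variable K : numClosedFieldType.
Local Notation V := 'rV[K]_3.
Local Notation I := 'I_7.
Variables (q r : I -> V) (f : V -> V -> V -> K).

Local Notation q0 := (q (o7 0)).
Local Notation q1 := (q (o7 1)).
Local Notation q2 := (q (o7 2)).
Let A := f q0 q0 q1.
Let B := f q0 q0 q2.
Let C := f q0 q1 q1.
Let D := f q0 q2 q2.
Let E := f q1 q1 q2.
Let G := f q1 q2 q2.
Let H := f q0 q1 q2.

Let Q := quartic (D ^+ 2) (4%:R * H * D - 4%:R * B * G)
  (2%:R * C * D + 4%:R * H ^+ 2 - 4%:R * A * G - 4%:R * B * E)
  (4%:R * C * H - 4%:R * A * E) (C ^+ 2).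

(** At w q_0 + q_1 + T q_2 the cubic is 3 (w^2 [t0 T] + w [pp T] + [ee T]). The discriminant in w of
    the quadratic is [Q T], and its derivative in w is f(s, s, q_0), so tangency is a double root
    w. *)
Let t0 T := A + B * T.
Let pp T := C + 2%:R * H * T + D * T ^+ 2.
Let ee T := T * (E + G * T).

Let QE T : Q T = pp T ^+ 2 - 4%:R * t0 T * ee T.
Proof. by rewrite /Q /quartic /pp /t0 /ee; ring. Qed.

Let pt w T : V := w *: q0 + 1 *: q1 + T *: q2.

Hypotheses (cf : config q r) (fC : on_cubic f q r).
Let fT : trilinear f. Proof. by case: fC. Qed.
Let fq c : f (q c) (q c) (q c) = 0. Proof. by case: fC. Qed.
Let fqr c : f (q c) (q c) (r c) = 0. Proof. by case: fC. Qed.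

Let nd : br q0 q1 q2 != 0. Proof. by apply: (qqq cf). Qed.

Let f_pt0 w T : f (pt w T) (pt w T) q0 = 2%:R * w * t0 T + pp T.
Proof.
rewrite /pt (tri3 fT) fq (triCA fT q0 q1) (triCA fT q0 q2) -!(tri_rot fT q0).
by rewrite /t0 /pp -/A -/B -/C -/D -/H; ring.
Qed.

Let f_pt2 w T : f (pt w T) (pt w T) q2 =
  w ^+ 2 * B + E + 2%:R * w * H + 2%:R * w * T * D + 2%:R * T * G.
Proof. by rewrite /pt (tri3 fT) fq -/B -/D -/E -/G -/H; ring. Qed.

Let f_pt1 w T : f (pt w T) (pt w T) q1 =
  w ^+ 2 * A + 2%:R * w * C + 2%:R * w * T * H + 2%:R * T * E + T ^+ 2 * G.
Proof.
rewrite /pt (tri3 fT) fq (triCA fT q0 q2) (triCA fT q1 q2) -(tri_rot fT q1 q2).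
by rewrite -/A -/C -/E -/G -/H; ring.
Qed.

Let f_pt w T : f (pt w T) (pt w T) (pt w T) =
  3%:R * (w ^+ 2 * t0 T + w * pp T + ee T).
Proof.
have h x : f x x (w *: q0 + 1 *: q1 + T *: q2) = w * f x x q0 + f x x q1 + T * f x x q2.
  by rewrite !(triD fT) !(triZ fT) mul1r.
by rewrite (h (pt w T)) f_pt0 f_pt1 f_pt2 /t0 /pp /ee; ring.
Qed.

(** If [t0 T] = 0, the line is the tangent q_0 r_0. There [pp T] is a nonzero square times f(q_0,
    r_0, r_0), nonzero by [fqrr], and so [Q T] is nonzero. *)
Let t0_neq0 T : Q T = 0 -> t0 T != 0.
Proof.
move=> QT; apply/eqP => t00; pose d := pt 0 T.
have e0 : f q0 q0 d = 0.
  by rewrite /d /pt !(triD fT) !(triZ fT) fq -/A -/B -[RHS]t00 /t0; ring.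
have nqr : cross q0 (r (o7 0)) != 0.
  by apply: (@br_neq0 _ _ _ q1); rewrite br_sw23 oppr_eq0 (qqr cf).
have : br q0 (r (o7 0)) d = 0.
  apply/eqP/negPn/negP => nb; case: fC => _ _ _ _ /(_ (o7 0)) [x].
  by rewrite (tri_vanish fT nb (fq _) (fqr _) e0) eqxx.
case/(span2 nqr) => [a [b ed]].
have nb : b != 0.
  apply/eqP => b0; have : br d q0 q2 = 0 by rewrite ed b0 scale0r addr0 brZ br_alt mulr0.
  rewrite /d /pt scale0r add0r !(brD, brZ) !br_alt mulr0 addr0 mul1r br_sw.
  by move/eqP; rewrite oppr_eq0 (negPf nd).
have : pp T = b ^+ 2 * f q0 (r (o7 0)) (r (o7 0)).
  transitivity (f d d q0); first by rewrite /d f_pt0; ring.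
  rewrite ed (tri_line2 fT) fq (triCA fT q0 (r _)) fqr -(tri_rot fT q0 (r _)); ring.
move/eqP => ep; move: QT; rewrite QE t00 (eqP ep) mulr0 mul0r subr0 => /eqP.
by rewrite expf_eq0 mulf_eq0 expf_eq0 (negPf nb) (negPf (fqrr cf fC _)).
Qed.

Hypothesis ndisc : tangent_disc q f != 0.

Let sol T := pt (- pp T / (2%:R * t0 T)) T.

Let n2 : 2%:R != 0 :> K. Proof. by rewrite pnatr_eq0. Qed.
Let n3 : 3%:R != 0 :> K. Proof. by rewrite pnatr_eq0. Qed.

(** The solution is the double root in w. It is a smooth point since at a zero T of [Q] the
    derivative of [Q] is - 4 [t0 T] f(s, s, q_2), and [Q] has no double root. *)
Let solP T : Q T = 0 -> [/\ f (sol T) (sol T) (sol T) = 0,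
  f (sol T) (sol T) q0 = 0, cross (sol T) q0 != 0 &
  exists x, f (sol T) (sol T) x != 0].
Proof.
move=> QT; have nt := t0_neq0 QT; have QT' := QT; rewrite QE in QT'.
have e0 : f (sol T) (sol T) q0 = 0 by rewrite /sol f_pt0; field.
have e1 : f (sol T) (sol T) (sol T) = 0.
  rewrite /sol f_pt; apply: (mulfI nt); apply: (mulfI n2); apply: (mulfI n2).
  rewrite !mulr0 -[RHS](mulr0 (- 3%:R)) -QT'; field; exact: nt.
split=> //.
  apply: (@br_neq0 _ _ _ q2); rewrite /sol /pt !(brD, brZ) !br_alt !mulr0 addr0 add0r mul1r.
  by rewrite br_sw oppr_eq0.
exists q2; apply/eqP; rewrite /sol; set w := - pp T / _ => e2.
have ew : 2%:R * w * t0 T + pp T = 0 by rewrite -f_pt0.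
have ew2 : w ^+ 2 * t0 T + w * pp T + ee T = 0.
  by apply: (mulfI n3); rewrite -f_pt mulr0.
case/eqP: ndisc; apply: (disc4_eq0 QT); rewrite /quartic'.
have epp : pp T = - (2%:R * w * t0 T) by apply/eqP; rewrite -addr_eq0 addrC ew.
have eee : ee T = w ^+ 2 * t0 T.
  by rewrite -[LHS]addr0 -[X in _ + X]oppr0 -[X in _ - X]ew2 epp; ring.
transitivity (2%:R * pp T * (2%:R * H + 2%:R * D * T) - 4%:R * B * ee T
   - 4%:R * t0 T * (E + 2%:R * G * T)); first by rewrite /pp /t0 /ee; ring.
rewrite epp eee; transitivity (- 4%:R * t0 T * (f (pt w T) (pt w T) q2)).
  by rewrite f_pt2; ring.
by rewrite e2 mulr0.
Qed.

(** Off the line q_0 q_2 the q_1-coordinate of s is nonzero, so s can be rescaled to the form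
    [pt w T]. *)
Let sol_complete s : f s s s = 0 -> f s s q0 = 0 -> br s q0 q2 != 0 ->
  exists T k, [/\ Q T = 0, k != 0 & s = k *: sol T].
Proof.
move=> fs fs0 ns; pose d := br q0 q1 q2; have nd' : d != 0 := nd.
pose y := br q0 s q2 / d.
have ny : y != 0 by rewrite /y mulf_neq0 ?invr_eq0 // br_sw oppr_eq0.
pose w := br s q1 q2 / d / y; pose T := br q0 q1 s / d / y.
have es : s = y *: pt w T.
  have := cramer q0 q1 q2 s; rewrite -/d => e; apply: (scalerI nd').
  rewrite e /pt !scalerDr !scalerA; congr (_ *: _ + _ *: _ + _ *: _).
  - by rewrite /w; field; rewrite nd' ny.
  - by rewrite /y mulr1 mulrC divfK.
  - by rewrite /T; field; rewrite nd' ny.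
have e0 : 2%:R * w * t0 T + pp T = 0.
  rewrite -f_pt0; apply: (mulfI ny); apply: (mulfI ny); rewrite !mulr0.
  by rewrite -[RHS]fs0 es !(triZ fT).
have e1 : w ^+ 2 * t0 T + w * pp T + ee T = 0.
  apply: (mulfI n3); rewrite -f_pt; do 3!apply: (mulfI ny); rewrite !mulr0.
  by rewrite -[RHS]fs es !(triZ fT).
have epp : pp T = - (2%:R * w * t0 T) by apply/eqP; rewrite -addr_eq0 addrC e0.
have QT : Q T = 0.
  rewrite QE.
  have -> : ee T = w ^+ 2 * t0 T.
    by rewrite -[LHS]addr0 -[X in _ + X]oppr0 -[X in _ - X]e1 epp; ring.
  by rewrite epp; ring.
exists T, y; split=> //; rewrite {1}es /sol; congr (_ *: pt _ _).
by rewrite epp; field; exact: t0_neq0.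
Qed.

Lemma fibre_points : exists s1 s2 s3 s4 : V,
  [/\ forall s, s \in [:: s1; s2; s3; s4] -> [/\ f s s s = 0, f s s q0 = 0,
        cross s q0 != 0 & exists x, f s s x != 0],
      [/\ cross s1 s2 != 0, cross s1 s3 != 0 & cross s1 s4 != 0],
      [/\ cross s2 s3 != 0, cross s2 s4 != 0 & cross s3 s4 != 0] &
      forall s, f s s s = 0 -> f s s q0 = 0 -> br s q0 q2 != 0 ->
        exists s' k, [/\ s' \in [:: s1; s2; s3; s4], k != 0 & s = k *: s']].
Proof.
(* The leading coefficient of the quartic: it is nonzero because the tangent at q_2 misses q_0. *)
have nD : D ^+ 2 != 0.
  by rewrite expf_neq0 // /D (tri_rot fT); apply: (fqq cf fC).
have [T1 [T2 [T3 [T4 [uT TP]]]]] := quartic_roots nD ndisc.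
exists (sol T1), (sol T2), (sol T3), (sol T4).
have ncr T T' : T != T' -> cross (sol T) (sol T') != 0.
  move=> nT; apply: (@br_neq0 _ _ _ q0); rewrite /sol /pt br_rot br_rot.
  rewrite !(brD, brZ) !br_alt !(mulr0, add0r, addr0, mul1r) [br q0 q2 q1]br_sw23.
  have -> : T' * br q0 q1 q2 + T * - br q0 q1 q2 = (T' - T) * br q0 q1 q2 by ring.
  by rewrite mulf_neq0 // subr_eq0 eq_sym.
move: uT; rewrite /= !inE !negb_or !andbT.
case/and3P=> /and3P[n12 n13 n14] /andP[n23 n24] n34.
split; [|by split; apply: ncr|by split; apply: ncr|].
  move=> s; rewrite !inE => /or4P[] /eqP ->; apply: solP; apply/TP;
    by rewrite !inE eqxx ?orbT.
move=> s fs fs0 ns; have [T [k [QT nk es]]] := sol_complete fs fs0 ns.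
exists (sol T), k; split=> //.
have : T \in [:: T1; T2; T3; T4] by apply/TP.
by rewrite !inE => /or4P[] /eqP ->; rewrite eqxx ?orbT.
Qed.

End Fibre.

(** * Preimages of a configuration *)

Section FibreConfig.
Variable K : numClosedFieldType.
Local Notation V := 'rV[K]_3.
Local Notation I := 'I_7.
Variables (q r : I -> V) (f : V -> V -> V -> K).
Hypotheses (cf : config q r) (fC : on_cubic f q r).
Let fT : trilinear f. Proof. by case: fC. Qed.
Let fq c : f (q c) (q c) (q c) = 0. Proof. by case: fC. Qed.

(** The cubic of (p, q) contains r by [cubic_iterate], hence is a nonzero multiple of [f] by
    [cubic_unique]. *)
Lemma config_on_cubic p : config p q ->
  f (p 0) (p 0) (q 0) = 0 /\ forall i, f (p i) (p i) (p i) = 0.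
Proof.
move=> cp; have [g gC] := cubic_exists cp.
have [gT gp gq gpq gn] := gC.
have [l hl] := cubic_unique cf fC gT gq (cubic_iterate cp cf gC).
have nl : l != 0.
  have [x] := gn 0; apply: contra_neq => l0; by rewrite hl l0 mul0r.
by split=> [|i]; apply: (mulfI nl); rewrite mulr0 -hl.
Qed.

(** The point p_(2a) is on the line p_0 q_a and on the cubic, and differs from p_0 and q_a. It is
    therefore the residual point, which [half_point] gives. *)
Lemma half_unique p s k : config p q -> p 0 = k *: s ->
  f s s s = 0 -> f s s (q 0) = 0 -> cross s (q 0) != 0 -> (exists x, f s s x != 0) ->
  forall i, exists2 t, t != 0 & p i = t *: half q f s i.
Proof.
move=> cp ep fs fs0 ns nsing i.
have [_ fp] := config_on_cubic cp.
have n3 : 3%:R != 0 :> K by rewrite pnatr_eq0.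
have [a <-] := half_exists i.
have nk : k != 0.
  have := nil_par cp (i := 0) (j := 1) isT.
  by apply: contra_neq => k0; rewrite ep k0 scale0r; apply: vecP; rewrite !mxE /=; ring.
case: (eqVneq a 0) => [->|na].
  by exists k; rewrite // addr0 half0.
have nii := f_s_q cf fC fs fs0 ns na.
have nc : cross (p 0) (q a) != 0.
  by rewrite ep crossZ scaler_eq0 negb_or nk (cross_s_q cf fC fs fs0 ns na).
have n2a := double_neq0 na.
have n02a : 0 != a + a by rewrite eq_sym.
have e0 : br (p 0) (q a) (p (a + a)) = 0.
  by rewrite br_sw23 (qqr0 cp) ?oppr0 // add0r.
have [x [y e2]] := span2 nc e0.
have ny : y != 0.
  apply: contra_neq (nil_par cp n02a) => y0.
  by rewrite e2 y0 scale0r addr0 crossZ crossuu scaler0.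
have nx : x != 0.
  have [c nac] : exists c, a != c by exists (a + 1); clear; caseI a; vm_compute.
  apply: contra_neq (qrr cp (a + a) nac) => x0.
  by rewrite e2 x0 scale0r add0r brZ br_alt mulr0.
have h : x * k * f s s (q a) + y * f s (q a) (q a) = 0.
  have := fp (a + a); rewrite e2 ep scalerA (tri_line fT) fs fq => h.
  apply: (mulfI n3); apply: (mulfI nx); apply: (mulfI ny); apply: (mulfI nk).
  by rewrite !mulr0 -h; ring.
exists (- (x * k / f s (q a) (q a))).
  by rewrite oppr_eq0 !mulf_neq0 ?invr_eq0.
have ey : y = - (x * k * f s s (q a)) / f s (q a) (q a).
  apply: (mulIf nii); rewrite divfK //; apply/eqP.
  by rewrite -addr_eq0 addrC; apply/eqP.
by rewrite half_double // /half_point e2 ep ey; apply: vecP; rewrite !mxE; field.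
Qed.

Lemma fibre_config : tangent_disc q f != 0 -> exists p1 p2 p3 p4 : I -> V,
  [/\ [/\ config p1 q, config p2 q, config p3 q & config p4 q],
      [/\ cross (p1 0) (p2 0) != 0, cross (p1 0) (p3 0) != 0
        & cross (p1 0) (p4 0) != 0],
      [/\ cross (p2 0) (p3 0) != 0, cross (p2 0) (p4 0) != 0
        & cross (p3 0) (p4 0) != 0] &
      forall p, config p q ->
        let same p' := forall i, exists2 t, t != 0 & p i = t *: p' i in
        [\/ same p1, same p2, same p3 | same p4]].
Proof.
move=> nd; have [s1 [s2 [s3 [s4 [hs n1 n2 hall]]]]] := fibre_points cf fC nd.
have q0 : o7 0 = 0 :> I by apply: val_inj.
rewrite q0 in hs hall.
exists (half q f s1), (half q f s2), (half q f s3), (half q f s4).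
have conf s : s \in [:: s1; s2; s3; s4] -> config (half q f s) q.
  by case/hs => h1 h2 h3 h4; apply: (half_config cf fC).
split; rewrite ?half0 //.
  by split; apply: conf; rewrite !inE eqxx ?orbT.
move=> p cp same; have [fp0 fp] := config_on_cubic cp.
(* The parametrization by T misses the line q_0 q_2, but p_0 is never on it. *)
have n02 : br (p 0) (q 0) (q (o7 2)) != 0 by apply: (qrr cp).
have [s [k [ins nk ep]]] := hall _ (fp 0) fp0 n02.
have [h1 h2 h3 h4] := hs _ ins.
have := half_unique cp ep h1 h2 h3 h4.
move: ins; rewrite !inE => /or4P[] /eqP -> h.
- by apply: Or41.
- by apply: Or42.
- by apply: Or43.
- by apply: Or44.
Qed.
End FibreConfig.

(** * Realizations of M_7 and the operator Lambda_{2,3} *)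

Section Realization.
Variable K : numFieldType.
Local Notation V := 'rV[K]_3.
Local Notation I := 'I_7.
Implicit Types L : label -> V.

Lemma incidE (a p : V) : incid a p = (dot a p == 0).
Proof. by rewrite /incid big3. Qed.

Lemma concurrentP (u v w : V) : concurrent u v w <-> br u v w = 0.
Proof.
rewrite br_eq0P; split=> -[n]; rewrite ?incidE => -[nz h1 h2 h3]; exists n.
  by split=> //; apply/eqP.
by split; rewrite ?incidE //; apply/eqP.
Qed.

Lemma proj_eq_cross (u v : V) : proj_eq u v -> cross u v = 0.
Proof. by case=> c [_ ->]; rewrite crossZ crossuu scaler0. Qed.

Lemma cross_proj_eq (u v : V) : u != 0 -> v != 0 -> cross u v = 0 -> proj_eq u v.
Proof.
move=> nu nv; rewrite crossC => /eqP; rewrite oppr_eq0 => /eqP /(cross_eq0 nv) [k ek].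
by exists k; split=> //; apply: contra_neq nu => k0; rewrite ek k0 scale0r.
Qed.

Lemma mod7E (a b c : I) : (a + b == 2 * c %[mod 7])%N = (a + b == c + c :> I).
Proof. by rewrite -val_eqE /= mul2n addnn. Qed.

Lemma nonbasis_inv (S : {set label}) : M7_nonbasis S -> exists a b c : I,
  [/\ a != b, a + b = c + c, forall i, (inl i \in S) = (i == a) || (i == b)
    & forall k, (inr k \in S) = (k == c)].
Proof.
move=> /existsP[a /existsP[b /existsP[c /and3P[nab e /eqP ->]]]].
exists a, b, c; split=> // [|i|k]; last 2 first.
- by rewrite !inE /= orbF.
- by rewrite !inE.
by apply/eqP; rewrite -mod7E.
Qed.

Lemma nonbasis_llr (i j k : I) : i != j ->
  M7_nonbasis [set inl i; inl j; inr k] = (i + j == k + k).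
Proof.
move=> nij; apply/idP/idP => [/nonbasis_inv [a [b [c [nab e hl hr]]]]|e].
  have := hr k; rewrite !inE eqxx /= => /esym/eqP ->.
  have := hl i; rewrite !inE eqxx /= => /esym.
  have := hl j; rewrite !inE eqxx orbT /= => /esym.
  case/orP=> /eqP ej; case/orP=> /eqP ei; move: nij; rewrite ei ej ?eqxx // -e //.
  by rewrite addrC.
apply/existsP; exists i; apply/existsP; exists j; apply/existsP; exists k.
by rewrite nij mod7E e eqxx.
Qed.

Lemma nonbasis_lll (i j k : I) : ~~ M7_nonbasis [set inl i; inl j; inl k].
Proof.
apply/negP => /nonbasis_inv [a [b [c [nab e hl hr]]]].
by have := hr c; rewrite !inE eqxx.
Qed.

Lemma nonbasis_lrr (i j k : I) : ~~ M7_nonbasis [set inl i; inr j; inr k].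
Proof.
apply/negP => /nonbasis_inv [a [b [c [nab e hl hr]]]].
have := hl a; have := hl b; rewrite !inE !eqxx orbT /= !orbF => /eqP eb /eqP ea.
by case: eb nab ea => -> /eqP nab []. 
Qed.

Lemma nonbasis_rrr (i j k : I) : ~~ M7_nonbasis [set inr i; inr j; inr k].
Proof.
apply/negP => /nonbasis_inv [a [b [c [nab e hl hr]]]].
by have := hl a; rewrite !inE eqxx.
Qed.

Lemma config_cross L : config (L \o inl) (L \o inr) -> forall x y, x != y -> cross (L x) (L y) != 0.
Proof.
move=> cf.
have lr i k : cross (L (inl i)) (L (inr k)) != 0.
  have [j /andP[nij nk]] : exists j, (i != j) && (i + j != k + k).
    by exists (if i == k then i + 1 else if k + k - i == i + 1 then i + 2%:R else i + 1); clear; caseI i; caseI k; vm_compute.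
  by apply: (@br_neq0 _ _ _ (L (inl j))); rewrite br_sw23 oppr_eq0; apply: (qqr cf).
move=> [i|i] [j|j] nij.
- by apply: (nil_par cf); apply: contra nij => /eqP ->.
- exact: lr.
- by rewrite crossC oppr_eq0 lr.
apply: (@br_neq0 _ _ _ (L (inl 0))); rewrite -br_rot; apply: (qrr cf).
by apply: contra nij => /eqP ->.
Qed.

Definition join (q r : I -> V) (x : label) : V :=
  match x with inl i => q i | inr i => r i end.

(** Concurrency is the vanishing of [br], and a non-basis has exactly one primed label. Since [T] is
    stable under transpositions, triples with the unprimed labels in front suffice. *)
Lemma realizationP L : realization L <-> config (L \o inl) (L \o inr).
Proof.
split=> [[h1 h2 h3]|cf].
  split=> i j k /=.
  - move=> nij nik njk; apply/eqP => /concurrentP; rewrite h3 //.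
    by apply/negP/nonbasis_lll.
  - move=> nij; apply/eqP/idP => [/concurrentP|e].
      by rewrite h3 // nonbasis_llr.
    by apply/concurrentP; rewrite h3 // nonbasis_llr.
  - move=> njk; apply/eqP => /concurrentP; rewrite h3 //.
    by apply/negP/nonbasis_lrr.
  - move=> nij nik njk; apply/eqP => /concurrentP; rewrite h3 //.
    by apply/negP/nonbasis_rrr.
have ncr := config_cross cf.
have nz x : L x != 0.
  have [y nxy] : exists y, x != y by case: x => i; [exists (inr 0)|exists (inl 0)].
  apply: contra_neq (ncr _ _ nxy) => ->; apply: vecP; rewrite !mxE /=; ring.
split=> // [x y nxy /proj_eq_cross e|x y z nxy nyz nxz].
  by have := ncr _ _ nxy; rewrite e eqxx.
rewrite concurrentP.
pose T x y z := x != y -> y != z -> x != z ->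
  (br (L x) (L y) (L z) = 0 <-> M7_nonbasis [set x; y; z]).
have sw x' y' z' : T x' y' z' -> T y' x' z'.
  move=> h n1 n2 n3; have -> : [set y'; x'; z'] = [set x'; y'; z'].
    by apply/setP => t; rewrite !inE [(t == y') || _]orbC.
  have := h _ n3 n2; rewrite eq_sym n1 => /(_ isT) <-.
  by split=> e; rewrite br_sw e oppr0.
have sw23 x' y' z' : T x' y' z' -> T x' z' y'.
  move=> h n1 n2 n3; have -> : [set x'; z'; y'] = [set x'; y'; z'].
    by apply/setP => t; rewrite !inE orbAC.
  have := h n3 _ n1; rewrite eq_sym n2 => /(_ isT) <-.
  by split=> e; rewrite br_sw23 e oppr0.
suff: T x y z by apply.
have lll i j k : T (inl i) (inl j) (inl k).
  move=> n1 n2 n3; split=> [e|]; last by rewrite (negPf (nonbasis_lll _ _ _)).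
  by have := qqq cf n1 n3 n2; rewrite /= e eqxx.
have llr i j k : T (inl i) (inl j) (inr k).
  move=> n1 n2 n3; rewrite nonbasis_llr //; case: cf => _ h _ _.
  by rewrite -h //; split=> /eqP.
have lrr i j k : T (inl i) (inr j) (inr k).
  move=> n1 n2 n3; split=> [e|]; last by rewrite (negPf (nonbasis_lrr _ _ _)).
  by have := qrr cf i n2; rewrite /= e eqxx.
have rrr i j k : T (inr i) (inr j) (inr k).
  move=> n1 n2 n3; split=> [e|]; last by rewrite (negPf (nonbasis_rrr _ _ _)).
  by case: cf => _ _ _ /(_ i j k n1 n3 n2); rewrite /= e eqxx.
case: x y z {nxy nyz nxz} => i [] j [] k.
- exact: lll.
- exact: llr.
- exact/sw23/llr.
- exact: lrr.
- exact/sw/sw23/llr.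
- exact/sw/lrr.
- exact/sw23/sw/lrr.
- exact: rrr.
Qed.
End Realization.

(** * Lines with exactly three double points *)

Section Lambda.
Variable K : numFieldType.
Local Notation V := 'rV[K]_3.
Local Notation I := 'I_7.
Variables (q r : I -> V) (L : label -> V).
Hypothesis cf : config q r.
Hypothesis Lq : forall k, L (inr k) = q k.

(** Here [cross (q a) (q b)] is the meet of two of the six lines other than l'_j. Among the 15 ways
    to pair off the six, only the pairing a + b = 2 j may have collinear meets. *)
Definition no_other_line : Prop := forall j a b c d e f : I,
  uniq [:: j; a; b; c; d; e; f] ->
  ~~ [&& a + b == j + j, c + d == j + j & e + f == j + j] ->
  br (cross (q a) (q b)) (cross (q c) (q d)) (cross (q e) (q f)) != 0.

Local Notation line j := [set inr k | k in [set~ j]].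

Lemma proj_eq_sym (u v : V) : proj_eq u v -> proj_eq v u.
Proof.
move=> [c [nc ->]]; exists c^-1; rewrite invr_eq0; split=> //.
by rewrite scalerA mulVf // scale1r.
Qed.
Lemma proj_eq_trans (u v w : V) : proj_eq u v -> proj_eq v w -> proj_eq u w.
Proof.
move=> [c [nc ->]] [d [nd ->]]; exists (c * d); rewrite mulf_neq0 //.
by rewrite scalerA.
Qed.

Lemma dot_cross (u v w : V) : dot w (cross u v) = br u v w.
Proof. by rewrite br_dot dotC. Qed.

Lemma cross_cross (u v w : V) : dot w u = 0 -> dot w v = 0 -> cross w (cross u v) = 0.
Proof.
move=> eu ev; transitivity (dot w v *: u - dot w u *: v).
  by apply: vecP; rewrite !mxE /= ?mxE /dot; ring.
by rewrite eu ev !scale0r subrr.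
Qed.

(** No three of the lines q_k are concurrent, so the meet of two of them is on no third one. *)
Lemma double_pointP j p : double_point (line j) L p <-> exists a b,
  [/\ a != b, a != j, b != j & proj_eq p (cross (q a) (q b))].
Proof.
pose S := [set k | (k != j) && (dot (q k) p == 0)].
have eS : [set i in line j | incid (L i) p] = [set inr k | k in S].
  apply/setP => -[k|k]; rewrite !inE.
    by apply/andP/imsetP => [[/imsetP[x _ //]]|[x _ //]].
  rewrite incidE Lq; apply/andP/imsetP => [[/imsetP[x]]|[x]]; rewrite !inE.
    by move=> nx [->] e; exists x; rewrite // inE nx.
  by case/andP=> nx e [->]; split=> //; apply/imsetP; exists x; rewrite // !inE.
have cS : #|[set i in line j | incid (L i) p]| = #|S|.
  by rewrite eS card_imset // => x y [].
rewrite /double_point cS; split=> [/andP[np /cards2P[a [b [nab eS2]]]]|].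
  have : a \in S by rewrite eS2 !inE eqxx.
  have : b \in S by rewrite eS2 !inE eqxx orbT.
  rewrite !inE => /andP[nb /eqP eb] /andP[na /eqP ea].
  exists a, b; split=> //; apply: cross_proj_eq => //; first exact: (nil_par cf).
  by apply: cross_cross; rewrite dotC.
move=> [a [b [nab na nb [c [nc ep]]]]].
have nx := nil_par cf nab.
have np : p != 0 by rewrite ep scaler_eq0 negb_or nc.
rewrite np /=; apply/cards2P; exists a, b; split=> //.
have dE k : dot (q k) p = c * br (q a) (q b) (q k).
  by rewrite ep -dot_cross /dot !mxE; ring.
apply/setP => k; rewrite !inE dE mulf_eq0 (negPf nc) /=.
case: (eqVneq k a) => [->|nka]; first by rewrite na br_alt eqxx.
case: (eqVneq k b) => [->|nkb]; first by rewrite nb br_alt eqxx.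
by rewrite (negPf (qqq cf nab _ _)) ?andbF // eq_sym.
Qed.

Lemma cross_inj a b c d : a != b -> c != a -> c != b ->
  ~ proj_eq (cross (q a) (q b)) (cross (q c) (q d)).
Proof.
move=> nab nca ncb [t [nt e]].
have : dot (q c) (cross (q a) (q b)) = 0.
  rewrite e; transitivity (t * dot (q c) (cross (q c) (q d))).
    by rewrite /dot !mxE; ring.
  by rewrite dot_cross br_alt mulr0.
by rewrite dot_cross; apply/eqP; apply: (qqq cf); rewrite // eq_sym.
Qed.

Lemma double_point_cross j a b : a != b -> a != j -> b != j ->
  double_point (line j) L (cross (q a) (q b)).
Proof.
move=> nab na nb; apply/double_pointP; exists a, b; split=> //.
by exists 1; rewrite oner_neq0 scale1r.
Qed.

Lemma incid_proj_eq (m p p' : V) : proj_eq p p' -> incid m p = incid m p'.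
Proof.
move=> [c [nc ->]]; rewrite !incidE.
have -> : dot m (c *: p') = c * dot m p' by rewrite /dot !mxE; ring.
by rewrite mulf_eq0 (negPf nc).
Qed.

(** The line r_j carries the meets of q_(j+k) and q_(j-k) for k = 1, 2, 3. On any other candidate,
    no two of the three double points share a line ([share], [disj]), so the six lines are paired
    off and [no_other_line] leaves only the pairing of r_j. *)
Lemma lambda23_line j : no_other_line -> Lambda23_is_line (line j) L (r j).
Proof.
move=> hm; split; first exact: (r_neq0 cf).
have neg k : k != 0 -> [/\ j + k != j - k, j + k != j & j - k != j].
  by move=> nk; split; move: nk; clear; caseI j; caseI k; vm_compute.
have on k : k != 0 -> incid (r j) (cross (q (j + k)) (q (j - k))).
  move=> nk; have [n1 _ _] := neg k nk; rewrite incidE dot_cross (qqr0 cf) //.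
  by rewrite addrACA subrr addr0.
split.
  have k1 : (o7 1 : I) != 0 by []. have k2 : (o7 2 : I) != 0 by [].
  have k3 : (o7 3 : I) != 0 by [].
  exists (cross (q (j + o7 1)) (q (j - o7 1))), (cross (q (j + o7 2)) (q (j - o7 2))),
    (cross (q (j + o7 3)) (q (j - o7 3))).
  split.
  - by have [? ? ?] := neg _ k1; rewrite double_point_cross // on.
  - by have [? ? ?] := neg _ k2; rewrite double_point_cross // on.
  - by have [? ? ?] := neg _ k3; rewrite double_point_cross // on.
  - by split; apply: cross_inj; move: j {neg on}; clear => j; caseI j; vm_compute.
  move=> x /double_pointP[a [b [nab na nb ex]]].
  rewrite incidE; move: (incid_proj_eq (r j) ex); rewrite !incidE => ->.
  rewrite dot_cross; case: (cf) => _ -> // _ _ /eqP eab.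
  have eb : b = j + j - a by rewrite -eab addrC addKr.
  have : [|| (a == j + o7 1) && (b == j - o7 1), (a == j + o7 2) && (b == j - o7 2),
             (a == j + o7 3) && (b == j - o7 3), (b == j + o7 1) && (a == j - o7 1),
             (b == j + o7 2) && (a == j - o7 2) | (b == j + o7 3) && (a == j - o7 3)].
    by rewrite eb; move: na; clear; caseI a; caseI j; vm_compute.
  have sw : proj_eq x (cross (q b) (q a)).
    apply: proj_eq_trans ex _; exists (-1); rewrite crossC scaleN1r.
    by split=> //; rewrite oppr_eq0 oner_eq0.
  case/or4P=> [/andP[/eqP ea /eqP eb']|/andP[/eqP ea /eqP eb']|/andP[/eqP ea /eqP eb']|].
  - by apply: Or31; rewrite -ea -eb'.
  - by apply: Or32; rewrite -ea -eb'.
  - by apply: Or33; rewrite -ea -eb'.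
  case/or3P=> /andP[/eqP eb' /eqP ea].
  - by apply: Or31; rewrite -ea -eb'.
  - by apply: Or32; rewrite -ea -eb'.
  - by apply: Or33; rewrite -ea -eb'.
move=> m nm [x1 [x2 [x3 [/andP[d1 m1] /andP[d2 m2] /andP[d3 m3] [n12 n13 n23] all]]]].
(* Two double points on a common line l'_a: then m = l'_a, which contains five. *)
have share x y z a b c : a != b -> a != c -> a != j -> b != j -> c != j ->
    proj_eq x (cross (q a) (q b)) -> proj_eq y (cross (q a) (q c)) ->
    ~ proj_eq x y -> incid m x -> incid m y ->
    (forall w, double_point (line j) L w -> incid m w ->
      [\/ proj_eq w x, proj_eq w y | proj_eq w z]) -> False.
  move=> nab nac na nb nc ex ey nxy mx my cov.
  have nbc : b != c.
    apply/eqP => ebc; apply: nxy; apply: proj_eq_trans ex _.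
    by rewrite ebc; apply: proj_eq_sym.
  have swap (c' d' : I) : proj_eq (cross (q c') (q d')) (cross (q d') (q c')).
    by exists (-1); rewrite crossC scaleN1r oppr_eq0 oner_eq0.
  have pencil (b' c' : I) : a != b' -> b' != c' -> a != c' ->
      ~ proj_eq (cross (q a) (q b')) (cross (q a) (q c')).
    move=> nab' nbc' nac' e.
    apply: (@cross_inj a b' c' a _ _ _ (proj_eq_trans e (swap a c'))) => //;
      by rewrite eq_sym.
  (* Two further indices d, e give two more distinct double points on l'_a, whereas only [z] is left
     for them. *)
  have : (1 < #|~: [set x in [:: a; b; c; j]]|)%N.
    rewrite -(ltn_add2l #|[set x in [:: a; b; c; j]]|) cardsC card_ord cardsE.
    by apply: leq_trans (_ : 4 + 1 < 7)%N => //; rewrite ltnS leq_add2r card_size.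
  case/card_gt1P => d [e []]; rewrite !inE !negb_or.
  case/and4P=> nda ndb ndc ndj /and4P[nea neb nec nej] nde.
  have cxy : cross x y != 0.
    apply/eqP => e0; apply: nxy; apply: cross_proj_eq e0.
      by case: ex => t [nt ->]; rewrite scaler_eq0 negb_or nt (nil_par cf).
    by case: ey => t [nt ->]; rewrite scaler_eq0 negb_or nt (nil_par cf).
  have perp (w : V) u' v : incid w u' -> incid w v -> cross w (cross u' v) = 0.
    by rewrite !incidE => /eqP h1 /eqP h2; apply: cross_cross.
  have qx (b' : I) w : proj_eq w (cross (q a) (q b')) -> incid (q a) w.
    by move=> /(incid_proj_eq (q a)) ->; rewrite incidE dot_cross br_alt.
  have ma : cross m (q a) = 0.
    apply: (cross_trans cxy); first exact: perp.
    by rewrite crossC (perp (q a) x y (qx b x ex) (qx c y ey)) oppr0.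
  have on_m (b' : I) : incid m (cross (q a) (q b')).
    by rewrite incidE dot_cross br_rot br_rot br_cross0.
  have third (d' : I) : d' != a -> d' != b -> d' != c -> d' != j ->
      proj_eq (cross (q a) (q d')) z.
    move=> h1 h2 h3 h4; have h1' : a != d' by rewrite eq_sym.
    have := cov _ (double_point_cross h1' na h4) (on_m d').
    case=> [h|h|//].
      by case: (pencil d' b h1' h2 nab); apply: proj_eq_trans h _.
    by case: (pencil d' c h1' h3 nac); apply: proj_eq_trans h _.
  apply: (pencil d e); rewrite // 1?eq_sym //.
  apply: proj_eq_trans (third d nda ndb ndc ndj) _.
  exact: proj_eq_sym (third e nea neb nec nej).
have [a1 [b1 [nab1 na1 nb1 e1]]] := (double_pointP _ _).1 d1.
have [a2 [b2 [nab2 na2 nb2 e2]]] := (double_pointP _ _).1 d2.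
have [a3 [b3 [nab3 na3 nb3 e3]]] := (double_pointP _ _).1 d3.
have disj x y z a b c d : a != b -> a != j -> b != j -> c != d -> c != j -> d != j ->
    proj_eq x (cross (q a) (q b)) -> proj_eq y (cross (q c) (q d)) ->
    ~ proj_eq x y -> incid m x -> incid m y ->
    (forall w, double_point (line j) L w -> incid m w ->
      [\/ proj_eq w x, proj_eq w y | proj_eq w z]) ->
    [&& a != c, a != d, b != c & b != d].
  move=> nab na nb ncd nc nd ex ey nxy mx my cov.
  have sw (c' d' : I) w : proj_eq w (cross (q c') (q d')) -> proj_eq w (cross (q d') (q c')).
    move=> h; apply: proj_eq_trans h _.
    by exists (-1); rewrite crossC scaleN1r oppr_eq0 oner_eq0.
  have nba : b != a by rewrite eq_sym.
  have ndc : d != c by rewrite eq_sym.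
  apply/and4P; split; apply/eqP => eac; subst.
  - exact: (share x y z c b d).
  - by apply: (share x y z d b c) => //; apply: sw.
  - by apply: (share x y z c a d) => //; apply: sw.
  - by apply: (share x y z d a c) => //; apply: sw.
have h12 := disj x1 x2 x3 a1 b1 a2 b2 nab1 na1 nb1 nab2 na2 nb2 e1 e2 n12 m1 m2 all.
have h13 : [&& a1 != a3, a1 != b3, b1 != a3 & b1 != b3].
  apply: (disj x1 x3 x2) => // w dw mw.
  by case: (all w dw mw) => h; [apply: Or31|apply: Or33|apply: Or32].
have h23 : [&& a2 != a3, a2 != b3, b2 != a3 & b2 != b3].
  apply: (disj x2 x3 x1) => // w dw mw.
  by case: (all w dw mw) => [h|h|h]; [apply: Or33|apply: Or31|apply: Or32].
have uniq7 : uniq [:: j; a1; b1; a2; b2; a3; b3].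
  case/and4P: h12 => ? ? ? ?; case/and4P: h13 => ? ? ? ?; case/and4P: h23 => ? ? ? ?.
  by rewrite /= !inE !negb_or !andbT; do ?[apply/andP; split=> //]; rewrite // eq_sym.
have br0 : br (cross (q a1) (q b1)) (cross (q a2) (q b2)) (cross (q a3) (q b3)) = 0.
  apply/br_eq0P; exists m; split=> //; apply/eqP; rewrite dotC -incidE.
  - by rewrite -(incid_proj_eq m e1).
  - by rewrite -(incid_proj_eq m e2).
  - by rewrite -(incid_proj_eq m e3).
case: (boolP [&& a1 + b1 == j + j, a2 + b2 == j + j & a3 + b3 == j + j]); last first.
  by move/(hm _ _ _ _ _ _ _ uniq7); rewrite br0 eqxx.
(* Now m and r_j both pass through the same two distinct meets. *)
case/and3P=> /eqP s1 /eqP s2 _.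
apply: cross_proj_eq => //; first exact: (r_neq0 cf).
have c12 : cross (cross (q a1) (q b1)) (cross (q a2) (q b2)) != 0.
  apply/eqP => c0; apply: n12; apply: proj_eq_trans e1 _.
  apply: proj_eq_trans (proj_eq_sym e2).
  by apply: cross_proj_eq c0; apply: (nil_par cf).
apply: (cross_trans c12).
  apply: cross_cross; apply/eqP; rewrite -incidE.
    by rewrite -(incid_proj_eq m e1).
  by rewrite -(incid_proj_eq m e2).
rewrite crossC cross_cross ?oppr0 // dot_cross; exact: (qqr0 cf).
Qed.
End Lambda.

(** * The genericity condition *)

(** [tangent_disc] of the normal form, written out over any commutative ring so that it is visibly
    polynomial and can be computed on binary integers. *)
Definition nf_disc (K : comNzRingType) (X Y Z a b c : K) : K :=
  let A := 2%:R * (Z - Y) in let B := 2%:R * (X - Z) in let C := 2%:R * (Z - b) in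
  let D := 2%:R * (X - c) in let E := 2%:R * c in let G := 2%:R * (X - a - c) in
  let H := X - a + b + c - Y - Z in
  disc4 (D ^+ 2) (4%:R * H * D - 4%:R * B * G)
    (2%:R * C * D + 4%:R * H ^+ 2 - 4%:R * A * G - 4%:R * B * E)
    (4%:R * C * H - 4%:R * A * E) (C ^+ 2).

Section PolyFun.
Variable K : numFieldType.
Local Notation V := 'rV[K]_3.
Local Notation I := 'I_7.
Implicit Types F G : (label -> V) -> K.

Definition poly_fun F : Prop :=
  exists g : mpoly.mpoly nvars K, forall N, mpoly.meval (coords N) g = F N.

Lemma poly_fun_cst (c : K) : poly_fun (fun=> c).
Proof. by exists (mpoly.mpolyC nvars c) => N; rewrite mpoly.mevalC. Qed.
Lemma poly_funD F G : poly_fun F -> poly_fun G -> poly_fun (fun N => F N + G N).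
Proof. by move=> [p hp] [q hq]; exists (p + q) => N; rewrite mpoly.mevalD hp hq. Qed.
Lemma poly_funN F : poly_fun F -> poly_fun (fun N => - F N).
Proof. by move=> [p hp]; exists (- p) => N; rewrite mpoly.mevalN hp. Qed.
Lemma poly_funM F G : poly_fun F -> poly_fun G -> poly_fun (fun N => F N * G N).
Proof. by move=> [p hp] [q hq]; exists (p * q) => N; rewrite mpoly.mevalM hp hq. Qed.
Lemma poly_funX F n : poly_fun F -> poly_fun (fun N => F N ^+ n).
Proof.
move=> hF; elim: n => [|n IHn]; first exact: poly_fun_cst 1.
have [p hp] := poly_funM hF IHn.
by exists p => N; rewrite hp exprS.
Qed.
Lemma poly_fun_coord x i : poly_fun (fun N => N x 0 i).
Proof.
exists (mpoly.mpolyX K (mpoly.mnm1 (enum_rank (x, i)))) => N.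
by rewrite mpoly.mevalXU /coords enum_rankK.
Qed.
Lemma poly_fun_prod (T : finType) (P : pred T) (F : T -> (label -> V) -> K) :
  (forall t, poly_fun (F t)) -> poly_fun (fun N => \prod_(t | P t) F t N).
Proof.
move=> /fin_all_exists [g hg]; exists (\prod_(t | P t) g t) => N.
by rewrite rmorph_prod; apply: eq_bigr => t _; exact: hg.
Qed.

Definition poly_vec (u : (label -> V) -> V) : Prop :=
  forall i, poly_fun (fun N => u N 0 i).

Ltac pf := repeat first [ exact: poly_fun_cst | apply: poly_funD | apply: poly_funN
  | apply: poly_funM | apply: poly_funX ].

Lemma poly_br u v w : poly_vec u -> poly_vec v -> poly_vec w ->
  poly_fun (fun N => br (u N) (v N) (w N)).
Proof. by move=> hu hv hw; rewrite /br; pf; first [apply: hu|apply: hv|apply: hw]. Qed.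

Lemma poly_vecE F G H : poly_fun F -> poly_fun G -> poly_fun H ->
  poly_vec (fun N => vec (F N) (G N) (H N)).
Proof.
move=> hF hG hH i.
case: i => [[|[|[|//]]] hi]; [move: hF|move: hG|move: hH] => -[g hg]; exists g => N;
  by rewrite hg mxE.
Qed.

Lemma poly_cross u v : poly_vec u -> poly_vec v -> poly_vec (fun N => cross (u N) (v N)).
Proof.
by move=> hu hv; apply: poly_vecE; pf; first [apply: hu|apply: hv].
Qed.

Lemma poly_nf (F := fun (h : (I -> V) -> K) N => h (N \o inl)) :
  [/\ poly_fun (F (@nfX K)), poly_fun (F (@nfY K)) & poly_fun (F (@nfZ K))] /\
  [/\ poly_fun (F (@nfa K)), poly_fun (F (@nfb K)) & poly_fun (F (@nfc K))].
Proof.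
by split; split; rewrite /F /nfX /nfY /nfZ /nfa /nfb /nfc /=; pf;
  apply: poly_fun_coord.
Qed.

Definition nfq (h : K -> K -> K -> K -> K -> K -> V) (N : label -> V) : V :=
  let q := N \o inl in h (nfX q) (nfY q) (nfZ q) (nfa q) (nfb q) (nfc q).

Lemma poly_nfq i : poly_vec (nfq (fun X Y Z a b c => nq X Y Z a b c i)).
Proof.
have [[hX hY hZ] [ha hb hc]] := poly_nf.
have p0 := poly_fun_cst 0; have p1 := poly_fun_cst 1.
by rewrite /nfq; case: i => [[|[|[|[|[|[|[|//]]]]]]] hi]; rewrite /nq /=; apply: poly_vecE.
Qed.

Definition other_lines (q : I -> V) : K :=
  \prod_(t : 7.-tuple I | uniq t &&
      ~~ [&& tnth t (o7 1) + tnth t (o7 2) == tnth t 0 + tnth t 0,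
             tnth t (o7 3) + tnth t (o7 4) == tnth t 0 + tnth t 0 &
             tnth t (o7 5) + tnth t (o7 6) == tnth t 0 + tnth t 0])
   br (cross (q (tnth t (o7 1))) (q (tnth t (o7 2))))
      (cross (q (tnth t (o7 3))) (q (tnth t (o7 4))))
      (cross (q (tnth t (o7 5))) (q (tnth t (o7 6)))).

Lemma other_linesP q : other_lines q != 0 <-> no_other_line q.
Proof.
split=> [/prodf_neq0 h|h].
  move=> j a b c d e f u ns.
  by have := h [tuple j; a; b; c; d; e; f]; rewrite u ns !(tnth_nth 0) /=; apply.
apply/prodf_neq0 => t /andP[u ns].
have et : [:: tnth t 0; tnth t (o7 1); tnth t (o7 2); tnth t (o7 3); tnth t (o7 4);
    tnth t (o7 5); tnth t (o7 6)] = t.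
  case: t {u ns} => -[|x0 [|x1 [|x2 [|x3 [|x4 [|x5 [|x6 [|//]]]]]]]] //= i; rewrite !(tnth_nth x0).
by apply: (h (tnth t 0)) ns; rewrite et.
Qed.

(* A function of a realization that vanishes exactly where the construction
   of the fibre breaks down. *)
Definition genericity (N : label -> V) : K :=
  let q := N \o inl in
  let X := nfX q in let Y := nfY q in let Z := nfZ q in
  let a := nfa q in let b := nfb q in let c := nfc q in
  tangent_disc (nq X Y Z a b c) (nphi X Y Z a b c) * other_lines (nq X Y Z a b c).

Lemma tangent_disc_nphi (X Y Z a b c : K) :
  tangent_disc (nq X Y Z a b c) (nphi X Y Z a b c) = nf_disc X Y Z a b c.
Proof.
rewrite /tangent_disc /nq /=.
set f := nphi X Y Z a b c.
set e := vec 1 1 1; set e1 := vec 1 0 0; set e2 := vec 0 1 0.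
have -> : f e e e1 = 2%:R * (Z - Y) by rewrite /f /nphi !vecE; ring.
have -> : f e e e2 = 2%:R * (X - Z) by rewrite /f /nphi !vecE; ring.
have -> : f e e1 e1 = 2%:R * (Z - b) by rewrite /f /nphi !vecE; ring.
have -> : f e e2 e2 = 2%:R * (X - c) by rewrite /f /nphi !vecE; ring.
have -> : f e1 e1 e2 = 2%:R * c by rewrite /f /nphi !vecE; ring.
have -> : f e1 e2 e2 = 2%:R * (X - a - c) by rewrite /f /nphi !vecE; ring.
have -> // : f e e1 e2 = X - a + b + c - Y - Z by rewrite /f /nphi !vecE; ring.
Qed.

Lemma poly_genericity : poly_fun genericity.
Proof.
have [[hX hY hZ] [ha hb hc]] := poly_nf.
apply: poly_funM.
  have [g hg] : poly_fun (fun N => let q := N \o inl in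
      tangent_disc (nq (nfX q) (nfY q) (nfZ q) (nfa q) (nfb q) (nfc q))
        (nphi (nfX q) (nfY q) (nfZ q) (nfa q) (nfb q) (nfc q))); last by exists g.
  have [g hg] : poly_fun (fun N => let q := N \o inl in
      nf_disc (nfX q) (nfY q) (nfZ q) (nfa q) (nfb q) (nfc q)).
    rewrite /nf_disc /disc4 /=; set n2 := 2%:R; set n3 := 3%:R; set n4 := 4%:R.
    by repeat first [exact: hX|exact: hY|exact: hZ|exact: ha|exact: hb|exact: hc
      |exact: poly_fun_cst|apply: poly_funX|apply: poly_funD|apply: poly_funN|apply: poly_funM].
  by exists g => N; rewrite hg; apply/esym; apply: tangent_disc_nphi.
apply: poly_fun_prod => t.
by apply: poly_br; apply: poly_cross; apply: poly_nfq.
Qed.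
End PolyFun.

(** * A generic realization *)

Section Rmorph.
Variables (R S : comNzRingType) (h : {rmorphism R -> S}).

Lemma rmorph_disc4 a b c d e :
  h (disc4 a b c d e) = disc4 (h a) (h b) (h c) (h d) (h e).
Proof.
rewrite /disc4 rmorphB rmorphM !rmorphXn rmorph_nat; congr (_ * _ ^+ 3 - _ ^+ 2);
  by rewrite !(rmorphB, rmorphD) !rmorphM !rmorph_nat.
Qed.

Lemma rmorph_nf_disc X Y Z a b c :
  h (nf_disc X Y Z a b c) = nf_disc (h X) (h Y) (h Z) (h a) (h b) (h c).
Proof.
rewrite /nf_disc rmorph_disc4.
by congr disc4; rewrite !(rmorph_nat, rmorphM, rmorphB, rmorphD).
Qed.
End Rmorph.

Section Sample.

(* Triples of binary integers, on which the conditions on a realization with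
   integer coordinates are checked by vm_compute. *)
Definition triple : Type := BinNums.Z * BinNums.Z * BinNums.Z.

Definition tcross (u v : triple) : triple :=
  let: (u0, u1, u2) := u in let: (v0, v1, v2) := v in
  (u1 * v2 - u2 * v1, u2 * v0 - u0 * v2, u0 * v1 - u1 * v0).

Definition tbr (u v w : triple) : BinNums.Z :=
  let: (u0, u1, u2) := u in let: (v0, v1, v2) := v in let: (w0, w1, w2) := w in
  u0 * (v1 * w2 - v2 * w1) - u1 * (v0 * w2 - v2 * w0) + u2 * (v0 * w1 - v1 * w0).

Section Params.
Variables X Y Z a b c : BinNums.Z.

Definition tq (i : nat) : triple :=
  match i with
  | 0 => (1, 1, 1) | 1 => (1, 0, 0) | 2 => (0, 1, 0) | 3 => (X, Y, c)
  | 4 => (0, 0, 1) | 5 => (X, b, Z) | _ => (a, Y, Z) end.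

Definition tr (i : nat) : triple :=
  match i with
  | 0 => (X, Y, Z) | 1 => (X, b, X) | 2 => (Y, Y, c) | 3 => (0, b, Z)
  | 4 => (a, Z, Z) | 5 => (a, Y, 0) | _ => (X, 0, c) end.

Definition config_check : bool :=
  let s := iota 0 7 in
  all (fun i => all (fun j => all (fun k =>
    [&& [|| i == j, i == k, j == k | tbr (tq i) (tq j) (tq k) != 0],
        (i == j) || ((tbr (tq i) (tq j) (tr k) == 0) == (modn (i + j)%N 7 == modn (k + k)%N 7)),
        (j == k) || (tbr (tq i) (tr j) (tr k) != 0) &
        [|| i == j, i == k, j == k | tbr (tr i) (tr j) (tr k) != 0]]) s) s) s.

Definition other_check : bool :=
  all (fun s => if s is [:: j; a; b; c; d; e; f] then
      let m := modn (j + j)%N 7 in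
      [|| [&& modn (a + b)%N 7 == m, modn (c + d)%N 7 == m & modn (e + f)%N 7 == m] |
       tbr (tcross (tq a) (tq b)) (tcross (tq c) (tq d)) (tcross (tq e) (tq f)) != 0]
    else true) (permutations (iota 0 7)).
End Params.

Variable K : numFieldType.
Local Notation V := 'rV[K]_3.
Local Notation I := 'I_7.

Let zr (z : BinNums.Z) : K := (int_of_Z z)%:~R.

Let zrD x y : zr (x + y) = zr x + zr y. Proof. by rewrite /zr !rmorphD. Qed.
Let zrM x y : zr (x * y) = zr x * zr y. Proof. by rewrite /zr !rmorphM. Qed.
Let zrN x : zr (- x) = - zr x. Proof. by rewrite /zr !rmorphN. Qed.
Let zr0 : zr 0 = 0. Proof. by rewrite /zr !rmorph0. Qed.
Let zr1 : zr 1 = 1. Proof. by rewrite /zr !rmorph1. Qed.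
Let zr_eq0 x : (zr x == 0) = (x == 0).
Proof. by rewrite /zr intr_eq0 -(inj_eq (can_inj int_of_ZK)) rmorph0. Qed.

Let tvec (u : triple) : V := let: (x, y, z) := u in vec (zr x) (zr y) (zr z).

Let tbrE u v w : br (tvec u) (tvec v) (tvec w) = zr (tbr u v w).
Proof.
case: u v w => [[? ?] ?] [[? ?] ?] [[? ?] ?]; rewrite /br /tbr /= !vecE.
by rewrite !(zrD, zrN, zrM).
Qed.

Let tcrossE u v : cross (tvec u) (tvec v) = tvec (tcross u v).
Proof.
case: u v => [[? ?] ?] [[? ?] ?]; rewrite /cross /tcross /= !vecE.
by rewrite !(zrD, zrN, zrM).
Qed.

Section Transfer.
Variables X Y Z a b c : BinNums.Z.
Let nq' := nq (zr X) (zr Y) (zr Z) (zr a) (zr b) (zr c).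
Let nr' := nr (zr X) (zr Y) (zr Z) (zr a) (zr b) (zr c).

Let nqE i : nq' i = tvec (tq X Y Z a b c i).
Proof. by case: i => [[|[|[|[|[|[|[|//]]]]]]] i]; rewrite /nq' /nq /= ?zr0 ?zr1. Qed.
Let nrE i : nr' i = tvec (tr X Y Z a b c i).
Proof. by case: i => [[|[|[|[|[|[|[|//]]]]]]] i]; rewrite /nr' /nr /= ?zr0 ?zr1. Qed.

Let mem7 (i : I) : val i \in iota 0 7. Proof. by rewrite mem_iota /=. Qed.

Lemma config_checkP : config_check X Y Z a b c -> config nq' nr'.
Proof.
move=> hc.
have h (i j k : I) := allP (allP (allP hc i (mem7 i)) j (mem7 j)) k (mem7 k).
split=> i j k; rewrite ?nqE ?nrE tbrE ?zr_eq0.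
- move=> nij nik njk; have /and4P[+ _ _ _] := h i j k.
  by rewrite !val_eqE (negPf nij) (negPf nik) (negPf njk).
- move=> nij; have /and4P[_ + _ _] := h i j k.
  by rewrite val_eqE (negPf nij) /= -(val_eqE (i + j)) => /eqP.
- move=> njk; have /and4P[_ _ + _] := h i j k.
  by rewrite val_eqE (negPf njk).
- move=> nij nik njk; have /and4P[_ _ _ +] := h i j k.
  by rewrite !val_eqE (negPf nij) (negPf nik) (negPf njk).
Qed.

Lemma other_checkP : other_check X Y Z a b c -> no_other_line nq'.
Proof.
move=> hc j a' b' c' d e f u ns.
rewrite !nqE !tcrossE tbrE zr_eq0.
have h : [seq val i | i <- [:: j; a'; b'; c'; d; e; f]] \in permutations (iota 0 7).
  rewrite mem_permutations uniq_perm ?iota_uniq ?(map_inj_uniq val_inj) //.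
  apply: (uniq_min_size _ _ _).2; rewrite ?(map_inj_uniq val_inj) //.
  by move=> x /mapP[i _ ->].
have /orP[] // := allP hc _ h.
move: ns; rewrite -(val_eqE (a' + b')) -(val_eqE (c' + d)) -(val_eqE (e + f)).
by move=> /negP ns /ns.
Qed.
End Transfer.

Let zr_disc X Y Z a b c :
  zr (nf_disc X Y Z a b c) = nf_disc (zr X) (zr Y) (zr Z) (zr a) (zr b) (zr c).
Proof. by rewrite /zr !rmorph_nf_disc. Qed.

(** Because denominators were cleared, normalizing a normal form rescales its parameters by a common
    factor. This is why [good_realization] tests the rescaled values. *)
Lemma nf_nq (X Y Z a b c : K) (q := nq X Y Z a b c) (m := Y * Z) :
  [/\ nfX q = m * X, nfY q = m * Y & nfZ q = m * Z] /\
  [/\ nfa q = m * a, nfb q = m * b & nfc q = m * c].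
Proof.
by split; split; rewrite /nfX /nfY /nfZ /nfa /nfb /nfc /q /m /nq /= /br !vecE; ring.
Qed.

Lemma good_realization (X Y Z a b c : BinNums.Z) (m := Y * Z) :
  config_check X Y Z a b c ->
  nf_disc (m * X) (m * Y) (m * Z) (m * a) (m * b) (m * c) != 0 ->
  other_check (m * X) (m * Y) (m * Z) (m * a) (m * b) (m * c) ->
  exists N0 : label -> V, realization N0 /\ genericity N0 != 0.
Proof.
move=> h1 h2 h3.
pose q := nq (zr X) (zr Y) (zr Z) (zr a) (zr b) (zr c).
pose r := nr (zr X) (zr Y) (zr Z) (zr a) (zr b) (zr c).
exists (join q r); split.
  by apply/realizationP; apply: config_checkP.
have [[eX eY eZ] [ea eb ec]] := nf_nq (zr X) (zr Y) (zr Z) (zr a) (zr b) (zr c).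
rewrite /genericity (_ : join q r \o inl = q) //.
rewrite eX eY eZ ea eb ec -!zrM tangent_disc_nphi -zr_disc mulf_neq0 ?zr_eq0 //.
by apply/other_linesP/other_checkP.
Qed.

Lemma exists_good_realization :
  exists N0 : label -> V, realization N0 /\ genericity N0 != 0.
Proof.
(* An integral solution of the three equations [nrel]. *)
apply: (good_realization (X := 180) (Y := 252) (Z := - 396) (a := - 315)
  (b := 2772) (c := 220)); by vm_compute.
Qed.
End Sample.

(** * The fibre *)

Section Frame.
Variable K : numFieldType.
Local Notation V := 'rV[K]_3.
Local Notation I := 'I_7.

Lemma simP M (q' q : I -> V) : sim M q' q <-> forall i, proj_eq (q' i *m M) (q i).
Proof.
by split=> h i; have [t] := h i; [move=> nt e; exists t|case=> nt e; exists t].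
Qed.

(** Fixing q_1, q_2, q_4 makes [g] diagonal, and fixing q_0 = (1, 1, 1) makes the diagonal entries
    equal. *)
Lemma frame_scalar (X Y Z a b c : K) (g : 'M[K]_3) :
  sim g (nq X Y Z a b c) (nq X Y Z a b c) -> exists t, forall v : V, v *m g = t *: v.
Proof.
move=> s.
have [t0 _ e0] := s (o7 0); have [t1 _ e1] := s (o7 1).
have [t2 _ e2] := s (o7 2); have [t4 _ e4] := s (o7 4).
rewrite /nq /= !mulmx_vec !vecE !(scale0r, scale1r, addr0, add0r) in e0 e1 e2 e4.
exists t0 => v; rewrite mulmx_vec.
move: e0; rewrite e1 e2 e4 => e0.
have := congr1 (fun w : V => w 0 c0) e0; have := congr1 (fun w : V => w 0 c1) e0.
have := congr1 (fun w : V => w 0 c2) e0.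
rewrite !mxE /= !(mulr0, mulr1, addr0, add0r) => -> -> ->.
by apply: vecP; rewrite !mxE /=; ring.
Qed.
End Frame.

Section Fibre.
Variable K : numClosedFieldType.
Local Notation V := 'rV[K]_3.
Local Notation I := 'I_7.

Lemma PGL_equiv_nq (X Y Z a b c : K) p p' :
  let q := nq X Y Z a b c in
  cross (p 0) (p' 0) != 0 -> ~ PGL_equiv (join p q) (join p' q).
Proof.
move=> q nc [g [ug h]].
have [t ht] : exists t, forall v : V, v *m g = t *: v.
  by apply: (@frame_scalar _ X Y Z a b c); apply/simP => i; apply/proj_eq_sym/(h (inr i)).
have [d [nd /= e]] := h (inl 0).
by case/eqP: nc; rewrite e ht crossC scalerA crossZ crossuu scaler0 oppr0.
Qed.

Lemma lambda23_join q r p : config q r -> config p q -> no_other_line q ->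
  lambda23 (join p q) (join q r : label -> V).
Proof.
move=> cf cp no; split; try exact/realizationP.
  by move=> j; exists 1; rewrite oner_neq0 scale1r.
by move=> j; exact: (lambda23_line cf (L := join p q) (fun=> erefl) j no).
Qed.

Lemma fibre_lambda23 N : realization N -> genericity N != 0 ->
  exists L1 L2 L3 L4 : label -> V,
    [/\ [/\ (exists N1, PGL_equiv N N1 /\ lambda23 L1 N1),
            (exists N2, PGL_equiv N N2 /\ lambda23 L2 N2),
            (exists N3, PGL_equiv N N3 /\ lambda23 L3 N3) &
            (exists N4, PGL_equiv N N4 /\ lambda23 L4 N4)],
        [/\ ~ PGL_equiv L1 L2, ~ PGL_equiv L1 L3 & ~ PGL_equiv L1 L4],
        [/\ ~ PGL_equiv L2 L3, ~ PGL_equiv L2 L4 & ~ PGL_equiv L3 L4] &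
        forall L N', PGL_equiv N N' -> lambda23 L N' ->
          [\/ PGL_equiv L L1, PGL_equiv L L2, PGL_equiv L L3 | PGL_equiv L L4]].
Proof.
move=> /realizationP cN; rewrite /genericity mulf_eq0 negb_or => /andP[nd /other_linesP no].
have [rel [M uM [sq sr]]] := normal_form cN.
move: nd no sq sr rel.
set X := nfX _; set Y := nfY _; set Z := nfZ _; set a := nfa _; set b := nfb _; set c := nfc _.
set q := nq X Y Z a b c; set r := nr X Y Z a b c => nd no sq sr rel.
have cf : config q r := config_sim uM sq sr cN.
have fC := nphi_on_cubic rel cf.
have [p1 [p2 [p3 [p4 [[h1 h2 h3 h4] [n12 n13 n14] [n23 n24 n34] hall]]]]] := fibre_config cf fC nd.
have eN : PGL_equiv N (join q r).
  exists (invmx M); split=> [|x]; first by rewrite unitmx_inv.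
  apply: proj_eq_sym.
  by case: x => i; [apply: (simP _ _ _).1 (sim_inv uM sq) i|apply: (simP _ _ _).1 (sim_inv uM sr) i].
exists (join p1 q), (join p2 q), (join p3 q), (join p4 q); split.
- by split; exists (join q r); split=> //; apply: lambda23_join.
- by split; apply: PGL_equiv_nq.
- by split; apply: PGL_equiv_nq.
move=> L N' [g' [ug' hN']] [/realizationP cL _ hNL _].
(* [M] takes the normal form to [N] and [g'] takes [N] to [N'], whose unprimed lines are the primed
   lines of [L]. Hence [G] takes q to the primed lines of [L]. *)
pose G := M *m g'; have uG : G \in unitmx by rewrite unitmx_mul uM.
have sG : sim G q (L \o inr).
  move=> i; have [t nt e] := sq i.
  have [s [ns es]] := proj_eq_trans (proj_eq_sym (hN' (inl i))) (hNL i).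
  by exists (t * s); rewrite ?mulf_neq0 // /G mulmxA e -scalemxAl /= es scalerA.
(* Pulled back by [G], [L] becomes a preimage (p, q) of the normal form, to which [fibre_config]
   applies. *)
pose p i := L (inl i) *m invmx G.
have sp : sim G p (L \o inl) by move=> i; exists 1; rewrite ?oner_neq0 // mulmxKV // scale1r.
have cp := config_sim uG sp sG cL.
have equiv p' : (forall i, exists2 t, t != 0 & p i = t *: p' i) ->
    PGL_equiv L (join p' q).
  move=> h; exists (invmx G); split=> [|[i|i]]; rewrite ?unitmx_inv //=; apply: proj_eq_sym.
    by have [t nt e] := h i; exists t.
  exact: (simP _ _ _).1 (sim_inv uG sG) i.
have := hall p cp => /= -[] /equiv h; by [apply: Or41|apply: Or42|apply: Or43|apply: Or44].
Qed.
End Fibre.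

(* lambda_{2,3} : R_7 --> R_7 is dominant of degree 4: for a generic point
   [N] of R_7 (i.e. N outside a proper Zariski-closed subset {g = 0} of the
   realization space) the fibre of lambda_{2,3} over [N] consists of
   exactly 4 points of R_7. *)
Theorem theorem3p3 (R : realType) :
  let C := (R[i])%C in
  exists g : mpoly.mpoly nvars C,
    (exists N0 : label -> 'rV[C]_3,
        realization N0 /\ mpoly.meval (coords N0) g != 0) /\
    forall N : label -> 'rV[C]_3,
      realization N -> mpoly.meval (coords N) g != 0 ->
      exists L1 L2 L3 L4 : label -> 'rV[C]_3,
        [/\ [/\ (exists N1, PGL_equiv N N1 /\ lambda23 L1 N1),
                (exists N2, PGL_equiv N N2 /\ lambda23 L2 N2),
                (exists N3, PGL_equiv N N3 /\ lambda23 L3 N3) &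
                (exists N4, PGL_equiv N N4 /\ lambda23 L4 N4)],
            [/\ ~ PGL_equiv L1 L2, ~ PGL_equiv L1 L3 & ~ PGL_equiv L1 L4],
            [/\ ~ PGL_equiv L2 L3, ~ PGL_equiv L2 L4 & ~ PGL_equiv L3 L4] &
            forall L N', PGL_equiv N N' -> lambda23 L N' ->
              [\/ PGL_equiv L L1, PGL_equiv L L2, PGL_equiv L L3
                | PGL_equiv L L4]].
Proof.
move=> C; have [g hg] := poly_genericity C; exists g; split.
  by have [N0 [rN0 gN0]] := exists_good_realization C; exists N0; rewrite hg.
by move=> N rN; rewrite hg; apply: fibre_lambda23.
Qed.
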